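(* Let $\rho>\frac12$ and $\frac12<\gamma<1$, and let $w\in C(\mathbb{R}_+;\mathbb{R})$ be $(\rho,\gamma)$-irregular on $\mathbb{R}_+$. Suppose that $s\in\mathbb{R}$ satisfies one of the following conditions: (i) $\frac12<\rho\le\frac{3\gamma}{6\gamma-2}$ and $s>\big(\frac32-3\rho\big)\gamma$; (ii) $\frac{3\gamma}{6\gamma-2}<\rho\le\frac32$ and $s\ge-\rho$; (iii) $\frac12<\gamma<\frac{\sqrt5-1}{2}$, and either (iii.a) $\frac32\le\rho<\frac{3(1-\gamma)^2}{2(-\gamma^2-\gamma+1)}$ and $s\ge-\rho$, or (iii.b) $\rho\ge\frac{3(1-\gamma)^2}{2(-\gamma^2-\gamma+1)}$ and $s>-\frac{4\rho(2\gamma-1)+3(1-\gamma)^2}{2(-\gamma^2+3\gamma-1)}$; (iv) $\frac{\sqrt5-1}{2}\le\gamma<1$, $\rho\ge\frac32$, and $s\ge-\rho$. Then the modulated KdV equation $$\partial_t u+\partial_x^3u\cdot\partial_t w=\partial_x u^2,\qquad u|_{t=0}=u_0,$$ on the circle $\mathbb{T}=\mathbb{R}/(2\pi\mathbb{Z})$ is globally well-posed in $H^s(\mathbb{T})$.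
   Context: Irregularity. Let $\langle a\rangle=(1+a^2)^{1/2}$. For $\rho>0$, $0<\gamma<1$, $T>0$, a function $w\in C([0,T];\mathbb{R})$ is $(\rho,\gamma)$-irregular on $[0,T]$ if $$\|\Phi^w\|_{\mathcal{W}^{\rho,\gamma}_T}:=\sup_{a\in\mathbb{R}}\ \sup_{0\le r<t\le T}\langle a\rangle^\rho\frac{|\Phi^w_{t,r}(a)|}{|t-r|^\gamma}<\infty,\qquad \Phi^w_{t,r}(a)=\int_r^te^{iaw(t')}\,dt'.$$ It is $(\rho,\gamma)$-irregular on $\mathbb{R}_+$ if it is so on $[0,T]$ for every finite $T>0$. Since only $\partial_tw$ enters the equation, $w$ is normalized by $w(0)=0$. Fourier conventions. $\widehat f(n)=\int_{\mathbb{T}}f(x)e^{-inx}\frac{dx}{2\pi}$, $n\in\mathbb{Z}$, and $\|f\|_{H^s(\mathbb{T})}^2=\sum_n\langle n\rangle^{2s}|\widehat f(n)|^2$. Functions are real-valued, and the spatial mean of $f$ is $\widehat f(0)$. Only times $t\ge0$ are considered. Notion of solution (mean-zero data). $U^w(t)=e^{-w(t)\partial_x^3}$ is the modulated linear propagator, i.e. the Fourier multiplier with symbol $e^{iw(t)n^3}$. The modulated interaction representation of $u$ is $\mathbf{u}(t)=U^w(t)^{-1}u(t)$. The bilinear driver is, formally, $X_{t,r}(f_1,f_2)=\int_r^tU^w(t')^{-1}\partial_x\big((U^w(t')f_1)(U^w(t')f_2)\big)dt'$; for mean-zero $f_1,f_2$ it is given by $$\widehat{X_{t,r}(f_1,f_2)}(n)=in\sum_{\substack{n_1,n_2\in\mathbb{Z}\setminus\{0\}\\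 n_1+n_2=n}}\Phi^w_{t,r}(-3nn_1n_2)\,\widehat f_1(n_1)\widehat f_2(n_2),$$ and $X_{t,r}(f)=X_{t,r}(f,f)$. The nonlinear Young integral of $\mathbf{u}$ is the limit in $H^s(\mathbb{T})$ of Riemann–Stieltjes type sums $$\mathcal{I}^X(\mathbf{u})(t)=\lim\sum_{j=0}^{m-1}X_{t_j,t_{j+1}}(\mathbf{u}(t_{j+1})),$$ over partitions $0=t_m<\dots<t_1<t_0=t$ of $[0,t]$ with mesh size tending to $0$. For mean-zero $u_0\in H^s(\mathbb{T})$, $u$ is a solution on $[0,T]\times\mathbb{T}$ with $u|_{t=0}=u_0$ if it has spatial mean zero, $\mathbf{u}\in C^\alpha([0,T];H^s(\mathbb{T}))$ (Hölder continuous of exponent $\alpha$) for some $\alpha\in(1-\gamma,\gamma)$, and $\mathbf{u}(t)=u_0+\mathcal{I}^X(\mathbf{u})(t)$ for $0\le t\le T$. General data. If $u_0$ has spatial mean $\alpha_0$, then $u$ is a solution on $[0,T]\times\mathbb{T}$ with data $u_0$ if the function $v(t,x)=u(t,x-2\alpha_0t)-\alpha_0$ is a solution with mean-zero data $u_0-\alpha_0$, that is, if $v$ has spatial mean zero, its modulated interaction representation $\mathbf{v}(t)=U^w(t)^{-1}v(t)$ belongs to $C^\alpha([0,T];H^s(\mathbb{T}))$ for some $\alpha\in(1-\gamma,\gamma)$, and $\mathbf{v}(t)=u_0-\alpha_0+\mathcal{I}^X(\mathbf{v})(t)$ for $0\le t\le T$ (the equation is invariant under this Galilean transform, and the spatial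 mean is conserved). Global well-posedness in $H^s(\mathbb{T})$: for every $u_0\in H^s(\mathbb{T})$ and every $T>0$ there is a unique solution $u$ on $[0,T]\times\mathbb{T}$ with $u|_{t=0}=u_0$, and the solution map $u_0\mapsto u$ is continuous from $H^s(\mathbb{T})$ to $C([0,T];H^s(\mathbb{T}))$. *)

(* Defs.v *)
From HB Require Import structures.
From mathcomp Require Import all_boot all_order all_algebra.
From mathcomp Require Import complex.
From mathcomp Require Import all_classical all_reals all_analysis.

Set Implicit Arguments.
Unset Strict Implicit.
Unset Printing Implicit Defensive.

Import Order.TTheory GRing.Theory Num.Theory.
Import numFieldNormedType.Exports.

Local Open Scope classical_set_scope.
Local Open Scope ring_scope.

(* A distribution on the circle R/(2 pi Z) is represented by the family of its
   Fourier coefficients; the constants and the translations below act on these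
   families.  The real-valued modulus on R[i] is [normc], since [`|z|] is
   R[i]-valued. *)
Notation coeffs R := (int -> R[i]).
Notation normc := ComplexField.Normc.normc.

Definition japanese (R : realType) (a : R) : R := Num.sqrt (1 + a ^+ 2).

Definition expi (R : realType) (x : R) : R[i] := (cos x +i* sin x)%C.

(* The sum of an absolutely summable family; like the Lebesgue integral, it is
   the difference of the sums of the positive and negative parts. *)
Definition rsum (R : realType) (D : set int) (F : int -> R) : R :=
  fine (\esum_(n in D) (Num.max (F n) 0)%:E)
  - fine (\esum_(n in D) (Num.max (- F n) 0)%:E).

Definition csum (R : realType) (D : set int) (F : int -> R[i]) : R[i] :=
  (rsum D (fun n => complex.Re (F n)) +i* rsum D (fun n => complex.Im (F n)))%C.

Section Irregularity.
Context {R : realType}.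
Implicit Types (w : R -> R) (r t a rho gamma T : R).

(* \int_r^t e^{i a w(t')} dt', for r <= t *)
Definition Phi w t r a : R[i] :=
  (\int[lebesgue_measure]_(t' in `[r, t]) cos (a * w t')
   +i* \int[lebesgue_measure]_(t' in `[r, t]) sin (a * w t'))%C.

Definition Wnorm rho gamma T w : \bar R :=
  ereal_sup [set y | exists a r t, [/\ 0 <= r, r < t, t <= T &
    y = (japanese a `^ rho * (normc (Phi w t r a) / `|t - r| `^ gamma))%:E]].

Definition irregular_on rho gamma T w : Prop := (Wnorm rho gamma T w < +oo)%E.

Definition irregular rho gamma w : Prop :=
  forall T, 0 < T -> irregular_on rho gamma T w.

End Irregularity.

Section Sobolev.
Context {R : realType}.
Implicit Types (f : coeffs R) (s c h alpha t T : R).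

Definition Hnorm s f : \bar R :=
  ((\esum_(n in [set: int])
     (japanese (n%:~R : R) `^ (2 * s) * normc (f n) ^+ 2)%:E) `^ 2^-1)%E.

#[global] Arguments Hnorm _%_R _%_R.

Definition real_valued f : Prop := forall n : int, f (- n) = (f n)^*%C.

Definition Hs s f : Prop := real_valued f /\ (Hnorm s f < +oo)%E.

(* The mean f 0 of a real-valued f is real. *)
Definition mean f : R := complex.Re (f 0).

Definition const_coeffs c : coeffs R := fun n => if n == 0 then c%:C%C else 0.

(* the coefficients of x |-> f (x - h) *)
Definition translate h f : coeffs R := fun n => expi (- (n%:~R * h)) * f n.

Definition holder_Hs alpha T s (u : R -> coeffs R) : Prop :=
  (forall t, 0 <= t <= T -> Hs s (u t)) /\
  exists C : R, forall r t : R, 0 <= r <= T -> 0 <= t <= T ->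
    (Hnorm s (u t - u r) <= (C * `|t - r| `^ alpha)%:E)%E.

Definition continuous_Hs T s (u : R -> coeffs R) : Prop :=
  (forall t, 0 <= t <= T -> Hs s (u t)) /\
  forall t, 0 <= t <= T -> forall eps : R, 0 < eps ->
    exists2 delta : R, 0 < delta &
      forall t', 0 <= t' <= T -> `|t' - t| < delta ->
        (Hnorm s (u t' - u t) < eps%:E)%E.

End Sobolev.

Section ModulatedKdV.
Context {R : realType}.
Implicit Types (w : R -> R) (f : coeffs R) (u v : R -> coeffs R).
Implicit Types (s gamma t r T : R).

(* e^{- theta \partial_x^3} *)
Definition airy (theta : R) f : coeffs R :=
  fun n => expi (theta * n%:~R ^+ 3) * f n.

(* U^w(t) = airy (w t), so U^w(t)^{-1} = airy (- w t). *)
Definition interaction w u : R -> coeffs R := fun t => airy (- w t) (u t).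

(* The bilinear driver X_{t,r}, r <= t, on mean-zero arguments. *)
Definition driver w t r (f1 f2 : coeffs R) : coeffs R := fun n =>
  ('i%C * n%:~R) *
  csum [set n1 | n1 != 0 /\ n - n1 != 0]
    (fun n1 => Phi w t r (- 3 * n%:~R * n1%:~R * (n - n1)%:~R)
               * f1 n1 * f2 (n - n1)).

(* 0 = tau m < ... < tau 1 < tau 0 = t *)
Definition partition_of t (m : nat) (tau : nat -> R) : Prop :=
  [/\ tau 0%N = t, tau m = 0 & forall j, (j < m)%N -> tau j.+1 < tau j].

Definition young_sum w u (m : nat) (tau : nat -> R) : coeffs R :=
  \sum_(j < m) driver w (tau j) (tau j.+1) (u (tau j.+1)) (u (tau j.+1)).

(* I is the limit in H^s of the Riemann-Stieltjes sums as the mesh tends to 0. *)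
Definition is_young_integral w s u t (I : coeffs R) : Prop :=
  Hs s I /\
  forall eps : R, 0 < eps -> exists2 delta : R, 0 < delta &
    forall (m : nat) (tau : nat -> R), partition_of t m tau ->
      (forall j, (j < m)%N -> tau j - tau j.+1 < delta) ->
      (Hnorm s (young_sum w u m tau - I) < eps%:E)%E.

Definition is_solution_mean0 w gamma s T (u0 : coeffs R) v : Prop :=
  [/\ forall t, 0 <= t <= T -> v t 0 = 0,
      exists2 alpha : R, 1 - gamma < alpha < gamma &
        holder_Hs alpha T s (interaction w v)
    & exists I : R -> coeffs R, forall t, 0 <= t <= T ->
        is_young_integral w s (interaction w v) t (I t) /\
        interaction w v t = u0 + I t].

(* v(t,x) = u(t, x - 2 c t) - c *)
Definition galilean (c : R) u : R -> coeffs R :=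
  fun t => translate (2 * c * t) (u t) - const_coeffs c.

Definition is_solution w gamma s T (u0 : coeffs R) u : Prop :=
  is_solution_mean0 w gamma s T (u0 - const_coeffs (mean u0))
    (galilean (mean u0) u).

(* Only the values on [0, T] of a function of time are relevant, so uniqueness
   means equality there. *)
Definition globally_well_posed w gamma s : Prop :=
  forall T, 0 < T ->
  [/\ forall u0 : coeffs R, Hs s u0 -> exists2 u, is_solution w gamma s T u0 u &
        forall u', is_solution w gamma s T u0 u' ->
          forall t, 0 <= t <= T -> u' t = u t,
      forall (u0 : coeffs R) u, Hs s u0 -> is_solution w gamma s T u0 u ->
        continuous_Hs T s u
    & forall (u0 : coeffs R) u, Hs s u0 -> is_solution w gamma s T u0 u ->
        forall eps : R, 0 < eps -> exists2 delta : R, 0 < delta &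
          forall (v0 : coeffs R) v, Hs s v0 -> is_solution w gamma s T v0 v ->
            (Hnorm s (v0 - u0) < delta%:E)%E ->
            forall t, 0 <= t <= T -> (Hnorm s (v t - u t) < eps%:E)%E].

End ModulatedKdV.

(* Main.v *)
(** The interaction representation x of a solution satisfies
    |x_t - x_r - X_{t,r}(x_r, x_r)| <= K (t - r)^z for some z > 1, and conversely;
    here X is bilinear, additive in time and gamma-Hoelder in time with
    gamma > 1/2, so a discrete sewing argument gives local solvability and
    Lipschitz dependence on the data.

    For global bounds the norm of H^s is replaced by the equivalent one with the
    weights m(n) = max(1, |n|/N)^s.  The bounds on X do not depend on N, whereas
    the cubic form <x, X(x, x)>, whose symbol n_1 m(n_1)^2 + n_2 m(n_2)^2 +
    n_3 m(n_3)^2 on n_1 + n_2 + n_3 = 0 vanishes when all |n_i| <= N, gains a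
    factor N^(-beta) with beta = min(2 rho, 3 rho - 3/2 - d), d > 0 small.  Data of
    norm B in H^s have size M ~ N^max(0,-s) B for the new norm, hence a local
    existence time tau ~ M^(-1/gamma), and the energy stays bounded over the
    T/tau steps as soon as N^(-beta) << tau, that is - s < gamma beta.  All the
    cases of the theorem satisfy rho > 1/2, s >= - rho and
    s > (3/2 - 3 rho) gamma, which is what this needs. *)

Require Import Defs.
From HB Require Import structures.
From mathcomp Require Import all_boot all_order all_algebra.
From mathcomp Require Import complex.
From mathcomp Require Import all_classical all_reals all_analysis.
From mathcomp Require Import zify ring lra.

Import Order.TTheory GRing.Theory Num.Theory.
Import numFieldNormedType.Exports.

Set Implicit Arguments.
Unset Strict Implicit.
Unset Printing Implicit Defensive.

Local Open Scope classical_set_scope.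
Local Open Scope ring_scope.

(** * Identities in additive groups *)

(** Everything nonlinear is done on uniform grids of step [h], for sequences whose one-step error is
    at most [e * h]: an Euler polygon has [e = 0], an Euler polygon of half the step read at even
    indices has [e] of order [h ^ (2 gamma - 1)], a solution sampled on a fine grid has [e] as small
    as desired. One a priori bound and one stability estimate thus serve existence, uniqueness and
    dependence on the data. The energy argument is itself a sewing: increments of the squared norm
    are compared with twice the cubic form, so the small factor is needed for the Lipschitz bound of
    the cubic form in its argument, not only for its size.

    Of the three interacting frequencies only the smallest is used for summation, which is why every
    kernel is reduced to [z ^ (- 1/2 - d)] in that frequency, square summable against an [l2]
    family. Lipschitz dependence is obtained for the interaction representation after removal of the
    mean. Going back to [u] multiplies by phases that depend on the mean and are unbounded in the
    frequency, so continuity of the solution map ends with a compactness argument. *)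

Inductive zexp := ZVar of nat | ZAdd of zexp & zexp | ZOpp of zexp | ZZero.

Fixpoint zeval (V : zmodType) (env : seq V) (e : zexp) : V :=
  match e with
  | ZVar k => nth 0 env k
  | ZAdd e1 e2 => zeval env e1 + zeval env e2
  | ZOpp e1 => - zeval env e1
  | ZZero => 0
  end.

Fixpoint zcoef (e : zexp) (k : nat) : int :=
  match e with
  | ZVar j => if j == k then 1 else 0
  | ZAdd e1 e2 => zcoef e1 k + zcoef e2 k
  | ZOpp e1 => - zcoef e1 k
  | ZZero => 0
  end.

(** The value depends only on the integer coefficient of each variable, so comparing coefficients, a
    computation, proves an identity in every [zmodType]. Variables outside the environment evaluate
    to [0], which is why only indices below [size env] count. *)
Lemma zevalE (V : zmodType) (env : seq V) (e : zexp) :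
  zeval env e = \sum_(k < size env) env`_k *~ zcoef e k.
Proof.
elim: e => [j|e1 IH1 e2 IH2|e IH|] /=.
- have [js|sj] := ltnP j (size env); last first.
    rewrite nth_default// big1// => k _; rewrite ifN//.
    by apply: contraTneq (ltn_ord k) => <-; rewrite -leqNgt.
  rewrite (bigD1 (Ordinal js))//= eqxx mulr1z big1 ?addr0// => k kj.
  by rewrite ifN// eq_sym; apply: contra kj => /eqP kj; apply/eqP/val_inj.
- by rewrite IH1 IH2 -big_split/=; apply: eq_bigr => k _; rewrite mulrzDr.
- by rewrite IH -sumrN; apply: eq_bigr => k _; rewrite mulrNz.
- by rewrite big1.
Qed.

Lemma zeval_eq (V : zmodType) (env : seq V) (e1 e2 : zexp) :
  all (fun k => zcoef e1 k == zcoef e2 k) (iota 0 (size env)) ->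
  zeval env e1 = zeval env e2.
Proof.
move=> /allP H; rewrite !zevalE; apply: eq_bigr => k _.
by rewrite (eqP (H k _))// mem_iota add0n leq0n ltn_ord.
Qed.

Ltac zmod_mem x env :=
  lazymatch env with
  | nil => constr:(false)
  | x :: _ => constr:(true)
  | _ :: ?tl => zmod_mem x tl
  end.

Ltac zmod_idx x env :=
  lazymatch env with
  | x :: _ => constr:(0%N)
  | _ :: ?tl => let n := zmod_idx x tl in constr:(S n)
  end.

Ltac zmod_env t env :=
  lazymatch t with
  | (?a + ?b)%R => let env1 := zmod_env a env in zmod_env b env1
  | (- ?a)%R => zmod_env a env
  | 0%R => env
  | _ => lazymatch zmod_mem t env with true => env | false => constr:(t :: env) end
  end.

Ltac zmod_reify t env :=
  lazymatch t with
  | (?a + ?b)%R =>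
      let e1 := zmod_reify a env in let e2 := zmod_reify b env in
      constr:(ZAdd e1 e2)
  | (- ?a)%R => let e1 := zmod_reify a env in constr:(ZOpp e1)
  | 0%R => constr:(ZZero)
  | _ => let n := zmod_idx t env in constr:(ZVar n)
  end.

(** Both sides are reified over a common list of atoms and their coefficients compared by
    computation. *)
Ltac zmod :=
  lazymatch goal with
  | |- @eq ?V ?a ?b =>
      let env0 := zmod_env a (@nil V) in
      let env := zmod_env b env0 in
      let e1 := zmod_reify a env in
      let e2 := zmod_reify b env in
      exact: (@zeval_eq _ env e1 e2 erefl)
  end.

Ltac nneg := repeat first [ assumption | exact: powR_ge0 | exact: normr_ge0
  | exact: ler0n | exact: ler01 | by apply: ltW | apply: mulr_ge0
  | apply: addr_ge0 | apply: exprn_ge0 ].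


(** * Sewing on uniform grids *)

Ltac nlia := repeat match goal with R : realType |- _ => clear dependent R end; lia.

(** The sum of the geometric series of ratio [(2 / 3) ^ (z - 1)]. The ratio comes from bisecting a
    run of [k >= 2] grid steps: the longer half has at most two thirds of the steps, the worst case
    being [k = 3]. *)
Definition sew_const {R : realType} (z : R) : R := (1 - (2 / 3) `^ (z - 1))^-1.

Lemma sew_const_ge1 (R : realType) (z : R) : 1 < z -> 1 <= sew_const z.
Proof.
move=> z1; rewrite /sew_const.
have p0 : 0 < (2 / 3 : R) `^ (z - 1) by apply: powR_gt0; lra.
have p1 : (2 / 3 : R) `^ (z - 1) < 1.
  rewrite [ltRHS](_ : 1 = 1 `^ (z - 1)); last by rewrite powR1.
  by rewrite gt0_ltr_powR ?nnegrE//; lra.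
by rewrite invf_ge1; lra.
Qed.

Lemma sew_constE (R : realType) (z : R) : 1 < z ->
  1 + sew_const z * (2 / 3) `^ (z - 1) = sew_const z.
Proof.
move=> z1; rewrite /sew_const.
have p1 : (2 / 3 : R) `^ (z - 1) < 1.
  rewrite [ltRHS](_ : 1 = 1 `^ (z - 1)); last by rewrite powR1.
  by rewrite gt0_ltr_powR ?nnegrE//; lra.
by field; lra.
Qed.

(** Write [x ^ z = x * x ^ (z - 1)]: the power [z - 1] gains [(2 / 3) ^ (z - 1)] on each part, and
    the linear factors add up to the whole. *)
Lemma powR_split_le (R : realType) (z h : R) (k l : nat) : 1 < z -> 0 <= h ->
  (3 * k <= 2 * (k + l))%N -> (3 * l <= 2 * (k + l))%N ->
  (k%:R * h) `^ z + (l%:R * h) `^ z <=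
    (2 / 3) `^ (z - 1) * ((k + l)%:R * h) `^ z.
Proof.
move=> z1 h0 kl lk.
have aux (m : nat) : (3 * m <= 2 * (k + l))%N ->
    (m%:R * h) `^ z <=
      m%:R * h * ((2 / 3) `^ (z - 1) * ((k + l)%:R * h) `^ (z - 1)).
  move=> mkl; rewrite -[leLHS]mulr_powRB1 ?mulr_ge0 ?ler0n//; last lra.
  apply: ler_wpM2l; first by rewrite mulr_ge0.
  rewrite -powRM; [|lra|by rewrite mulr_ge0].
  apply: ge0_ler_powR; rewrite ?nnegrE ?mulr_ge0//; try lra.
  have : 3 * m%:R <= 2 * (k + l)%:R :> R by rewrite -!natrM ler_nat.
  move=> H; rewrite mulrA ler_wpM2r//. lra.
apply: le_trans (lerD (aux _ kl) (aux _ lk)) _.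
rewrite -[X in _ <= _ * X]mulr_powRB1 ?mulr_ge0//; last lra.
by rewrite natrD; lra.
Qed.

(** The discrete sewing lemma, by bisection of the run. The defect of additivity [L * x ^ z] is paid
    once per generation, and the generations sum to [sew_const z]. The errors [e * h] of single
    steps merely add up to [k * (e * h)]. *)
Lemma sewing_grid (R : realType) (r : nat -> nat -> R) (n p : nat)
    (h e L z : R) : 0 <= h -> 0 <= e -> 0 <= L -> 1 < z ->
  (forall i, (i < n)%N -> r i i.+1 <= e * h) ->
  (forall i k l, (0 < k)%N -> (0 < l)%N -> (k + l <= p)%N ->
    (i + (k + l) <= n)%N ->
    r i (i + (k + l))%N <=
      r i (i + k)%N + r (i + k)%N (i + k + l)%N + L * ((k + l)%:R * h) `^ z) ->
  forall k i, (0 < k <= p)%N -> (i + k <= n)%N ->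
    r i (i + k)%N <= sew_const z * L * (k%:R * h) `^ z + k%:R * (e * h).
Proof.
move=> h0 e0 L0 z1 r1 rs; elim/ltn_ind => k IH i /andP[k0 kp] ikn.
have c1 := sew_const_ge1 z1.
have [k1|k1] := leqP k 1.
  have -> : k = 1%N by nlia.
  rewrite addn1 mul1r mul1r -[leLHS]add0r lerD ?r1//; last nlia.
  by rewrite !mulr_ge0 ?powR_ge0//; lra.
pose k' := k./2; pose l := (k - k')%N.
have kk' : k = (k' + l)%N by rewrite /l /k'; nlia.
have := rs i k' l; rewrite -kk' => /(_ _ _ kp ikn) H.
have k'E : (0 < k')%N by rewrite /k'; nlia.
have lE : (0 < l)%N by rewrite /l /k'; nlia.
apply: le_trans (H k'E lE) _.
have IH1 := IH k' ltac:(rewrite /k'; nlia) i ltac:(apply/andP; split; nlia) ltac:(nlia).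
have IH2 := IH l ltac:(rewrite /l/k'; nlia) (i + k')%N ltac:(apply/andP; split; nlia) ltac:(nlia).
have S := @powR_split_le R z h k' l z1 h0 ltac:(rewrite /l /k'; nlia) ltac:(rewrite /l /k'; nlia).
rewrite -kk' in S.
have /(ler_wpM2l) := S => /(_ (sew_const z * L)).
rewrite mulr_ge0 => [/(_ isT)|//|//]; last lra.
have E := sew_constE z1.
have -> : k%:R * (e * h) = k'%:R * (e * h) + l%:R * (e * h).
  by rewrite -mulrDl -natrD -kk'.
have : L * (k%:R * h) `^ z + sew_const z * L * ((2 / 3) `^ (z - 1) * (k%:R * h) `^ z) =
  sew_const z * L * (k%:R * h) `^ z.
  by rewrite -[in RHS]E; ring.
lra.
Qed.

(** A closed loop between increments [d] and remainders [r]: the defect of [r] contains [d], while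
    [d] is at most [a * x ^ g] plus [r]. On runs no longer than [tau], half of the Hölder constant
    [G] is absorbed thanks to [sew_const (2 * g) * b * tau ^ g <= 1 / 2]; this is the origin of the
    factor [2] in [G]. *)
Lemma sewing_grid_holder (R : realType) (r d : nat -> nat -> R) (n p : nat)
    (h e a b b' g tau : R) :
  0 <= h -> 0 <= e -> 0 <= a -> 0 <= b -> 0 <= b' -> 1 / 2 < g < 1 ->
  p%:R * h <= tau -> sew_const (2 * g) * b * tau `^ g <= 1 / 2 ->
  (forall i, (i < n)%N -> r i i.+1 <= e * h) ->
  (forall i k, (0 < k <= p)%N -> (i + k <= n)%N ->
    d i (i + k)%N <= a * (k%:R * h) `^ g + r i (i + k)%N) ->
  (forall i k l, (0 < k)%N -> (0 < l)%N -> (k + l <= p)%N ->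
    (i + (k + l) <= n)%N ->
    r i (i + (k + l))%N <= r i (i + k)%N + r (i + k)%N (i + k + l)%N
      + ((k + l)%:R * h) `^ g * (b * d i (i + k)%N + b' * ((k + l)%:R * h) `^ g)) ->
  let G := 2 * (a + sew_const (2 * g) * b' * tau `^ g + e * tau `^ (1 - g)) in
  forall k i, (0 < k <= p)%N -> (i + k <= n)%N ->
    d i (i + k)%N <= G * (k%:R * h) `^ g /\
    r i (i + k)%N <= sew_const (2 * g) * (b * G + b') * (k%:R * h) `^ (2 * g)
      + k%:R * (e * h).
Proof.
move=> h0 e0 a0 b0 b'0 /andP[g2 g1] ph tausmall r1 dr rs G.
have c1 : 1 <= sew_const (2 * g) by apply: sew_const_ge1; lra.
have G0 : 0 <= G.
  by rewrite /G !(addr_ge0, mulr_ge0, powR_ge0)//; lra.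
have sq (k : nat) : (k%:R * h) `^ g * (k%:R * h) `^ g = (k%:R * h) `^ (2 * g).
  by rewrite -powRD ?mulr_natl ?mulr2n//; apply/implyP => /eqP; lra.
have dG (k : nat) (i : nat) : (0 < k <= p)%N -> (i + k <= n)%N ->
    r i (i + k)%N <= sew_const (2 * g) * (b * G + b') * (k%:R * h) `^ (2 * g)
      + k%:R * (e * h) -> d i (i + k)%N <= G * (k%:R * h) `^ g.
  move=> kp ikn rk; have := dr i k kp ikn.
  set x := k%:R * h in rk *.
  have x0 : 0 <= x by rewrite mulr_ge0.
  have xtau : x <= tau.
    by apply: le_trans ph; rewrite ler_wpM2r// ler_nat; case/andP: kp.
  have xg : x `^ g <= tau `^ g by rewrite ge0_ler_powR ?nnegrE//; lra.
  have x1g : x `^ (1 - g) <= tau `^ (1 - g) by rewrite ge0_ler_powR ?nnegrE//; lra.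
  have x2g : x `^ (2 * g) = x `^ g * x `^ g by rewrite -sq.
  have xE : x = x `^ g * x `^ (1 - g).
    rewrite -powRD; last by apply/implyP => /eqP; lra.
    by rewrite (_ : g + (1 - g) = 1) ?powRr1//; ring.
  have Xg0 := powR_ge0 x g.
  move: rk; rewrite (_ : k%:R * (e * h) = e * x); last by rewrite /x; ring.
  rewrite x2g {3}xE => rk H; apply: (le_trans H); apply: le_trans (lerD (lexx _) rk) _.
  have T1 : sew_const (2 * g) * (b * G) * x `^ g <= G / 2.
    have : sew_const (2 * g) * b * x `^ g <= 1 / 2.
      by apply: le_trans tausmall; apply: ler_wpM2l xg; apply: mulr_ge0 => //; lra.
    by move=> /(ler_wpM2r G0); lra.
  have T2 : sew_const (2 * g) * b' * x `^ g <= sew_const (2 * g) * b' * tau `^ g.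
    by apply: ler_wpM2l xg; apply: mulr_ge0 => //; lra.
  have T3 : e * x `^ (1 - g) <= e * tau `^ (1 - g) by apply: ler_wpM2l.
  have : (a + sew_const (2 * g) * (b * G) * x `^ g + sew_const (2 * g) * b' * x `^ g
     + e * x `^ (1 - g)) * x `^ g <= G * x `^ g.
    apply: ler_wpM2r => //.
    have GE : G = 2 * (a + sew_const (2 * g) * b' * tau `^ g + e * tau `^ (1 - g)) by [].
    by clear -GE T1 T2 T3; lra.
  by apply: le_trans; rewrite le_eqVlt; apply/orP; left; apply/eqP; ring.
suff H : forall k i, (0 < k <= p)%N -> (i + k <= n)%N ->
    r i (i + k)%N <= sew_const (2 * g) * (b * G + b') * (k%:R * h) `^ (2 * g)
      + k%:R * (e * h).
  by move=> k i kp ikn; split; [apply: dG => //|]; apply: H.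
(* The defect is truncated to windows of length at most q, where the Hölder
   bound is already known for the shorter windows. *)
have main (q : nat) : (q <= p)%N -> forall k i, (0 < k <= q)%N -> (i + k <= n)%N ->
    r i (i + k)%N <= sew_const (2 * g) * (b * G + b') * (k%:R * h) `^ (2 * g)
      + k%:R * (e * h).
  elim: q => [|q IH] qp; first by move=> k i; case: k.
  apply: sewing_grid => //.
  - exact: addr_ge0 (mulr_ge0 b0 G0) b'0.
  - lra.
  move=> i k l k0 l0 klq ikl.
  apply: le_trans (rs i k l k0 l0 _ ikl) _; first nlia.
  rewrite lerD2l.
  have dk : d i (i + k)%N <= G * ((k + l)%:R * h) `^ g.
    apply: (@le_trans _ _ (G * (k%:R * h) `^ g)).
      by apply: dG; [nlia|nlia|apply: IH; nlia].
    apply: ler_wpM2l => //; apply: ge0_ler_powR; rewrite ?nnegrE ?mulr_ge0//; first lra.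
    by rewrite ler_wpM2r// ler_nat; nlia.
  rewrite -sq; set y := ((k + l)%:R * h) `^ g in dk *.
  have y0 : 0 <= y by apply: powR_ge0.
  have := ler_wpM2l b0 dk => H.
  apply: (@le_trans _ _ (y * (b * (G * y) + b' * y))).
    by apply: ler_wpM2l => //; lra.
  by rewrite le_eqVlt; apply/orP; left; apply/eqP; ring.
by move=> k i; apply: (main p).
Qed.

(** * Nonlinear Young equations *)

Section YoungEquation.
Context {R : realType} {V : normedZmodType R}.
Implicit Types (T C gamma a h e B tau t r : R) (X : R -> R -> V -> V -> V).
Implicit Types (u v : nat -> V) (ip : V -> V -> R).

(** [X t r] is the increment from [r] to [t], the later time first. Only a normed group is assumed,
    so bilinearity is additivity in each argument, which is all that difference estimates use. *)
Record young_driver T C gamma X : Prop := YoungDriver {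
  driver_T_ge0 : 0 <= T;
  driver_C_gt0 : 0 < C;
  driver_gamma : 1 / 2 < gamma < 1;
  driverBl : forall t r, 0 <= r <= t -> t <= T -> forall f g k,
    X t r (f - g) k = X t r f k - X t r g k;
  driverBr : forall t r, 0 <= r <= t -> t <= T -> forall f g k,
    X t r k (f - g) = X t r k f - X t r k g;
  driver_chasles : forall t m r, 0 <= r <= m -> m <= t -> t <= T -> forall f g,
    X t r f g = X t m f g + X m r f g;
  driver_le : forall t r, 0 <= r <= t -> t <= T -> forall f g,
    `|X t r f g| <= C * (t - r) `^ gamma * (`|f| * `|g|) }.

(** [ip] is the inner product of the norm. [ip_driver_le] bounds the variation of the cubic form
    [ip f (X t r f f)] with a constant [kappa] meant to be much smaller than that of the driver;
    taking [g = 0] bounds its size. *)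
Record driver_energy T kappa gamma X ip : Prop := DriverEnergy {
  energy_kappa_ge0 : 0 <= kappa;
  ip_sq : forall f g : V, `|f + g| ^+ 2 = `|f| ^+ 2 + 2 * ip f g + `|g| ^+ 2;
  ipDr : forall f g k : V, ip f (g + k) = ip f g + ip f k;
  ip_le : forall f g : V, `|ip f g| <= `|f| * `|g|;
  ip_driver_le : forall t r, 0 <= r <= t -> t <= T -> forall f g : V,
    `|ip f (X t r f f) - ip g (X t r g g)|
      <= kappa * (t - r) `^ gamma * (`|f - g| * (`|f| + `|g|) ^+ 2) }.

Definition defect X a h u (i j : nat) : R :=
  `|u j - u i - X (a + j%:R * h) (a + i%:R * h) (u i) (u i)|.

Definition approx_sol X a h e n u :=
  forall i, (i < n)%N -> defect X a h u i i.+1 <= e * h.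

End YoungEquation.

Lemma driver_quadB (R : realType) (V : normedZmodType R) (T C gamma : R)
    (X : R -> R -> V -> V -> V) : young_driver T C gamma X ->
  forall t r, 0 <= r <= t -> t <= T -> forall f g,
  `|X t r f f - X t r g g| <= C * (t - r) `^ gamma * (`|f - g| * (`|f| + `|g|)).
Proof.
move=> XP t r rt tT f g.
have -> : X t r f f - X t r g g = X t r (f - g) f + X t r g (f - g).
  by rewrite (driverBl XP)// (driverBr XP)// addrA subrK.
apply: le_trans (ler_normD _ _) _.
apply: le_trans (lerD (driver_le XP rt tT _ _) (driver_le XP rt tT _ _)) _.
by rewrite le_eqVlt; apply/orP; left; apply/eqP; ring.
Qed.

Lemma grid_le (R : realType) (a h T : R) (n i j : nat) : 0 <= a -> 0 <= h -> a + n%:R * h <= T ->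
  (i <= j <= n)%N ->
  (0 <= a + i%:R * h <= a + j%:R * h) /\ a + j%:R * h <= T.
Proof.
move=> a0 h0 aT /andP[ij jn]; split.
  rewrite addr_ge0 ?mulr_ge0 ?ler0n//= lerD2l ler_wpM2r// ler_nat//.
by apply: le_trans aT; rewrite lerD2l ler_wpM2r// ler_nat.
Qed.

Lemma gridB (R : realType) (a h : R) (i k : nat) : a + (i + k)%:R * h - (a + i%:R * h) = k%:R * h.
Proof. by rewrite natrD; ring. Qed.

(** By additivity of [X] in time, the defect fails to be additive only through [X] over the second
    interval, taken at [u j] and at [u i]. *)
Lemma defect_split (R : realType) (V : normedZmodType R) (T C gamma a h : R)
    (X : R -> R -> V -> V -> V) (u : nat -> V) (i j l : nat) :
  young_driver T C gamma X -> 0 <= a + i%:R * h <= a + j%:R * h ->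
  a + j%:R * h <= a + l%:R * h -> a + l%:R * h <= T ->
  defect X a h u i l <= defect X a h u i j + defect X a h u j l
    + `|X (a + l%:R * h) (a + j%:R * h) (u j) (u j)
        - X (a + l%:R * h) (a + j%:R * h) (u i) (u i)|.
Proof.
move=> XP ij jl lT; rewrite /defect (driver_chasles XP ij jl lT).
set A := X _ _ (u j) (u j); set A' := X _ _ (u i) (u i); set A'' := X _ _ (u i) (u i).
have -> : u l - u i - (A' + A'') = (u j - u i - A'') + (u l - u j - A) + (A - A').
  by zmod.
by apply: le_trans (ler_normD _ _) _; rewrite lerD2r; exact: ler_normD.
Qed.

Lemma powR_sq_double (R : realType) (g x : R) : 0 < g ->
  x `^ g * x `^ g = x `^ (2 * g).
Proof.
by move=> g0; rewrite -powRD ?mulr_natl ?mulr2n//; apply/implyP => /eqP; lra.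
Qed.

(** [sewing_grid_holder] with the increments of [u] as [d] and its defects as [r]. The bound [B]
    makes the quadratic term Lipschitz with constant [2 * C * B], and no other defect remains, so
    [b' = 0]. The bound is asked strictly before the last index, which lets it serve in an
    induction. *)
Lemma approx_holder (R : realType) (V : normedZmodType R) (T C gamma : R)
    (X : R -> R -> V -> V -> V) (a h e B tau : R) (n p : nat) (u : nat -> V) :
  young_driver T C gamma X ->
  0 <= a -> 0 <= h -> a + n%:R * h <= T -> 0 <= e -> 0 <= B ->
  p%:R * h <= tau -> sew_const (2 * gamma) * (2 * C * B) * tau `^ gamma <= 1 / 2 ->
  approx_sol X a h e n u -> (forall i, (i < n)%N -> `|u i| <= B) ->
  let G := 2 * (C * B ^+ 2 + e * tau `^ (1 - gamma)) in
  forall k i, (0 < k <= p)%N -> (i + k <= n)%N ->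
    `|u (i + k)%N - u i| <= G * (k%:R * h) `^ gamma /\
    defect X a h u i (i + k)%N <=
      sew_const (2 * gamma) * (2 * C * B) * G * (k%:R * h) `^ (2 * gamma)
      + k%:R * (e * h).
Proof.
move=> XP a0 h0 anT e0 B0 ph tauP uapp uB G.
have gammaP := driver_gamma XP; have C0 := driver_C_gt0 XP.
have := @sewing_grid_holder R (defect X a h u) (fun i j => `|u j - u i|) n p h e
  (C * B ^+ 2) (2 * C * B) 0 gamma tau h0 e0.
rewrite mulr0 mul0r !addr0 -/G => H k1 i1 kp1 ikn1.
suff : `|u (i1 + k1)%N - u i1| <= G * (k1%:R * h) `^ gamma /\
    defect X a h u i1 (i1 + k1) <=
    sew_const (2 * gamma) * (2 * C * B * G + 0) * (k1%:R * h) `^ (2 * gamma)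
    + k1%:R * (e * h).
  by rewrite addr0 !mulrA.
apply: H kp1 ikn1 => //.
- by rewrite mulr_ge0 ?exprn_ge0// ltW.
- by rewrite mulr_ge0// mulr_ge0// ltW.
- move=> i k /andP[k0 kp] ikn.
  have [|rt tT] := @grid_le R a h T n i (i + k) a0 h0 anT; first by nlia.
  set A := X (a + (i + k)%:R * h) (a + i%:R * h) (u i) (u i).
  have -> : u (i + k)%N - u i = A + (u (i + k)%N - u i - A) by zmod.
  apply: le_trans (ler_normD _ _) _; rewrite lerD2r.
  apply: le_trans (driver_le XP rt tT _ _) _; rewrite gridB.
  have iB : `|u i| <= B by apply: uB; nlia.
  have -> : C * B ^+ 2 * (k%:R * h) `^ gamma = C * (k%:R * h) `^ gamma * (B * B) by ring.
  apply: ler_wpM2l; first by rewrite mulr_ge0 ?powR_ge0// ltW.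
  exact: ler_pM.
move=> i k l k0 l0 klp ikln.
have [|rm mT] := @grid_le R a h T n i (i + k) a0 h0 anT; first by nlia.
have [|mt tT] := @grid_le R a h T n (i + k) (i + k + l) a0 h0 anT; first by nlia.
case/andP: mt => m0 mt.
rewrite mul0r addr0 addnA; apply: le_trans (defect_split u XP rm mt tT) _.
rewrite lerD2l.
apply: le_trans (driver_quadB XP _ tT _ _) _; first by apply/andP.
rewrite gridB.
have iB : `|u i| <= B by apply: uB; nlia.
have ikB : `|u (i + k)%N| <= B by apply: uB; nlia.
have xy : (l%:R * h) `^ gamma <= ((k + l)%:R * h) `^ gamma.
  apply: ge0_ler_powR; rewrite ?nnegrE ?mulr_ge0//.
    by case/andP: gammaP => g2 _; clear -g2; lra.
  by rewrite ler_wpM2r// ler_nat leq_addl.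
set x := (l%:R * h) `^ gamma in xy *; set y := ((k + l)%:R * h) `^ gamma in xy *.
set d := `|_ - _|.
have -> : y * (2 * C * B * d) = C * y * (d * (B + B)) by ring.
have x0 : 0 <= x by exact: powR_ge0.
apply: ler_pM.
- by rewrite mulr_ge0// ltW.
- by apply: mulr_ge0; [exact: normr_ge0|exact: addr_ge0].
- by rewrite ler_pM2l.
- by apply: ler_wpM2l; [exact: normr_ge0|exact: lerD].
Qed.

Lemma ip_driver_cubic_le (R : realType) (V : normedZmodType R) (T C kappa gamma : R)
    (X : R -> R -> V -> V -> V) (ip : V -> V -> R) :
  young_driver T C gamma X -> driver_energy T kappa gamma X ip ->
  forall t r, 0 <= r <= t -> t <= T -> forall f,
  `|ip f (X t r f f)| <= kappa * (t - r) `^ gamma * `|f| ^+ 3.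
Proof.
move=> XP EP t r rt tT f.
have := ip_driver_le EP rt tT f 0.
have ip0 x : ip 0 x = 0.
  apply/eqP; rewrite -normr_le0.
  by apply: le_trans (ip_le EP _ _) _; rewrite normr0 mul0r.
by rewrite ip0 !subr0 normr0 addr0 -exprS.
Qed.

(** Expanding the square leaves, besides twice the cubic form, the square of the increment, of order
    [h ^ (2 gamma) = h ^ (2 gamma - 1) * h], and the pairing of [u i] with the local error. Divided
    by [h], both vanish with [h] and [e]. *)
Lemma energy_step (R : realType) (V : normedZmodType R) (T C kappa gamma : R)
    (X : R -> R -> V -> V -> V) (ip : V -> V -> R) (h e M : R) (n : nat)
    (u : nat -> V) :
  young_driver T C gamma X -> driver_energy T kappa gamma X ip ->
  0 < h -> n%:R * h <= T -> 0 <= e -> 0 <= M ->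
  approx_sol X 0 h e n u -> forall i, (i < n)%N -> `|u i| <= 2 * M ->
  `| `|u i.+1| ^+ 2 - `|u i| ^+ 2
     - 2 * ip (u i) (X (i.+1%:R * h) (i%:R * h) (u i) (u i))| <=
  (h `^ (2 * gamma - 1) * (4 * C * M ^+ 2 + e * h `^ (1 - gamma)) ^+ 2
   + 4 * M * e) * h.
Proof.
move=> XP EP h0 nT e0 M0 uapp i i_n uM.
have C0 := driver_C_gt0 XP; have /andP[g2 g1] := driver_gamma XP.
have nT0 : 0 + n%:R * h <= T by rewrite add0r.
have [|rt tT] := @grid_le R 0 h T n i i.+1 (lexx _) (ltW h0) nT0; first by nlia.
rewrite !add0r in rt tT.
set x := X _ _ _ _.
have := uapp i i_n; rewrite /defect !add0r -/x.
set rho := _ - _ - _ => rhoe.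
have -> : u i.+1 = u i + (x + rho) by rewrite /rho; zmod.
rewrite (ip_sq EP) (ipDr EP).
have -> : `|u i| ^+ 2 + 2 * (ip (u i) x + ip (u i) rho) + `|x + rho| ^+ 2
   - `|u i| ^+ 2 - 2 * ip (u i) x = `|x + rho| ^+ 2 + 2 * ip (u i) rho by ring.
apply: le_trans (ler_normD _ _) _; rewrite [leRHS]mulrDl; apply: lerD; last first.
  rewrite normrM ger0_norm//.
  have := ip_le EP (u i) rho.
  have : `|u i| * `|rho| <= (2 * M) * (e * h) by apply: ler_pM.
  lra.
rewrite ger0_norm ?exprn_ge0//.
have xM : `|x| <= 4 * C * M ^+ 2 * h `^ gamma.
  apply: le_trans (driver_le XP rt tT _ _) _.
  have := gridB 0 h i 1; rewrite !add0r addn1 mul1r => ->.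
  have -> : 4 * C * M ^+ 2 * h `^ gamma = C * h `^ gamma * ((2 * M) * (2 * M)) by ring.
  apply: ler_wpM2l; first by rewrite mulr_ge0 ?powR_ge0// ltW.
  exact: ler_pM.
have hE : h = h `^ (1 - gamma) * h `^ gamma.
  by rewrite -powRD ?subrK ?powRr1 ?ltW// oner_eq0.
have hE2 : h `^ (2 * gamma - 1) * h = h `^ gamma ^+ 2.
  rewrite -{2}(powRr1 (ltW h0)) -powRD ?subrK -?powR_sq_double//; first lra.
  by apply/implyP => /eqP; lra.
have : `|x + rho| <= (4 * C * M ^+ 2 + e * h `^ (1 - gamma)) * h `^ gamma.
  apply: le_trans (ler_normD _ _) _; rewrite [leRHS]mulrDl -(mulrA e) -hE; exact: lerD.
move=> H; rewrite mulrAC hE2 -exprMn mulrC.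
rewrite lerXn2r ?nnegrE//; exact: le_trans (normr_ge0 _) H.
Qed.

(** Sewing for the energy: the change of the squared norm over a run, minus twice the cubic form at
    its start, is additive up to a variation of the cubic form, which the Hölder bound on [u] and
    [ip_driver_le] make of order [2 gamma]. The constant [80] is [64] from the sewing plus [2 * 8]
    from the cubic form at norm [2 * M]. *)
Lemma energy_window (R : realType) (V : normedZmodType R) (T C kappa gamma : R)
    (X : R -> R -> V -> V -> V) (ip : V -> V -> R) (h e e' M tau : R) (n p : nat)
    (u : nat -> V) :
  young_driver T C gamma X -> driver_energy T kappa gamma X ip ->
  0 < h -> n%:R * h <= T -> 0 <= e -> 0 < M ->
  sew_const (2 * gamma) * C * M * tau `^ gamma <= 1 / 8 ->
  p%:R * h <= tau -> e * tau `^ (1 - gamma) <= 4 * C * M ^+ 2 ->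
  h `^ (2 * gamma - 1) * (4 * C * M ^+ 2 + e * h `^ (1 - gamma)) ^+ 2
    + 4 * M * e <= e' ->
  approx_sol X 0 h e n u -> (forall i, (i < n)%N -> `|u i| <= 2 * M) ->
  forall k i, (0 < k <= p)%N -> (i + k <= n)%N ->
    `|u (i + k)%N| ^+ 2 <=
      `|u i| ^+ 2 + 80 * kappa * M ^+ 3 * tau `^ gamma + tau * e'.
Proof.
move=> XP EP h0 nT e0 M0 tauC pt etau ee' uapp uM.
have C0 := driver_C_gt0 XP; have /andP[g2 g1] := driver_gamma XP.
have k0 := energy_kappa_ge0 EP.
have c1 : 1 <= sew_const (2 * gamma) by apply: sew_const_ge1; lra.
have e'0 : 0 <= e'.
  by apply: le_trans ee'; nneg.
have M0' := ltW M0; have h0' := ltW h0.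
have nT0 : 0 + n%:R * h <= T by rewrite add0r.
have tauC2 : sew_const (2 * gamma) * (2 * C * (2 * M)) * tau `^ gamma <= 1 / 2 by lra.
have M20 : 0 <= 2 * M by rewrite mulr_ge0.
have H := approx_holder XP (lexx 0) h0' nT0 e0 M20 pt tauC2 uapp uM.
set G := 2 * (C * (2 * M) ^+ 2 + e * tau `^ (1 - gamma)) in H.
have G16 : G <= 16 * C * M ^+ 2 by rewrite /G exprMn; lra.
pose L := 32 * kappa * M ^+ 2 * (16 * C * M ^+ 2).
have L0 : 0 <= L by rewrite /L; nneg.
pose r i j := `| `|u j| ^+ 2 - `|u i| ^+ 2
   - 2 * ip (u i) (X (j%:R * h) (i%:R * h) (u i) (u i))|.
have rle : forall k i, (0 < k <= p)%N -> (i + k <= n)%N ->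
    r i (i + k)%N <= sew_const (2 * gamma) * L * (k%:R * h) `^ (2 * gamma)
      + k%:R * (e' * h).
  apply: sewing_grid => //; first lra.
    move=> i i_n.
    have uiM := uM i i_n.
    apply: le_trans (energy_step XP EP h0 nT e0 M0' uapp i_n uiM) _.
    by rewrite ler_wpM2r.
  move=> i k l k_gt0 l_gt0 klp ikln.
  have [|rm mT] := @grid_le R 0 h T n i (i + k) (lexx 0) h0' nT0; first by nlia.
  have [|mt tT] := @grid_le R 0 h T n (i + k) (i + k + l) (lexx 0) h0' nT0; first by nlia.
  rewrite !add0r in rm mT mt tT.
  case/andP: (mt) => _ mt'.
  have uiM : `|u i| <= 2 * M by apply: uM; nlia.
  have uikM : `|u (i + k)%N| <= 2 * M by apply: uM; nlia.
  have := driver_chasles XP rm mt' tT (u i) (u i).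
  rewrite /r addnA => ->; rewrite (ipDr EP).
  set A := X _ _ _ _; set B := X _ _ _ _; set A' := X _ _ (u (i + k)%N) _.
  have := ip_driver_le EP mt tT (u (i + k)%N) (u i).
  rewrite -/A -/A'.
  have := gridB 0 h (i + k) l; rewrite !add0r => ->.
  have [|| dG _] := H k i; [by nlia|by nlia|].
  set d := `|u (i + k)%N - u i| in dG *.
  move=> ipd.
  have kl1 (q : nat) : (q <= k + l)%N -> (q%:R * h) `^ gamma <= ((k + l)%:R * h) `^ gamma.
    move=> qkl; apply: ge0_ler_powR; rewrite ?nnegrE ?mulr_ge0//; first lra.
    by rewrite ler_wpM2r// ler_nat.
  have kk := kl1 k (leq_addr _ _); have ll := kl1 l (leq_addl _ _).
  rewrite -powR_sq_double; last lra.
  set y := ((k + l)%:R * h) `^ gamma in kk ll *.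
  have dy : d <= 16 * C * M ^+ 2 * y.
    apply: (le_trans dG); apply: ler_pM => //; try exact: powR_ge0.
    by rewrite /G; nneg.
  have sq16 : (`|u (i + k)%N| + `|u i|) ^+ 2 <= (4 * M) ^+ 2.
    rewrite lerXn2r ?nnegrE ?addr_ge0//; first by rewrite mulr_ge0.
    have -> : 4 * M = 2 * M + 2 * M by ring.
    exact: lerD.
  have ipd' : 2 * `|ip (u (i + k)%N) A' - ip (u i) A| <= L * (y * y).
    apply: (@le_trans _ _ (2 * (kappa * y * (16 * C * M ^+ 2 * y * (4 * M) ^+ 2)))).
      rewrite ler_pM2l//; apply: (le_trans ipd); apply: ler_pM.
      - by nneg.
      - by nneg.
      - by rewrite ler_wpM2l.
      - by apply: ler_pM => //; nneg.
    by rewrite le_eqVlt; apply/orP; left; apply/eqP; rewrite /L; ring.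
  set E1 := `|u (i + k + l)%N| ^+ 2; set E2 := `|u (i + k)%N| ^+ 2; set E3 := `|u i| ^+ 2.
  have -> : E1 - E3 - 2 * (ip (u i) A + ip (u i) B) =
    (E2 - E3 - 2 * ip (u i) B) + (E1 - E2 - 2 * ip (u (i + k)%N) A')
    + 2 * (ip (u (i + k)%N) A' - ip (u i) A) by ring.
  apply: le_trans (ler_normD _ _) _; apply: lerD; first exact: ler_normD.
  by rewrite normrM ger0_norm.
move=> k i kp ikn.
have := rle k i kp ikn; rewrite /r.
have [|rt tT] := @grid_le R 0 h T n i (i + k) (lexx 0) h0' nT0; first by nlia.
rewrite !add0r in rt tT.
have uiM : `|u i| <= 2 * M by apply: uM; nlia.
have := ip_driver_cubic_le XP EP rt tT (u i).
set A := X _ _ _ _.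
have := gridB 0 h i k; rewrite !add0r => ->.
set x := k%:R * h.
have x0 : 0 <= x by rewrite mulr_ge0.
have xtau : x <= tau.
  by apply: le_trans pt; rewrite ler_wpM2r// ler_nat; nlia.
have xg : x `^ gamma <= tau `^ gamma by rewrite ge0_ler_powR ?nnegrE//; lra.
rewrite -powR_sq_double; last lra.
set z := x `^ gamma in xg *; set w := tau `^ gamma in xg tauC *.
have z0 : 0 <= z by exact: powR_ge0.
move=> cub rr.
have cub' : `|ip (u i) A| <= kappa * w * (2 * M) ^+ 3.
  apply: (le_trans cub); apply: ler_pM; [by nneg|by nneg|by rewrite ler_wpM2l|].
  by rewrite lerXn2r ?nnegrE.
have S1 : sew_const (2 * gamma) * L * (z * z) <= 64 * kappa * M ^+ 3 * w.
  apply: (@le_trans _ _ (sew_const (2 * gamma) * L * (w * w))).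
    apply: ler_wpM2l; first by rewrite mulr_ge0//; lra.
    exact: ler_pM.
  have -> : sew_const (2 * gamma) * L * (w * w) =
    512 * (sew_const (2 * gamma) * C * M * w) * (kappa * M ^+ 3 * w) by rewrite /L; ring.
  have N0 : 0 <= kappa * M ^+ 3 * w by nneg.
  by have := ler_wpM2r N0 tauC; clear; lra.
have S2 : k%:R * (e' * h) <= tau * e'.
  have -> : k%:R * (e' * h) = x * e' by rewrite /x; ring.
  by rewrite ler_wpM2r.
have := le_trans (ler_norm _) rr.
have := le_trans (ler_norm _) cub'.
have -> : (2 * M) ^+ 3 = 8 * M ^+ 3 by ring.
by clear -S1 S2; lra.
Qed.

Lemma grid_window (R : realType) (h tau : R) : 0 < h -> 0 < tau -> h <= tau / 2 ->
  exists p : nat, [/\ (0 < p)%N, p%:R * h <= tau & tau / 2 <= p%:R * h].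
Proof.
move=> h0 tau0 htau.
pose p := Num.truncn (tau / h).
have tauh : 0 <= tau / h by rewrite divr_ge0 ?ltW.
have /andP[p1 p2] := truncn_itv tauh; rewrite -/p in p1 p2.
have pt : p%:R * h <= tau by rewrite -ler_pdivlMr.
have pgt0 : (0 < p)%N.
  by rewrite truncn_gt0 ler_pdivlMr// mul1r; lra.
have pt2 : tau / 2 <= p%:R * h.
  have : tau < p.+1%:R * h by rewrite -ltr_pdivrMr.
  have : 1 * h <= p%:R * h by rewrite ler_pM2r// ler1n.
  by rewrite -natr1; lra.
by exists p.
Qed.

(** A bootstrap in the index: the bound [2 * M] strictly before [i] suffices to run [energy_window]
    up to [i]. At most [2 * T / tau + 1 <= 3 * T / tau] windows of [p] steps are needed. Over all of
    them the [kappa] part and the [e'] part of the cost are at most [M ^ 2] each, so the squared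
    norm stays at most [3 * M ^ 2], below [(2 * M) ^ 2]. *)
Lemma apriori_grid (R : realType) (V : normedZmodType R) (T C kappa gamma : R)
    (X : R -> R -> V -> V -> V) (ip : V -> V -> R) (h e e' M tau : R) (n : nat)
    (u : nat -> V) :
  young_driver T C gamma X -> driver_energy T kappa gamma X ip ->
  0 < h -> n%:R * h <= T -> 0 <= e -> 0 < M -> 0 < tau <= T ->
  sew_const (2 * gamma) * C * M * tau `^ gamma <= 1 / 8 ->
  240 * T * kappa * M * tau `^ gamma <= tau ->
  h <= tau / 2 -> e * tau `^ (1 - gamma) <= 4 * C * M ^+ 2 ->
  h `^ (2 * gamma - 1) * (4 * C * M ^+ 2 + e * h `^ (1 - gamma)) ^+ 2
    + 4 * M * e <= e' -> 3 * T * e' <= M ^+ 2 ->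
  approx_sol X 0 h e n u -> `|u 0%N| <= M ->
  forall i, (i <= n)%N -> `|u i| <= 2 * M.
Proof.
move=> XP EP h0 nT e0 M0 /andP[tau0 tauT] tauC kT htau etau ee' e'T uapp u0.
have k0 := energy_kappa_ge0 EP.
elim/ltn_ind => i IH i_n.
have [p [pgt0 pt pt2]] := grid_window h0 tau0 htau.
have uM j : (j < i)%N -> `|u j| <= 2 * M by move=> ji; apply: IH => //; nlia.
have iT : i%:R * h <= T by apply: le_trans nT; rewrite ler_pM2r// ler_nat.
have uapp' : approx_sol X 0 h e i u by move=> j ji; apply: uapp; nlia.
have W := energy_window XP EP h0 iT e0 M0 tauC pt etau ee' uapp' uM.
pose D := 80 * kappa * M ^+ 3 * tau `^ gamma + tau * e'.
have {}W k j : (0 < k <= p)%N -> (j + k <= i)%N ->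
    `|u (j + k)%N| ^+ 2 <= `|u j| ^+ 2 + D.
  by move=> kp jki; rewrite addrA; exact: W.
have e'0 : 0 <= e'.
  have C0 := driver_C_gt0 XP.
  by apply: le_trans ee'; nneg.
have D0 : 0 <= D.
  by rewrite /D; nneg.
have DE : D = 80 * kappa * M ^+ 3 * tau `^ gamma + tau * e' by [].
clearbody D.
have E (q : nat) : forall j, (j <= q * p)%N -> (j <= i)%N ->
    `|u j| ^+ 2 <= M ^+ 2 + q%:R * D.
  elim: q => [|q IHq] j jq ji.
    have -> : j = 0%N by nlia.
    by rewrite mul0r addr0 lerXn2r ?nnegrE// ltW.
  have [jq'|jq'] := leqP j (q * p).
    apply: le_trans (IHq j jq' ji) _; rewrite lerD2l ler_wpM2r// ler_nat//.
  have jE : j = (q * p + (j - q * p))%N by nlia.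
  have := W (j - q * p)%N (q * p)%N; rewrite -jE => /(_ _ ji) Wj.
  apply: le_trans (Wj _) _; first by rewrite mulSn in jq; nlia.
  rewrite -natr1 mulrDl mul1r addrA lerD2r.
  by apply: IHq; nlia.
have iq : (i <= (i %/ p).+1 * p)%N by rewrite ltnW// ltn_ceil.
have := E _ i iq (leqnn i).
have qT : (i %/ p)%N%:R * tau <= 2 * T.
  have : ((i %/ p) * p)%N%:R * h <= T.
    by apply: le_trans iT; rewrite ler_pM2r// ler_nat leq_trunc_div.
  rewrite natrM -mulrA => qp.
  have : (i %/ p)%:R * (tau / 2) <= (i %/ p)%:R * (p%:R * h) by rewrite ler_wpM2l.
  lra.
have qT3 : (i %/ p).+1%:R * tau <= 3 * T by rewrite -natr1 mulrDl mul1r; lra.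
have DD : tau * ((i %/ p).+1%:R * D) <= tau * (2 * M ^+ 2).
  apply: (@le_trans _ _ (3 * T * D)).
    by rewrite mulrA (mulrC tau) ler_wpM2r.
  have := ler_wpM2r (exprn_ge0 2 (ltW M0)) kT.
  have := ler_wpM2l (ltW tau0) e'T.
  by rewrite DE; lra.
have : (i %/ p).+1%:R * D <= 2 * M ^+ 2 by rewrite -(ler_pM2l tau0).
move=> D2 uE.
rewrite -(@ler_pXn2r _ 2)// ?nnegrE ?mulr_ge0//; last exact: ltW.
apply: (le_trans uE); rewrite exprMn.
have : 0 <= M ^+ 2 by exact: exprn_ge0 (ltW M0).
lra.
Qed.

(** With [dd] the increment of the difference [u - v], bilinearity writes the double difference as
    two terms in [dd], to be absorbed by sewing, and two terms pairing the difference itself, of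
    size [D], with an increment of one solution, of size [G * y]. *)
Lemma driver_quad_diff (R : realType) (V : normedZmodType R) (T C gamma : R)
    (X : R -> R -> V -> V -> V) : young_driver T C gamma X ->
  forall t r, 0 <= r <= t -> t <= T -> forall (B D G y : R) (u u' v v' : V),
  0 <= G * y -> `|u'| <= B -> `|v| <= B ->
  `|u - v| <= D -> `|u' - v'| <= D ->
  `|u' - u| <= G * y -> `|v' - v| <= G * y ->
  `|(X t r u' u' - X t r u u) - (X t r v' v' - X t r v v)| <=
    C * (t - r) `^ gamma * (2 * B * `|(u' - v') - (u - v)| + 2 * D * G * y).
Proof.
move=> XP t r rt tT B D G y u u' v v' Gy u'B vB D1 D2 G1 G2.
have C0 := driver_C_gt0 XP.
pose dd := (u' - v') - (u - v).
have -> : (X t r u' u' - X t r u u) - (X t r v' v' - X t r v v) =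
    (X t r dd u' + X t r (v' - v) (u' - v'))
    + (X t r (u - v) (u' - u) + X t r v dd).
  by rewrite /dd !(driverBl XP) ?(driverBr XP)//; zmod.
have le f g : `|X t r f g| <= C * (t - r) `^ gamma * (`|f| * `|g|).
  exact: (driver_le XP).
have P0 : 0 <= C * (t - r) `^ gamma by nneg.
apply: le_trans (ler_normD _ _) _.
apply: le_trans (lerD (ler_normD _ _) (ler_normD _ _)) _.
have t1 := le_trans (le dd u') (ler_wpM2l P0 (ler_wpM2l (normr_ge0 _) u'B)).
have t2 := le_trans (le (v' - v) (u' - v')) (ler_wpM2l P0 (ler_pM (normr_ge0 _) (normr_ge0 _) G2 D2)).
have t3 := le_trans (le (u - v) (u' - u)) (ler_wpM2l P0 (ler_pM (normr_ge0 _) (normr_ge0 _) D1 G1)).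
have t4 := le_trans (le v dd) (ler_wpM2l P0 (ler_pM (normr_ge0 _) (normr_ge0 _) vB (lexx _))).
apply: le_trans (lerD (lerD t1 t2) (lerD t3 t4)) _.
by rewrite le_eqVlt; apply/orP; left; apply/eqP; rewrite /dd; ring.
Qed.

(** Sewing of the difference of the two remainders. By induction the difference of the sequences is
    at most [D] before index [i]; the sewing bound turns this into an increment of at most
    [D / 2 + 4 * e * tau], and [D] is chosen so that adding the initial difference reproduces
    [D]. *)
Lemma stability_window (R : realType) (V : normedZmodType R) (T C gamma : R)
    (X : R -> R -> V -> V -> V) (a h e B tau : R) (n : nat) (u v : nat -> V) :
  young_driver T C gamma X ->
  0 <= a -> 0 <= h -> a + n%:R * h <= T -> 0 <= e -> 0 <= B ->
  n%:R * h <= tau -> 16 * sew_const (2 * gamma) * C * B * tau `^ gamma <= 1 ->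
  e * tau `^ (1 - gamma) <= C * B ^+ 2 ->
  approx_sol X a h e n u -> approx_sol X a h e n v ->
  (forall i, (i <= n)%N -> `|u i| <= B) -> (forall i, (i <= n)%N -> `|v i| <= B) ->
  forall i, (i <= n)%N -> `|u i - v i| <= 2 * `|u 0%N - v 0%N| + 8 * e * tau.
Proof.
move=> XP a0 h0 anT e0 B0 nt tauB etau uapp vapp uB vB.
have C0 := driver_C_gt0 XP; have gP := driver_gamma XP; have /andP[g2 g1] := gP.
have c1 : 1 <= sew_const (2 * gamma) by apply: sew_const_ge1; lra.
have tau0 : 0 <= tau by apply: le_trans nt; nneg.
set D := 2 * _ + _.
have D0 : 0 <= D by rewrite /D; nneg.
elim/ltn_ind => i IH i_n.
have [->|i0] := eqVneq i 0%N.
  have : 0 <= e * tau by nneg.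
  by have := normr_ge0 (u 0%N - v 0%N); rewrite /D; clear; lra.
have dB j : (j < i)%N -> `|u j - v j| <= D.
  by move=> ji; apply: IH => //; nlia.
have tg0 : 0 <= tau `^ gamma by exact: powR_ge0.
have CBt : C * B * tau `^ gamma <= 1 / 16.
  have : 0 <= C * B * tau `^ gamma by nneg.
  move=> P0; have := ler_wpM2r P0 c1; clear -tauB; lra.
have tauC2 : sew_const (2 * gamma) * (2 * C * B) * tau `^ gamma <= 1 / 2.
  by clear -tauB; lra.
have uB' j : (j < n)%N -> `|u j| <= B by move=> jn; apply: uB; nlia.
have vB' j : (j < n)%N -> `|v j| <= B by move=> jn; apply: vB; nlia.
have Hu := approx_holder XP a0 h0 anT e0 B0 nt tauC2 uapp uB'.
have Hv := approx_holder XP a0 h0 anT e0 B0 nt tauC2 vapp vB'.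
rewrite /= in Hu Hv.
set G := 2 * (C * B ^+ 2 + _) in Hu Hv.
have G4 : G <= 4 * C * B ^+ 2 by rewrite /G; clear -etau; lra.
have G0 : 0 <= G by rewrite /G; nneg.
clearbody G.
pose rem (w : nat -> V) (j k : nat) := w k - w j - X (a + k%:R * h) (a + j%:R * h) (w j) (w j).
pose r j k := `|rem u j k - rem v j k|.
pose d j k := `|(u k - v k) - (u j - v j)|.
have ih : i%:R * h <= tau by apply: le_trans nt; rewrite ler_wpM2r// ler_nat.
have a1 : 0 <= 2 * C * B * D by nneg.
have b1 : 0 <= 2 * C * B by nneg.
have b2 : 0 <= 2 * C * D * G by nneg.
have e2 : 0 <= 2 * e by nneg.
have tauC3 : sew_const (2 * gamma) * (2 * C * B) * tau `^ gamma <= 1 / 2.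
  by clear -tauB; lra.
have W := @sewing_grid_holder R r d i i h (2 * e) (2 * C * B * D) (2 * C * B)
  (2 * C * D * G) gamma tau h0 e2 a1 b1 b2 gP ih tauC3.
have [||||| dG _] := W _ _ _ i 0%N.
- move=> j ji.
  have j_n : (j < n)%N by nlia.
  apply: le_trans (ler_normB _ _) _.
  have := uapp j j_n; have := vapp j j_n; rewrite /defect -/(rem u j j.+1) -/(rem v j j.+1).
  by clear; lra.
- move=> j k kp jki.
  have [|rt tT] := @grid_le R a h T n j (j + k) a0 h0 anT; first by nlia.
  pose A (w : nat -> V) := X (a + (j + k)%:R * h) (a + j%:R * h) (w j) (w j).
  have -> : d j (j + k)%N = `|(A u - A v) + (rem u j (j + k)%N - rem v j (j + k)%N)|.
    by rewrite /d /rem /A; congr `|_|; zmod.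
  apply: le_trans (ler_normD _ _) _; rewrite lerD2r.
  apply: le_trans (driver_quadB XP rt tT _ _) _; rewrite gridB.
  have -> : 2 * C * B * D * (k%:R * h) `^ gamma = C * (k%:R * h) `^ gamma * (D * (B + B)) by ring.
  apply: ler_wpM2l; first by nneg.
  apply: ler_pM; [by nneg|by nneg|apply: dB; nlia|].
  by apply: lerD; [apply: uB; nlia|apply: vB; nlia].
- move=> j k l k0 l0 kli jkli.
  have [|rm mT] := @grid_le R a h T n j (j + k) a0 h0 anT; first by nlia.
  have [|mt tT] := @grid_le R a h T n (j + k) (j + k + l) a0 h0 anT; first by nlia.
  case/andP: (mt) => _ mt'.
  pose A (w : nat -> V) (q : nat) := X (a + (j + k + l)%:R * h) (a + (j + k)%:R * h) (w q) (w q).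
  have key w : rem w j (j + k + l)%N = rem w j (j + k)%N + rem w (j + k)%N (j + k + l)%N
      + (A w (j + k)%N - A w j).
    by rewrite /rem (driver_chasles XP rm mt' tT (w j) (w j)) /A; zmod.
  rewrite addnA /r !key.
  set x1 := rem u _ _; set x2 := rem u _ _; set y1 := rem v _ _; set y2 := rem v _ _.
  have -> : x1 + x2 + (A u (j + k)%N - A u j) - (y1 + y2 + (A v (j + k)%N - A v j)) =
    (x1 - y1) + (x2 - y2) + ((A u (j + k)%N - A u j) - (A v (j + k)%N - A v j)) by zmod.
  apply: le_trans (ler_normD _ _) _; apply: lerD; first exact: ler_normD.
  have [|| uG _] := Hu k j; [by nlia|by nlia|].
  have [|| vG _] := Hv k j; [by nlia|by nlia|].
  have mono (q : nat) : (q <= k + l)%N -> (q%:R * h) `^ gamma <= ((k + l)%:R * h) `^ gamma.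
    move=> qkl; apply: ge0_ler_powR; rewrite ?nnegrE ?mulr_ge0//; first by clear -g2; lra.
    by rewrite ler_wpM2r// ler_nat.
  have kk := mono k (leq_addr _ _); have ll := mono l (leq_addl _ _).
  have Gy0 : 0 <= G * (k%:R * h) `^ gamma by nneg.
  apply: le_trans (driver_quad_diff XP mt tT Gy0 _ _ _ _ uG vG) _.
  + exact: (uB (j + k)%N ltac:(nlia)).
  + exact: (vB j ltac:(nlia)).
  + exact: (dB j ltac:(nlia)).
  + exact: (dB (j + k)%N ltac:(nlia)).
  rewrite gridB -/(d j (j + k)%N).
  set y := ((k + l)%:R * h) `^ gamma in kk ll *.
  have -> : y * (2 * C * B * d j (j + k)%N + 2 * C * D * G * y) =
    C * y * (2 * B * d j (j + k)%N + 2 * D * G * y) by ring.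
  apply: ler_pM.
  + by nneg.
  + by nneg.
  + by apply: ler_wpM2l => //; exact: ltW.
  + by rewrite lerD2l; apply: ler_wpM2l => //; nneg.
- by rewrite lt0n i0 leqnn.
- by rewrite add0n leqnn.
rewrite add0n in dG.
have DE : D = 2 * `|u 0%N - v 0%N| + 8 * e * tau by [].
have ui : `|u i - v i| <= `|u 0%N - v 0%N| + d 0%N i.
  have -> : u i - v i = (u 0%N - v 0%N) + (u i - v i - (u 0%N - v 0%N)) by zmod.
  exact: ler_normD.
apply: (le_trans ui); clear ui.
have ihg : (i%:R * h) `^ gamma <= tau `^ gamma.
  by apply: ge0_ler_powR; rewrite ?nnegrE ?mulr_ge0//; clear -g2; lra.
have tE : tau `^ (1 - gamma) * tau `^ gamma = tau.
  by rewrite -powRD ?subrK ?powRr1// oner_eq0.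
clearbody D; clear Hu Hv dB IH.
move: dG; set G' := 2 * _ => dG.
have G'0 : 0 <= G' by rewrite /G'; nneg; clear -c1; lra.
have {}dG := le_trans dG (ler_wpM2l G'0 ihg).
suff : G' * tau `^ gamma <= D / 2 + 4 * e * tau by rewrite DE in dG *; clear -dG; lra.
rewrite /G'; set w := tau `^ gamma in tE tauB CBt tg0 *; clearbody w.
set z := tau `^ (1 - gamma) in tE *; clearbody z.
set c := sew_const _ in c1 tauB *; clearbody c.
have -> : 2 * (2 * C * B * D + c * (2 * C * D * G) * w + 2 * e * z) * w =
  4 * (C * B * w) * D + 4 * D * (c * C * G * w * w) + 4 * e * (z * w) by ring.
rewrite tE lerD2r.
have q1 : c * C * G * w * w <= c * C * (4 * C * B ^+ 2) * w * w.
  have N : 0 <= c * C * w * w by nneg; clear -c1; lra.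
  by have := ler_wpM2l N G4; clear; lra.
have q2 : c * C * (4 * C * B ^+ 2) * w * w <= 1 / 64.
  have -> : c * C * (4 * C * B ^+ 2) * w * w = 4 * ((c * C * B * w) * (C * B * w)) by ring.
  have : (c * C * B * w) * (C * B * w) <= (1 / 16) * (1 / 16).
    by apply: ler_pM => //; [nneg; clear -c1; lra|nneg|clear -tauB; lra].
  by clear; lra.
have q3 := ler_wpM2l D0 (le_trans q1 q2).
have q4 := ler_wpM2l D0 CBt.
by clear -q3 q4 D0; lra.
Qed.

Lemma approx_sol_shift (R : realType) (V : normedZmodType R)
    (X : R -> R -> V -> V -> V) (a h e : R) (m n : nat) (u : nat -> V) :
  approx_sol X a h e (m + n) u ->
  approx_sol X (a + m%:R * h) h e n (fun j => u (m + j)%N).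
Proof.
move=> uapp i i_n; have /uapp : (m + i < m + n)%N by rewrite ltn_add2l.
by rewrite /defect -!addrA -!mulrDl -!natrD addnS.
Qed.

Lemma approx_sol_le (R : realType) (V : normedZmodType R)
    (X : R -> R -> V -> V -> V) (a h e e' : R) (m n : nat) (u : nat -> V) :
  0 <= h -> e <= e' -> (m <= n)%N -> approx_sol X a h e n u -> approx_sol X a h e' m u.
Proof.
move=> h0 ee' mn uapp i im; apply: le_trans (uapp i _) _; first by nlia.
exact: ler_wpM2r.
Qed.

(** Each window costs a factor [2]. Windows have length at least [tau / 2], hence the condition
    [2 * T <= Q * tau]. Adding [8 * e * tau] to the difference makes the recursion purely
    multiplicative. *)
Lemma stability_grid (R : realType) (V : normedZmodType R) (T C gamma : R)
    (X : R -> R -> V -> V -> V) (h e B tau : R) (n Q : nat) (u v : nat -> V) :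
  young_driver T C gamma X ->
  0 < h -> n%:R * h <= T -> 0 <= e -> 0 <= B -> 0 < tau -> h <= tau / 2 ->
  2 * T <= Q%:R * tau -> 16 * sew_const (2 * gamma) * C * B * tau `^ gamma <= 1 ->
  e * tau `^ (1 - gamma) <= C * B ^+ 2 ->
  approx_sol X 0 h e n u -> approx_sol X 0 h e n v ->
  (forall i, (i <= n)%N -> `|u i| <= B) -> (forall i, (i <= n)%N -> `|v i| <= B) ->
  forall i, (i <= n)%N -> `|u i - v i| <= 2 ^+ Q * (`|u 0%N - v 0%N| + 8 * e * tau).
Proof.
move=> XP h0 nT e0 B0 tau0 htau QT tauB etau uapp vapp uB vB.
have [p [p0 pt pt2]] := grid_window h0 tau0 htau.
have nQp : (n <= Q * p)%N.
  rewrite -(ler_nat R) -(ler_pM2r h0) natrM -mulrA.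
  have : Q%:R * (tau / 2) <= Q%:R * (p%:R * h) by rewrite ler_wpM2l.
  by clear -nT QT; lra.
have et0 : 0 <= 8 * e * tau by nneg.
have main (q : nat) : forall i, (i <= q * p)%N -> (i <= n)%N ->
    `|u i - v i| + 8 * e * tau <= 2 ^+ q * (`|u 0%N - v 0%N| + 8 * e * tau).
  elim: q => [|q IH] i iq i_n.
    have -> : i = 0%N by nlia.
    by rewrite expr0 mul1r.
  have [iq'|iq'] := leqP i (q * p).
    apply: le_trans (IH i iq' i_n) _; apply: ler_wpM2r; first by nneg.
    by rewrite ler_eXn2l// ltr1n.
  have qn : (q * p <= n)%N by nlia.
  pose k := (i - q * p)%N.
  have iE : i = (q * p + k)%N by rewrite /k; nlia.
  have kp : (k <= p)%N by rewrite mulSn in iq; rewrite /k; nlia.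
  clearbody k.
  have kt : k%:R * h <= tau by apply: le_trans pt; rewrite ler_pM2r// ler_nat.
  have kT : 0 + (q * p)%:R * h + k%:R * h <= T.
    by rewrite add0r -mulrDl -natrD -iE; apply: le_trans nT; rewrite ler_pM2r// ler_nat.
  have q0 : 0 <= 0 + (q * p)%:R * h by rewrite add0r; nneg.
  have sh w : approx_sol X 0 h e n w ->
      approx_sol X (0 + (q * p)%:R * h) h e k (fun j => w (q * p + j)%N).
    by move=> wapp; apply: approx_sol_shift; apply: approx_sol_le wapp => //; [exact: ltW|nlia].
  have := stability_window XP q0 (ltW h0) kT e0 B0 kt tauB etau (sh u uapp) (sh v vapp)
    (fun j jk => uB (q * p + j)%N ltac:(nlia)) (fun j jk => vB (q * p + j)%N ltac:(nlia)) (leqnn k).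
  rewrite -iE addn0.
  have := IH (q * p)%N (leqnn _) qn.
  by rewrite exprS; lra.
move=> i i_n; have := main Q i (leq_trans i_n nQp) i_n.
by move=> H; apply: le_trans H; rewrite lerDl.
Qed.

(** * Solutions in continuous time: a priori bound, stability, existence *)

Lemma powR_small (R : realType) (b eps : R) : 0 < b -> 0 < eps ->
  exists2 eta : R, 0 < eta & forall h, 0 <= h <= eta -> h `^ b <= eps.
Proof.
move=> b0 eps0; exists (eps `^ b^-1); first exact: powR_gt0.
move=> h /andP[h0 heps].
have -> : eps = (eps `^ b^-1) `^ b by rewrite -powRrM mulVf ?powRr1 ?ltW// gt_eqF.
by apply: ge0_ler_powR; rewrite ?nnegrE ?powR_ge0//; exact: ltW.
Qed.

Lemma small_params (R : realType) (T C g M tau : R) :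
  0 < T -> 0 < C -> 1 / 2 < g < 1 -> 0 < M -> 0 < tau ->
  exists eta e0 : R, [/\ 0 < eta, 0 < e0 & forall h e,
    0 < h <= eta -> 0 <= e <= e0 ->
    [/\ h <= tau / 2, e * tau `^ (1 - g) <= C * M ^+ 2 &
      3 * T * (h `^ (2 * g - 1) * (4 * C * M ^+ 2 + e * h `^ (1 - g)) ^+ 2
               + 4 * M * e) <= M ^+ 2]].
Proof.
move=> T0 C0 /andP[g2 g1] M0 tau0.
pose S := (4 * C * M ^+ 2 + 1) ^+ 2.
have S0 : 0 < S.
  by apply: exprn_gt0; apply: ltr_wpDl => //; nneg.
have w0 : 0 < tau `^ (1 - g) by exact: powR_gt0.
have b0 : 0 < 2 * g - 1 by lra.
have eps0 : 0 < M ^+ 2 / (6 * T * S) by rewrite divr_gt0// mulr_gt0// mulr_gt0.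
have [eta1 eta10 etaP] := powR_small b0 eps0.
(* The two terms of the energy error receive half of [M ^ 2] each: [6 * T * S] is for the power of
   [h], with [S] bounding the square when [e] and [h] are at most [1], and [24 * T] is for
   [4 * M * e]. *)
exists (Num.min eta1 (Num.min 1 (tau / 2))),
  (Num.min 1 (Num.min (C * M ^+ 2 / tau `^ (1 - g)) (M / (24 * T)))).
split.
- by rewrite !lt_min eta10 ltr01 divr_gt0.
- by rewrite !lt_min ltr01 !divr_gt0 ?mulr_gt0.
move=> h e /andP[h0]; rewrite !le_min => /and3P[h1 h2 h3].
move=> /andP[e0 /and3P[e1 e2 e3]].
split => //; first by rewrite -ler_pdivlMr.
have hb : h `^ (2 * g - 1) <= M ^+ 2 / (6 * T * S) by rewrite etaP// (ltW h0).
have h1g : h `^ (1 - g) <= 1.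
  rewrite [leRHS](_ : 1 = 1 `^ (1 - g)); last by rewrite powR1.
  by apply: ge0_ler_powR; rewrite ?nnegrE ?(ltW h0)//; lra.
have SS : (4 * C * M ^+ 2 + e * h `^ (1 - g)) ^+ 2 <= S.
  rewrite /S lerXn2r// ?nnegrE; [by nneg|by nneg|rewrite lerD2l].
  by rewrite -[leRHS]mulr1; apply: ler_pM => //; nneg.
have P1 : h `^ (2 * g - 1) * (4 * C * M ^+ 2 + e * h `^ (1 - g)) ^+ 2
    <= M ^+ 2 / (6 * T * S) * S by apply: ler_pM => //; nneg.
have T30 : 0 <= 3 * T by nneg.
rewrite mulrDr.
have := ler_wpM2l T30 P1.
have -> : 3 * T * (M ^+ 2 / (6 * T * S) * S) = M ^+ 2 / 2 by field; rewrite !gt_eqF.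
have M40 : 0 <= 3 * T * (4 * M) by nneg.
have := ler_wpM2l M40 e3.
have -> : 3 * T * (4 * M) * (M / (24 * T)) = M ^+ 2 / 2 by field; rewrite ?gt_eqF.
by clear; lra.
Qed.

Lemma geometric_small (R : realType) (q K eps : R) : 0 <= q < 1 -> 0 < eps ->
  exists k0 : nat, forall k, (k0 <= k)%N -> K * q ^+ k <= eps.
Proof.
move=> /andP[q0 q1] eps0.
have qn : `|q| < 1 by rewrite ger0_norm.
have /cvgrPdist_le := cvg_expr qn => /(_ (eps / (`|K| + 1))) [|k0 _ H].
  by rewrite divr_gt0// ltr_wpDl.
exists k0 => k kk0; have := H k kk0; rewrite sub0r normrN.
rewrite ler_pdivlMr; last by rewrite ltr_wpDl.
apply: le_trans; apply: le_trans (ler_norm _) _; rewrite normrM mulrC.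
by rewrite ler_wpM2l// lerDl.
Qed.

(** Davie's formulation of the equation driven by [X]: a first-order expansion with remainder of
    order [z], to be used with [z > 1]. It mentions no integral and no limit, and it restricts to
    every grid. *)
Definition davie (R : realType) (V : normedZmodType R) (T : R)
    (X : R -> R -> V -> V -> V) (z : R) (x : R -> V) : Prop :=
  exists2 K : R, 0 <= K & forall t r, 0 <= r <= t -> t <= T ->
    `|x t - x r - X t r (x r) (x r)| <= K * (t - r) `^ z.

Lemma davie_approx_sol (R : realType) (V : normedZmodType R) (T : R)
    (X : R -> R -> V -> V -> V) (z : R) (x : R -> V) (e0 : R) :
  1 < z -> davie T X z x -> 0 < e0 -> exists2 eta : R, 0 < eta &
  forall n h, 0 < h <= eta -> n%:R * h <= T ->
    approx_sol X 0 h e0 n (fun i => x (i%:R * h)).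
Proof.
move=> z1 [K K0 xP] e00.
have z10 : 0 < z - 1 by lra.
have K1 : 0 < K + 1 by apply: ltr_wpDl.
have eps0 : 0 < e0 / (K + 1) by rewrite divr_gt0.
have [eta eta0 etaP] := powR_small z10 eps0.
exists eta => // n h /andP[h0 h1] nhT i i_n; rewrite /defect !add0r.
have := gridB 0 h i 1; rewrite addn1 !add0r mul1r => hh.
apply: le_trans (xP _ _ _ _) _.
- by rewrite mulr_ge0 ?(ltW h0)//= ler_pM2r// ler_nat.
- by apply: le_trans nhT; rewrite ler_pM2r// ler_nat.
rewrite hh -(@mulr_powRB1 _ h z (ltW h0)); last lra.
have : h `^ (z - 1) <= e0 / (K + 1) by rewrite etaP// (ltW h0).
rewrite ler_pdivlMr// => H.
have : 0 <= h `^ (z - 1) by exact: powR_ge0.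
move: H; set y := h `^ _ => H y0.
by rewrite mulrCA mulrC; apply: ler_wpM2r; [exact: ltW|move: H y0; clear; lra].
Qed.

Lemma grid_exists (R : realType) (t eta : R) : 0 < t -> 0 < eta ->
  exists n h, 0 < h <= eta /\ n%:R * h = t.
Proof.
move=> t0 eta0.
pose n := (Num.truncn (t / eta)).+1.
exists n, (t / n%:R); split; last by rewrite mulrC divfK// gt_eqF.
rewrite divr_gt0//= ler_pdivrMr// -ler_pdivrMl// mulrC.
by apply/ltW; rewrite /n; case/andP: (truncn_itv (ltW (divr_gt0 t0 eta0))).
Qed.

(* tau is the time on which data of size M are controlled by the sewing bound;
   the last condition keeps the energy gained over the T / tau windows below
   the size of the data. *)
Record young_params (R : realType) (T C kappa gamma M tau : R) : Prop :=
  YoungParams {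
    params_T_gt0 : 0 < T;
    params_M_gt0 : 0 < M;
    params_tau_gt0 : 0 < tau;
    params_tau_le : tau <= T;
    params_tau_small : sew_const (2 * gamma) * C * M * tau `^ gamma <= 1 / 32;
    params_kappa_small : 240 * T * kappa * M * tau `^ gamma <= tau }.

Lemma davie_apriori (R : realType) (V : normedZmodType R) (T C kappa gamma : R)
    (X : R -> R -> V -> V -> V) (ip : V -> V -> R) (M tau z : R) (x : R -> V) :
  young_driver T C gamma X -> driver_energy T kappa gamma X ip ->
  young_params T C kappa gamma M tau -> 1 < z -> davie T X z x -> `|x 0| <= M ->
  forall t, 0 <= t <= T -> `|x t| <= 2 * M.
Proof.
move=> XP EP [T0 M0 tau0 tauT tauC tauk] z1 xP x0 t /andP[t0 tT].
have C0 := driver_C_gt0 XP.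
have [->|tn0] := eqVneq t 0; first by lra.
have [eta [e0 [eta0 e00 small]]] := small_params T0 C0 (driver_gamma XP) M0 tau0.
have [eta1 eta10 xapp] := davie_approx_sol z1 xP e00.
have t_gt0 : 0 < t by rewrite lt0r tn0.
have eta2 : 0 < Num.min eta eta1 by rewrite lt_min eta0.
have [n [h []]] := grid_exists t_gt0 eta2.
rewrite le_min => /and3P[h0 h1 h2] nt.
have {}xapp : approx_sol X 0 h e0 n (fun i => x (i%:R * h)).
  by apply: xapp; rewrite ?h0 ?nt.
have [|| htau etau eM] := small h e0; [by rewrite h0|by rewrite (ltW e00) lexx|].
have nT : n%:R * h <= T by rewrite nt.
have u0 : `|x (0%:R * h)| <= M by rewrite mul0r.
rewrite -nt; apply: (apriori_grid XP EP h0 nT (ltW e00) M0 _ _ tauk htau _ (lexx _) eM xapp u0 (leqnn n)).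
- by rewrite tau0.
- by clear -tauC; lra.
- have : 0 <= C * M ^+ 2 by nneg.
  by clear -etau; lra.
Qed.

(** On a fine grid both solutions have local error [e1], chosen so that it contributes at most [eps]
    to the bound of [stability_grid], whose factor [2 ^ Q] does not depend on the grid. *)
Lemma davie_stability (R : realType) (V : normedZmodType R) (T C gamma : R)
    (X : R -> R -> V -> V -> V) (B tau z1 z2 : R) (Q : nat) (x y : R -> V) :
  young_driver T C gamma X -> 0 < T -> 0 < B -> 0 < tau ->
  16 * sew_const (2 * gamma) * C * B * tau `^ gamma <= 1 ->
  2 * T <= Q%:R * tau -> 1 < z1 -> 1 < z2 -> davie T X z1 x -> davie T X z2 y ->
  (forall t, 0 <= t <= T -> `|x t| <= B) -> (forall t, 0 <= t <= T -> `|y t| <= B) ->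
  forall t, 0 <= t <= T -> `|x t - y t| <= 2 ^+ Q * `|x 0 - y 0|.
Proof.
move=> XP T0 B0 tau0 tauB QT z1P z2P xP yP xB yB t /andP[t0 tT].
have C0 := driver_C_gt0 XP.
have [->|tn0] := eqVneq t 0.
  rewrite ler_peMl// exprn_ege1// ler1n//.
apply/ler_addgt0Pr => eps eps0.
have [eta [e0 [eta0 e00 small]]] := small_params T0 C0 (driver_gamma XP) B0 tau0.
pose e1 := Num.min e0 (eps / (2 ^+ Q * 8 * tau)).
have D0 : 0 < 2 ^+ Q * 8 * tau by rewrite !mulr_gt0// exprn_gt0.
have e10 : 0 < e1 by rewrite lt_min e00 divr_gt0.
have [etax etax0 xapp] := davie_approx_sol z1P xP e10.
have [etay etay0 yapp] := davie_approx_sol z2P yP e10.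
have t_gt0 : 0 < t by rewrite lt0r tn0.
have eta2 : 0 < Num.min eta (Num.min etax etay) by rewrite !lt_min eta0 etax0.
have [n [h []]] := grid_exists t_gt0 eta2.
rewrite !le_min => /and4P[h0 h1 h2 h3] nt.
have nT : n%:R * h <= T by rewrite nt.
have [|| htau etau _] := small h e1.
- by rewrite h0.
- by rewrite (ltW e10) ge_min lexx.
have inT (i : nat) : (i <= n)%N -> 0 <= i%:R * h <= T.
  move=> i_n; rewrite mulr_ge0 ?(ltW h0)//=; apply: le_trans nT.
  by rewrite ler_pM2r// ler_nat.
have := stability_grid XP h0 nT (ltW e10) (ltW B0) tau0 htau QT tauB etau
  (xapp n h _ nT) (yapp n h _ nT) (fun i i_n => xB _ (inT i i_n))
  (fun i i_n => yB _ (inT i i_n)) (leqnn n).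
rewrite h0 => /(_ h2 h3); rewrite nt mul0r => H; apply: (le_trans H).
rewrite mulrDr lerD2l.
have : e1 <= eps / (2 ^+ Q * 8 * tau) by rewrite ge_min lexx orbT.
rewrite ler_pdivlMr//; apply: le_trans.
by rewrite le_eqVlt; apply/orP; left; apply/eqP; ring.
Qed.

(** Completeness for sequences with geometric increments, with the rate of convergence included; the
    dyadic Euler scheme needs no other case. *)
Definition geometrically_complete (R : realType) (V : normedZmodType R) : Prop :=
  forall (x : nat -> V) (K q : R), 0 <= q < 1 ->
    (forall k, `|x k.+1 - x k| <= K * q ^+ k) ->
    exists l, forall k, `|x k - l| <= K / (1 - q) * q ^+ k.

Fixpoint euler (R : realType) (V : normedZmodType R) (X : R -> R -> V -> V -> V)
    (h : R) (x0 : V) (i : nat) : V :=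
  if i is j.+1 then
    euler X h x0 j + X (j.+1%:R * h) (j%:R * h) (euler X h x0 j) (euler X h x0 j)
  else x0.

Lemma euler_approx (R : realType) (V : normedZmodType R)
    (X : R -> R -> V -> V -> V) (h : R) (x0 : V) (n : nat) :
  approx_sol X 0 h 0 n (euler X h x0).
Proof.
move=> i _; rewrite /defect !add0r mul0r /=.
set a := euler _ _ _ _; set b := X _ _ _ _.
by rewrite (_ : a + b - a - b = 0) ?normr0//; zmod.
Qed.

(** Two half steps differ from one full step by the driver over the second half, taken at the
    midpoint value instead of the initial one. This is of order [h ^ (2 gamma)], hence a local error
    that vanishes with [h]. *)
Lemma euler_half (R : realType) (V : normedZmodType R) (T C gamma : R)
    (X : R -> R -> V -> V -> V) (h M : R) (n : nat) (x0 : V) :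
  young_driver T C gamma X -> 0 < h -> (n * 2)%:R * (h / 2) <= T -> 0 <= M ->
  (forall i, (i <= n * 2)%N -> `|euler X (h / 2) x0 i| <= 2 * M) ->
  approx_sol X 0 h (16 * C ^+ 2 * M ^+ 3 * h `^ (2 * gamma - 1)) n
    (fun i => euler X (h / 2) x0 (i * 2)) /\
  forall i, (i < n * 2)%N ->
    `|euler X (h / 2) x0 i.+1 - euler X (h / 2) x0 i| <= 4 * C * M ^+ 2 * h `^ gamma.
Proof.
move=> XP h0 nT M0 uM.
have C0 := driver_C_gt0 XP; have /andP[g2 g1] := driver_gamma XP.
have h20 : 0 <= h / 2 by rewrite divr_ge0// ltW.
have nT0 : 0 + (n * 2)%:R * (h / 2) <= T by rewrite add0r.
set u := euler X (h / 2) x0 in uM *.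
have step i : (i < n * 2)%N ->
    `|u i.+1 - u i| <= 4 * C * M ^+ 2 * (h / 2) `^ gamma.
  move=> i_n; have [|rt tT] := @grid_le R 0 (h / 2) T (n * 2) i i.+1 (lexx 0) h20 nT0.
    by nlia.
  rewrite !add0r in rt tT.
  rewrite {1}/u /= -/u (_ : u i + _ - u i = X (i.+1%:R * (h / 2)) (i%:R * (h / 2)) (u i) (u i)); last by zmod.
  apply: le_trans (driver_le XP rt tT _ _) _.
  have := gridB 0 (h / 2) i 1; rewrite !add0r addn1 mul1r => ->.
  have -> : 4 * C * M ^+ 2 * (h / 2) `^ gamma = C * (h / 2) `^ gamma * ((2 * M) * (2 * M)) by ring.
  have ui := uM i (ltnW i_n).
  apply: ler_wpM2l; first by nneg.
  exact: ler_pM.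
have hh : (h / 2) `^ gamma <= h `^ gamma.
  by apply: ge0_ler_powR; rewrite ?nnegrE ?(ltW h0)//; lra.
split; last first.
  move=> i i_n; apply: le_trans (step i i_n) _; apply: ler_wpM2l => //; nneg.
move=> i i_n; rewrite /defect !add0r.
pose t := i.+1%:R * h; pose r := i%:R * h; pose m := (i * 2).+1%:R * (h / 2).
have tE : t = (i * 2).+2%:R * (h / 2).
  by rewrite (_ : (i * 2).+2 = (i.+1 * 2)%N) /t ?natrM//; field.
have rE : r = (i * 2)%:R * (h / 2) by rewrite /r natrM; field.
have [|rm mT] := @grid_le R 0 (h / 2) T (n * 2) (i * 2) (i * 2).+1 (lexx 0) h20 nT0; first by nlia.
have [|mt tT] := @grid_le R 0 (h / 2) T (n * 2) (i * 2).+1 (i * 2).+2 (lexx 0) h20 nT0; first by nlia.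
rewrite !add0r -/m -?rE -?tE in rm mT mt tT.
case/andP: (mt) => _ mt'.
rewrite -/t -/r.
have -> : u (i.+1 * 2)%N = u (i * 2)%N + X m r (u (i * 2)%N) (u (i * 2)%N)
   + X t m (u (i * 2).+1) (u (i * 2).+1).
  by rewrite mulSn add2n /u /= -tE -rE.
rewrite (driver_chasles XP rm mt' tT (u (i * 2)%N)).
set A := X t m _ _; set B := X t m _ _; set D := X m r _ _.
rewrite (_ : _ - _ - _ = A - B); last by zmod.
have i2 : (i * 2 < n * 2)%N by nlia.
apply: le_trans (driver_quadB XP mt tT _ _) _.
have := gridB 0 (h / 2) (i * 2).+1 1; rewrite !add0r addn1 mul1r -/m -tE => ->.
have S := step _ i2.
have U1 := uM _ i2; have U2 := uM _ (ltnW i2).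
have hE : h `^ gamma * h `^ gamma = h `^ (2 * gamma - 1) * h.
  rewrite powR_sq_double; last lra.
  rewrite -{3}(powRr1 (ltW h0)) -powRD ?subrK//.
  by apply/implyP => /eqP; lra.
apply: (@le_trans _ _ (C * h `^ gamma * (4 * C * M ^+ 2 * h `^ gamma * (2 * M + 2 * M)))).
  apply: ler_pM; [by nneg|by nneg|by apply: ler_wpM2l => //; exact: ltW|].
  apply: ler_pM; [by nneg|by nneg| |exact: lerD].
  by apply: (le_trans S); apply: ler_wpM2l => //; nneg.
have -> : C * h `^ gamma * (4 * C * M ^+ 2 * h `^ gamma * (2 * M + 2 * M)) =
  16 * C ^+ 2 * M ^+ 3 * (h `^ gamma * h `^ gamma) by ring.
by rewrite hE mulrA.
Qed.

Lemma truncn_half (R : realType) (t h : R) : 0 <= t -> 0 < h ->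
  Num.truncn (t / (h / 2)) = (Num.truncn (t / h) * 2)%N \/
  Num.truncn (t / (h / 2)) = (Num.truncn (t / h) * 2).+1.
Proof.
move=> t0 h0.
have th0 : 0 <= t / h by rewrite divr_ge0// ltW.
have -> : t / (h / 2) = t / h * 2 by field; rewrite gt_eqF.
have /andP[a b] := truncn_itv th0.
have th20 : 0 <= t / h * 2 by rewrite mulr_ge0.
have /andP[c d] := truncn_itv th20.
set i := Num.truncn (t / h) in a b *; set j := Num.truncn _ in c d *.
have ji : (j < i.*2.+2)%N.
  rewrite -(ltr_nat R); apply: le_lt_trans c _.
  have : i.*2.+2%:R = i.+1%:R * 2 :> R by rewrite -natrM muln2 doubleS.
  by move=> ->; rewrite ltr_pM2r.
have ij : (i.*2 < j.+1)%N.
  rewrite -(ltr_nat R); apply: le_lt_trans d.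
  by rewrite -muln2 natrM ler_pM2r.
by clearbody i j; clear -ji ij; lia.
Qed.

Lemma powR_exprn (R : realType) (x b : R) (k : nat) : 0 <= x ->
  (x ^+ k) `^ b = (x `^ b) ^+ k.
Proof.
by move=> x0; rewrite -powR_mulrn// -powRrM mulrC powRrM powR_mulrn// powR_ge0.
Qed.

(** The Euler polygons of step [T / 2 ^ k], extended as step functions, have geometric increments in
    [k] at each time, since [stability_grid] compares level [k] with the even points of level
    [k + 1]. The expansion of the limit comes from [approx_holder] at level [k], with constants
    independent of [k] and errors that vanish as [k] grows. *)
Lemma davie_exists (R : realType) (V : normedZmodType R) (T C kappa gamma : R)
    (X : R -> R -> V -> V -> V) (ip : V -> V -> R) (M tau : R) (x0 : V) :
  geometrically_complete V ->
  young_driver T C gamma X -> driver_energy T kappa gamma X ip ->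
  young_params T C kappa gamma M tau -> `|x0| <= M ->
  exists2 x : R -> V, davie T X (2 * gamma) x & x 0 = x0.
Proof.
move=> complete XP EP [T0 M0 tau0 tauT tauC tauk] x0M.
have C0 := driver_C_gt0 XP; have gP := driver_gamma XP; have /andP[g2 g1] := gP.
have c1 : 1 <= sew_const (2 * gamma) by apply: sew_const_ge1; lra.
have M20 : 0 < 2 * M by rewrite mulr_gt0.
have gam0 : 0 <= gamma by lra.
have gam20 : 0 <= 2 * gamma by lra.
pose b := 2 * gamma - 1.
have b0 : 0 < b by rewrite /b; lra.
(* The ratio of the errors at consecutive levels: the local error for the step [hh k] is of order
   [hh k ^ b]. *)
pose q : R := (1 / 2) `^ b.
have q0 : 0 < q by apply: powR_gt0; lra.
have q1 : q < 1.
  rewrite [ltRHS](_ : 1 = 1 `^ b); last by rewrite powR1.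
  by rewrite gt0_ltr_powR ?nnegrE//; lra.
pose hh k : R := T * (1 / 2) ^+ k.
have hh0 k : 0 < hh k by rewrite mulr_gt0// exprn_gt0//; lra.
have hhS k : hh k.+1 = hh k / 2 by rewrite /hh exprSr; field.
have hhT k : hh k <= T.
  by rewrite /hh -[leRHS]mulr1 ler_pM2l//; apply: exprn_ile1; lra.
have hhb k : hh k `^ b = T `^ b * q ^+ k.
  rewrite /hh powRM; [|exact: ltW|by apply: exprn_ge0; lra].
  by rewrite powR_exprn//; lra.
have hhg k : hh k `^ gamma <= T `^ (1 - gamma) * (T `^ b * q ^+ k).
  rewrite -hhb [X in _ `^ X <= _](_ : gamma = (1 - gamma) + b); last by rewrite /b; ring.
  rewrite powRD; last by rewrite (gt_eqF (hh0 k)) implybT.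
  apply: ler_wpM2r; first exact: powR_ge0.
  by apply: ge0_ler_powR; rewrite ?nnegrE ?(ltW (hh0 k)) ?(ltW T0)//; lra.
have [Q QT] : exists Q : nat, 2 * T <= Q%:R * tau.
  exists (Num.truncn (2 * T / tau)).+1.
  have T2 : 0 <= 2 * T / tau by rewrite divr_ge0 ?mulr_ge0 ?ltW.
  by case/andP: (truncn_itv T2) => _ /ltW; rewrite ler_pdivrMr.
have [eta [e0 [eta0 e00 small]]] := small_params T0 C0 gP M0 tau0.
pose K0 := 16 * C ^+ 2 * M ^+ 3 * T `^ b.
have q01 : 0 <= q < 1 by rewrite (ltW q0) q1.
have half01 : 0 <= (1 / 2 : R) < 1 by lra.
have [ka kaP] := @geometric_small R (1 / 2) T eta half01 eta0.
have [kb kbP] := @geometric_small R q K0 e0 q01 e00.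
pose n0 := maxn ka kb.
have eta_le k : (n0 <= k)%N -> hh k <= eta.
  by move=> nk; apply: kaP; rewrite (leq_trans (leq_maxl ka kb)).
pose e k := 16 * C ^+ 2 * M ^+ 3 * hh k `^ b.
have eE k : e k = K0 * q ^+ k by rewrite /e hhb /K0; ring.
have e_ge0 k : 0 <= e k by rewrite /e; nneg.
have e_le k : (n0 <= k)%N -> e k <= e0.
  by move=> nk; rewrite eE; apply: kbP; rewrite (leq_trans (leq_maxr ka kb)).
have nhT k : (2 ^ k)%:R * hh k = T.
  by rewrite /hh natrX mulrCA -exprMn (_ : 2 * (1 / 2) = 1) ?expr1n ?mulr1//; field.
pose u k := euler X (hh k) x0.
have uM k : (n0 <= k)%N -> forall i, (i <= 2 ^ k)%N -> `|u k i| <= 2 * M.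
  move=> nk; have [|| htau etau eM] := small (hh k) 0.
  - by rewrite hh0 eta_le.
  - by rewrite lexx ltW.
  have hkT : (2 ^ k)%:R * hh k <= T by rewrite nhT.
  apply: (apriori_grid XP EP (hh0 k) hkT (lexx 0) M0 _ _ tauk htau _ (lexx _) eM) => //.
  - by rewrite tau0.
  - by clear -tauC; lra.
  - by rewrite mul0r; nneg.
  - exact: euler_approx.
have tauB : 16 * sew_const (2 * gamma) * C * (2 * M) * tau `^ gamma <= 1.
  by clear -tauC; lra.
have half k : (n0 <= k)%N ->
    approx_sol X 0 (hh k) (e k) (2 ^ k) (fun i => u k.+1 (i * 2)%N) /\
    forall i, (i < 2 ^ k * 2)%N ->
      `|u k.+1 i.+1 - u k.+1 i| <= 4 * C * M ^+ 2 * hh k `^ gamma.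
  move=> nk; rewrite /u hhS; apply: (euler_half XP (hh0 k) _ (ltW M0)).
    by rewrite -hhS -expnSr nhT.
  by rewrite -hhS -expnSr; apply: uM; exact: leqW.
have close k : (n0 <= k)%N -> forall i, (i <= 2 ^ k)%N ->
    `|u k i - u k.+1 (i * 2)%N| <= 2 ^+ Q * (8 * e k * tau).
  move=> nk i ik; have [|| htau etau _] := small (hh k) (e k).
  - by rewrite hh0 eta_le.
  - by rewrite e_ge0 e_le.
  have hkT : (2 ^ k)%:R * hh k <= T by rewrite nhT.
  have etau' : e k * tau `^ (1 - gamma) <= C * (2 * M) ^+ 2.
    apply: (le_trans etau); rewrite exprMn; have : 0 <= C * M ^+ 2 by nneg.
    by clear; lra.
  have := stability_grid XP (hh0 k) hkT (e_ge0 k) (ltW M20) tau0 htau QT tauB etau'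
    (approx_sol_le (ltW (hh0 k)) (e_ge0 k) (leqnn _) (@euler_approx R V X (hh k) x0 _))
    (half k nk).1 (uM k nk) _ ik.
  rewrite subrr normr0 add0r; apply => j jk; apply: uM; first exact: leqW.
  by rewrite expnSr leq_mul2r.
pose idx k t := Num.truncn (t / hh k).
have idxP k t : 0 <= t <= T -> [/\ (idx k t <= 2 ^ k)%N,
    (idx k t)%:R * hh k <= t & t < (idx k t).+1%:R * hh k].
  move=> /andP[t0 tT]; have th : 0 <= t / hh k by rewrite divr_ge0// ltW.
  have /andP[p1 p2] := truncn_itv th.
  have i1 : (idx k t)%:R * hh k <= t by rewrite -ler_pdivlMr.
  split => //; last by rewrite -ltr_pdivrMr.
  rewrite -(ler_nat R) -(ler_pM2r (hh0 k)) nhT.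
  exact: le_trans tT.
pose y k t := u k (idx k t).
pose K1 := 2 ^+ Q * (8 * K0 * tau) + 4 * C * M ^+ 2 * (T `^ (1 - gamma) * T `^ b).
have K10 : 0 <= K1 by rewrite /K1 /K0; nneg.
have yS k t : (n0 <= k)%N -> 0 <= t <= T -> `|y k.+1 t - y k t| <= K1 * q ^+ k.
  move=> nk tT; have [ik _ _] := idxP k t tT.
  have [ik1 _ _] := idxP k.+1 t tT.
  have := close k nk _ ik.
  have t0 : 0 <= t by case/andP: tT.
  have -> : 2 ^+ Q * (8 * e k * tau) = 2 ^+ Q * (8 * K0 * tau) * q ^+ k by rewrite eE; ring.
  have P : 0 <= 4 * C * M ^+ 2 * (T `^ (1 - gamma) * T `^ b) * q ^+ k.
    by nneg.
  (* The grid point below [t] at level [k + 1] is that of level [k] or the next fine one. An extra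
     fine step costs [hh k ^ gamma], again of order [q ^ k] because [b <= gamma]. *)
  have := truncn_half t0 (hh0 k); rewrite -hhS -/(idx k t) -/(idx k.+1 t).
  have -> : K1 * q ^+ k = 2 ^+ Q * (8 * K0 * tau) * q ^+ k
    + 4 * C * M ^+ 2 * (T `^ (1 - gamma) * T `^ b) * q ^+ k by rewrite /K1 mulrDl.
  rewrite /y => -[iE|iE]; rewrite iE => cl.
    by rewrite distrC; apply: (le_trans cl); rewrite lerDl.
  have lt2 : (idx k t * 2 < 2 ^ k * 2)%N by rewrite iE expnSr in ik1.
  have := (half k nk).2 _ lt2.
  set a := u k.+1 _; set c := u k.+1 _; set d := u k _ in cl *.
  move=> ac; rewrite (_ : a - d = (c - d) + (a - c)); last by zmod.
  apply: le_trans (ler_normD _ _) _; apply: lerD; first by rewrite distrC.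
  apply: (le_trans ac); rewrite -(mulrA (4 * C * M ^+ 2)).
  apply: ler_wpM2l; first by nneg.
  by rewrite -(mulrA (T `^ (1 - gamma))); exact: hhg.
have [x xP] : exists x : R -> V, forall t, 0 <= t <= T ->
    forall k, `|y (n0 + k)%N t - x t| <= K1 / (1 - q) * q ^+ (n0 + k).
  have lims t : exists l : V, 0 <= t <= T ->
      forall k, `|y (n0 + k)%N t - l| <= K1 / (1 - q) * q ^+ (n0 + k).
    have [tT|tT] := boolP (0 <= t <= T); last by exists 0.
    have [|l lP] := complete (fun k => y (n0 + k)%N t) (K1 * q ^+ n0) q q01.
      move=> k; rewrite -mulrA -exprD addnS.
      by apply: yS => //; exact: leq_addr.
    exists l => _ k; apply: (le_trans (lP k)).
    by rewrite exprD le_eqVlt; apply/orP; left; apply/eqP; ring.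
  by exists (fun t => projT1 (cid (lims t))) => t; case: cid.
have yM k t : (n0 <= k)%N -> 0 <= t <= T -> `|y k t| <= 2 * M.
  by move=> nk tT; have [ik _ _] := idxP k t tT; exact: uM.
have y00 k : y k 0 = x0 by rewrite /y /idx mul0r truncn0.
pose K2 := K1 / (1 - q).
have K20 : 0 <= K2 by rewrite /K2 divr_ge0// subr_ge0 ltW.
exists x; last first.
  apply/eqP; rewrite -subr_eq0 -normr_le0; apply/ler_addgt0Pr => eps eps0.
  have [k kP] := geometric_small (K1 / (1 - q)) q01 eps0.
  have T00 : 0 <= (0 : R) <= T by rewrite lexx ltW.
  have := xP 0 T00 k; rewrite y00 distrC add0r => /le_trans; apply.
  by apply: kP; rewrite leq_addl.
pose G := 2 * (C * (2 * M) ^+ 2).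
pose KK := sew_const (2 * gamma) * (2 * C * (2 * M)) * G.
have KK0 : 0 <= KK by rewrite /KK /G; nneg; clear -c1; lra.
pose B := 2 * M + K2.
have xB t : 0 <= t <= T -> `|x t| <= B.
  move=> tT; have := xP t tT 0%N; rewrite addn0 => d.
  rewrite (_ : x t = y n0 t - (y n0 t - x t)); last by zmod.
  apply: le_trans (ler_normB _ _) _; apply: lerD; first exact: yM.
  apply: (le_trans d); rewrite -/K2 -[leRHS]mulr1; apply: ler_wpM2l => //.
  by apply: exprn_ile1 => //; exact: ltW.
have B0 : 0 <= B by rewrite /B; nneg.
have tau20 : 0 < tau / 2 by rewrite divr_gt0.
pose S := 2 * B + C * T `^ gamma * B ^+ 2.
have S0 : 0 <= S by rewrite /S; nneg.
pose L1 := S / (tau / 2) `^ (2 * gamma).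
pose L2 := KK * 2 `^ (2 * gamma).
have L10 : 0 <= L1 by rewrite /L1 divr_ge0 ?powR_ge0.
have L20 : 0 <= L2 by rewrite /L2; nneg.
exists (L1 + L2) => [|t r /andP[r0 rt] tT]; first by nneg.
have rT : 0 <= r <= T by rewrite r0 (le_trans rt).
have tT' : 0 <= t <= T by rewrite tT (le_trans r0).
have rt' : 0 <= r <= t by rewrite r0.
have tr0 : 0 <= t - r by rewrite subr_ge0.
have trT : t - r <= T by rewrite lerBlDr (le_trans tT)// lerDl.
have Xle f g : `|X t r f g| <= C * T `^ gamma * (`|f| * `|g|).
  apply: le_trans (driver_le XP rt' tT f g) _; apply: ler_wpM2r; first by nneg.
  apply: ler_wpM2l; first exact: ltW.
  by apply: ge0_ler_powR; rewrite ?nnegrE ?(ltW T0).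
(* The window bound covers only runs of length at most [tau]. At distance at least [tau / 2] the
   crude bound [S] suffices. At shorter distance the grid run between the two times has length at
   most [2 * (t - r) <= tau], and this factor [2] is paid in [L2]. *)
have [far|near] := leP (tau / 2) (t - r).
  apply: (@le_trans _ _ (L1 * (t - r) `^ (2 * gamma))); last first.
    by rewrite ler_wpM2r ?powR_ge0// lerDl.
  apply: (@le_trans _ _ S).
    apply: le_trans (ler_normB _ _) _; apply: lerD.
      apply: le_trans (ler_normB _ _) _.
      have := xB t tT'; have := xB r rT; clear; lra.
    apply: le_trans (Xle _ _) _; apply: ler_wpM2l; first by nneg.
    by rewrite expr2; apply: ler_pM => //; exact: xB.
  rewrite /L1 mulrAC ler_pdivlMr ?powR_gt0//; apply: ler_wpM2l => //.
  by apply: ge0_ler_powR; rewrite ?nnegrE ?(ltW tau20).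
have [->|tr] := eqVneq t r.
  have rr : 0 <= r <= r by rewrite r0 lexx.
  have rT' : r <= T by case/andP: rT.
  have := driver_le XP rr rT' (x r) (x r).
  have g0 : gamma != 0 by rewrite gt_eqF//; clear -g2; lra.
  have g20 : 2 * gamma != 0 by rewrite mulf_neq0.
  rewrite !subrr sub0r !powR0// mulr0 mul0r mulr0.
  by rewrite normr_le0 => /eqP ->; rewrite oppr0 normr0.
have tr_gt0 : 0 < t - r by rewrite subr_gt0 lt_neqAle eq_sym tr.
apply: (@le_trans _ _ (L2 * (t - r) `^ (2 * gamma))); last first.
  by rewrite ler_wpM2r ?powR_ge0// lerDr.
apply/ler_addgt0Pr => eps eps0.
(* [K3 * q ^ k] collects the errors of moving from the grid times to [t] and [r], and from the
   values at level [k] to the limit. *)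
pose K3 := 8 * C * M ^+ 2 * (T `^ (1 - gamma) * T `^ b)
  + 2 * K2 + C * T `^ gamma * (K2 * (2 * B + K2)).
have [k1 k1P] := geometric_small K3 q01 eps0.
have [k2 k2P] := @geometric_small R (1 / 2) T (t - r) half01 tr_gt0.
pose k := (n0 + (k1 + k2))%N.
have nk : (n0 <= k)%N by exact: leq_addr.
have hk : hh k <= t - r by apply: k2P; rewrite /k addnA leq_addl.
have qk : K3 * q ^+ k <= eps by apply: k1P; rewrite /k addnCA leq_addr.
have [jk j1 j2] := idxP k t tT'; have [ik i1 i2] := idxP k r rT.
have dt : `|y k t - x t| <= K2 * q ^+ k by exact: xP.
have dr : `|y k r - x r| <= K2 * q ^+ k by exact: xP.
have yr := yM k r nk rT.
have rj : r <= (idx k t)%:R * hh k.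
  by move: j2; rewrite -natr1 mulrDl mul1r; clear -hk; lra.
have i_lt_j : (idx k r < idx k t)%N.
  rewrite -(ltr_nat R) -(ltr_pM2r (hh0 k)); apply: (le_lt_trans i1).
  by move: j2; rewrite -natr1 mulrDl mul1r; clear -hk; lra.
pose m := (idx k t - idx k r)%N.
have jE : idx k t = (idx k r + m)%N by rewrite /m subnKC// ltnW.
have m0 : (0 < m)%N by rewrite /m subn_gt0.
have mh : m%:R * hh k <= 2 * (t - r).
  have : (idx k t)%:R * hh k = (idx k r)%:R * hh k + m%:R * hh k.
    by rewrite jE natrD mulrDl.
  by move: j1 i2 hk; rewrite -(natr1 (idx k r)) mulrDl mul1r; clear; lra.
have mtau : m%:R * hh k <= tau by move: mh near; clear; lra.
have hkT : 0 + (2 ^ k)%:R * hh k <= T by rewrite add0r nhT.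
have tauB2 : sew_const (2 * gamma) * (2 * C * (2 * M)) * tau `^ gamma <= 1 / 2.
  by clear -tauC; lra.
have [|| _ ] := approx_holder XP (lexx 0) (ltW (hh0 k)) hkT (lexx 0) (ltW M20) mtau
  tauB2 (@euler_approx R V X (hh k) x0 (2 ^ k)) (fun i ik => uM k nk i (ltnW ik)) (k := m) (i := idx k r).
- by rewrite m0 leqnn.
- by rewrite -jE.
rewrite -jE !mul0r !mulr0 !addr0 -/G -/KK /defect !add0r => def.
have {}def : `|y k t - y k r - X ((idx k t)%:R * hh k) ((idx k r)%:R * hh k) (y k r) (y k r)|
    <= L2 * (t - r) `^ (2 * gamma).
  apply: (le_trans def); rewrite /L2 -mulrA -powRM//; apply: ler_wpM2l => //.
  apply: ge0_ler_powR; rewrite ?nnegrE//; [by rewrite mulr_ge0// ltW|by rewrite mulr_ge0].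
set jh := (idx k t)%:R * hh k in j1 rj def; set ih := (idx k r)%:R * hh k in i1 def.
have ih0 : 0 <= ih by rewrite mulr_ge0// ltW.
have c_tr := driver_chasles XP (t := t) (m := jh) (r := r) _ j1 tT (y k r) (y k r).
have c_ji := driver_chasles XP (t := jh) (m := r) (r := ih) _ rj _ (y k r) (y k r).
rewrite r0 rj in c_tr; rewrite ih0 i1 (le_trans j1 tT) in c_ji.
have short a c : 0 <= c <= a -> a <= T -> a <= c + hh k ->
    `|X a c (y k r) (y k r)| <= 4 * C * M ^+ 2 * (T `^ (1 - gamma) * (T `^ b * q ^+ k)).
  move=> ca aT ach; apply: le_trans (driver_le XP ca aT _ _) _.
  have -> : 4 * C * M ^+ 2 * (T `^ (1 - gamma) * (T `^ b * q ^+ k)) =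
    C * (T `^ (1 - gamma) * (T `^ b * q ^+ k)) * ((2 * M) * (2 * M)) by ring.
  apply: ler_pM; [by nneg|by nneg| |exact: ler_pM].
  apply: ler_wpM2l; first exact: ltW.
  apply: le_trans (hhg k); apply: ge0_ler_powR; rewrite ?nnegrE ?(ltW (hh0 k))//.
  - by rewrite subr_ge0; case/andP: ca.
  - by rewrite lerBlDl.
have s1 : `|X t jh (y k r) (y k r)| <= 4 * C * M ^+ 2 * (T `^ (1 - gamma) * (T `^ b * q ^+ k)).
  apply: short => //; first by rewrite j1 (le_trans r0).
  by move: j2; rewrite -/jh -natr1 mulrDl mul1r -/jh => /ltW.
have s2 : `|X r ih (y k r) (y k r)| <= 4 * C * M ^+ 2 * (T `^ (1 - gamma) * (T `^ b * q ^+ k)).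
  apply: short => //; first by rewrite ih0 i1.
    by case/andP: rT.
  by move: i2; rewrite -natr1 mulrDl mul1r -/ih => /ltW.
have s3 := driver_quadB XP rt' tT (y k r) (x r).
have {}s3 : `|X t r (y k r) (y k r) - X t r (x r) (x r)| <=
    C * T `^ gamma * (K2 * (2 * B + K2)) * q ^+ k.
  apply: (le_trans s3).
  have -> : C * T `^ gamma * (K2 * (2 * B + K2)) * q ^+ k =
    C * T `^ gamma * (K2 * q ^+ k * (2 * B + K2)) by ring.
  have TT : (t - r) `^ gamma <= T `^ gamma.
    by apply: ge0_ler_powR; rewrite ?nnegrE ?(ltW T0).
  apply: ler_pM; [by nneg|by nneg|by apply: ler_wpM2l => //; exact: ltW|].
  apply: ler_pM; [by nneg|by nneg|exact: dr|].
  have := xB r rT; have : 2 * M <= B by rewrite /B lerDl.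
  by move: yr K20; clear; lra.
pose A := X t r (x r) (x r).
have -> : x t - x r - A = (y k t - y k r - X jh ih (y k r) (y k r))
   + ((y k r - x r) - (y k t - x t))
   + ((X r ih (y k r) (y k r) - X t jh (y k r) (y k r)) + (X t r (y k r) (y k r) - A)).
  by rewrite (c_tr isT) (c_ji isT isT); zmod.
apply: le_trans (ler_normD _ _) _.
apply: le_trans (lerD (ler_normD _ _) (ler_normD _ _)) _.
have n1 := le_trans (ler_normB _ _) (lerD dr dt).
have n2 := le_trans (ler_normB _ _) (lerD s2 s1).
apply: le_trans (lerD (lerD def n1) (lerD n2 s3)) _.
rewrite -addrA lerD2l; apply: le_trans qk.
by rewrite le_eqVlt; apply/orP; left; apply/eqP; rewrite /K3; ring.
Qed.

(** * Kernel estimates for the truncated weights *)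

Lemma expR_sub1_le (R : realType) (u : R) :
  `|expR u - 1| <= `|u| * Num.max 1 (expR u).
Proof.
have [u0|u0] := leP 0 u.
  have e1 : 1 <= expR u by rewrite -[leLHS](expR0 R) ler_expR.
  rewrite (max_idPr e1) !ger0_norm ?subr_ge0//.
  have := expR_ge1Dx (- u).
  have -> : expR (- u) = (expR u)^-1 by rewrite expRN.
  have eu := expR_gt0 u.
  rewrite -(ler_pM2r eu) mulVf ?gt_eqF//; clear; lra.
have e1 : expR u <= 1 by rewrite -[leRHS](expR0 R) ler_expR ltW.
rewrite (max_idPl e1) mulr1 ler0_norm ?subr_le0// (ltr0_norm u0).
by have := expR_ge1Dx u; clear; lra.
Qed.

(** A mean value inequality valid for both signs of [p]: with [r = a / b], write [r ^ p] as the
    exponential of [p * ln r] and use [ln r <= r - 1]. *)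
Lemma powR_diff_le (R : realType) (a b p : R) : 0 < b -> b <= a ->
  `|a `^ p - b `^ p| <= `|p| * ((a - b) / b) * Num.max (a `^ p) (b `^ p).
Proof.
move=> b0 ba; pose r := a / b.
have r1 : 1 <= r by rewrite /r ler_pdivlMr// mul1r.
have r0 : 0 < r by apply: lt_le_trans r1.
have aE : a = r * b by rewrite /r divfK// gt_eqF.
have -> : a `^ p = r `^ p * b `^ p by rewrite -powRM ?ltW// -aE.
have -> : (a - b) / b = r - 1 by rewrite /r mulrBl divff// gt_eqF.
have bp : 0 <= b `^ p by exact: powR_ge0.
rewrite -[X in Num.max _ X]mul1r -maxr_pMl// mulrA.
rewrite -[X in _ - X]mul1r -mulrBl normrM (ger0_norm bp); apply: ler_wpM2r => //.
have -> : r `^ p = expR (p * ln r) by rewrite /powR gt_eqF.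
apply: le_trans (expR_sub1_le _) _.
rewrite maxC; apply: ler_wpM2r; first by rewrite le_max ler01 orbT.
rewrite normrM; apply: ler_wpM2l => //.
have ln0 : 0 <= ln r by rewrite ln_ge0.
rewrite ger0_norm//; have := @le_ln1Dx R (r - 1).
rewrite (_ : 1 + (r - 1) = r); last by ring.
by apply; move: r0; clear; lra.
Qed.

Section Weight.
Context {R : realType}.
Implicit Types (N s rho x y z : R).

Definition cutoff N x : R := Num.max 1 (x / N).

Definition mwt N s x : R := cutoff N x `^ s.

(** The decay [x ^ (- rho)] of the phase in one of the three frequencies, divided by the weight
    carried by the function at that frequency. For functions normalised in the weighted [l2], the
    kernel of the trilinear form is a product of three [qwt] times the derivative and the squared
    weight of the output. *)
Definition qwt N s rho x : R := x `^ (- rho) / mwt N s x.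

End Weight.

Lemma cutoff_ge1 (R : realType) (N x : R) : 1 <= cutoff N x.
Proof. by rewrite /cutoff le_max lexx. Qed.

Lemma cutoff_gt0 (R : realType) (N x : R) : 0 < cutoff N x.
Proof. exact: lt_le_trans ltr01 (cutoff_ge1 _ _). Qed.

Lemma cutoff_le (R : realType) (N x y : R) : 0 < N -> x <= y -> cutoff N x <= cutoff N y.
Proof.
move=> N0 xy; rewrite /cutoff ge_max !le_max lexx/=.
by apply/orP; right; rewrite ler_pM2r ?invr_gt0.
Qed.

Lemma cutoff_ratio (R : realType) (N x y : R) : 0 < N -> 0 < y -> y <= x ->
  cutoff N x / cutoff N y <= x / y.
Proof.
move=> N0 y0 yx; rewrite ler_pdivrMr ?cutoff_gt0// /cutoff ge_max.
have xy : 1 <= x / y by rewrite ler_pdivlMr ?mul1r.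
apply/andP; split.
  by rewrite -[leLHS]mulr1; apply: ler_pM => //; rewrite le_max lexx.
have -> : x / N = x / y * (y / N) by field; rewrite !gt_eqF.
by apply: ler_wpM2l; [lra|rewrite le_max lexx orbT].
Qed.

Lemma cutoff_le_id (R : realType) (N x : R) : 1 <= N -> 1 <= x -> cutoff N x <= x.
Proof.
move=> N1 x1; rewrite /cutoff ge_max x1/= ler_pdivrMr; last by lra.
by rewrite ler_peMr//; lra.
Qed.

Lemma mwt_gt0 (R : realType) (N s x : R) : 0 < mwt N s x.
Proof. by rewrite powR_gt0// cutoff_gt0. Qed.

Lemma powR_doubling (R : realType) (a b p : R) : 0 < b -> b <= a -> a <= 2 * b ->
  a `^ p <= 2 `^ `|p| * b `^ p /\ b `^ p <= 2 `^ `|p| * a `^ p.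
Proof.
move=> b0 ba ab.
have a0 : 0 < a by exact: lt_le_trans ba.
have p2 : 1 <= 2 `^ `|p| :> R.
  rewrite -[leLHS](powRr0 2); apply: ler_powR => //; lra.
have mono u v : 0 < u -> u <= v -> v <= 2 * u -> forall t : R, 0 <= t ->
    v `^ t <= 2 `^ t * u `^ t.
  move=> u0 uv vu t t0; rewrite -powRM//; last exact: ltW.
  by apply: ge0_ler_powR; rewrite ?nnegrE//; [lra|rewrite mulr_ge0// ltW].
have [p0|p0] := leP 0 p.
  rewrite ger0_norm//; split; first exact: mono.
  apply: (@le_trans _ _ (1 * a `^ p)); last first.
    by rewrite ler_wpM2r ?powR_ge0//; rewrite ger0_norm in p2.
  by rewrite mul1r ge0_ler_powR ?nnegrE// ltW.
rewrite ltr0_norm//; have np : 0 <= - p by rewrite oppr_ge0 ltW.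
have E u : u `^ p = (u `^ (- p))^-1 by rewrite -powRN opprK.
rewrite !E; split.
  apply: (@le_trans _ _ (1 * (b `^ (- p))^-1)).
    rewrite mul1r lef_pV2 ?posrE ?powR_gt0//.
    by rewrite ge0_ler_powR ?nnegrE// ltW.
  by rewrite ler_wpM2r ?invr_ge0 ?powR_ge0//; rewrite ltr0_norm in p2.
rewrite -ler_pdivrMr ?invr_gt0 ?powR_gt0// invrK mulrC ler_pdivrMr ?powR_gt0//.
exact: mono.
Qed.

Lemma mwt_doubling (R : realType) (N s x y : R) : 0 < N -> 0 < y -> y <= x -> x <= 2 * y ->
  mwt N s x <= 2 `^ `|s| * mwt N s y /\ mwt N s y <= 2 `^ `|s| * mwt N s x.
Proof.
move=> N0 y0 yx xy; apply: powR_doubling; [exact: cutoff_gt0|exact: cutoff_le|].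
have := cutoff_ratio N0 y0 yx; rewrite ler_pdivrMr ?cutoff_gt0// => /le_trans; apply.
by rewrite ler_pM2r ?cutoff_gt0// ler_pdivrMr.
Qed.

Lemma qwt_ge0 (R : realType) (N s rho x : R) : 0 <= qwt N s rho x.
Proof. by rewrite /qwt divr_ge0 ?powR_ge0// ltW// mwt_gt0. Qed.

(** The product [x ^ rho * mwt N s x] is nondecreasing: for negative [s] the weight loses at most
    [(x / y) ^ (- s)], by [cutoff_ratio], and [- s <= rho] compensates. This is where [- rho <= s]
    enters the kernels. *)
Lemma qwt_decr (R : realType) (N s rho x y : R) : 0 < N -> 0 < rho -> - rho <= s ->
  0 < y -> y <= x -> qwt N s rho x <= qwt N s rho y.
Proof.
move=> N0 rho0 srho y0 yx.
have x0 : 0 < x by exact: lt_le_trans yx.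
have E u : 0 < u -> qwt N s rho u = (u `^ rho * mwt N s u)^-1.
  by move=> u0; rewrite /qwt powRN invfM.
rewrite !E// lef_pV2 ?posrE ?mulr_gt0 ?powR_gt0 ?mwt_gt0 ?cutoff_gt0//.
have [s0|s0] := leP 0 s.
  have rho0' := ltW rho0; have y0' := ltW y0; have x0' := ltW x0.
  apply: ler_pM; [exact: powR_ge0|exact: powR_ge0|exact: ge0_ler_powR|].
  by apply: ge0_ler_powR; rewrite ?nnegrE ?(ltW (cutoff_gt0 _ _)) ?cutoff_le.
have E2 u : mwt N s u = (cutoff N u `^ (- s))^-1 by rewrite -powRN opprK.
have ra : (x / y) `^ (- s) <= (x / y) `^ rho.
  apply: ler_powR; last by lra.
  by rewrite ler_pdivlMr// mul1r.
have xE (t : R) : (x / y) `^ t * y `^ t = x `^ t.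
  by rewrite -powRM ?divfK ?gt_eqF// ltW// divr_gt0.
have cE : (cutoff N x / cutoff N y) `^ (- s) * cutoff N y `^ (- s) = cutoff N x `^ (- s).
  by rewrite -powRM ?divfK ?gt_eqF ?cutoff_gt0// ltW// ?divr_gt0 ?cutoff_gt0.
have cr : (cutoff N x / cutoff N y) `^ (- s) <= (x / y) `^ (- s).
  have cc : 0 < cutoff N x / cutoff N y by rewrite divr_gt0 ?cutoff_gt0.
  have xy : 0 < x / y by rewrite divr_gt0.
  apply: ge0_ler_powR; rewrite ?nnegrE ?(ltW cc) ?(ltW xy)//.
    by rewrite oppr_ge0 ltW.
  exact: cutoff_ratio.
rewrite !E2 -(xE rho) -cE invfM.
have cy0 : 0 < cutoff N y `^ (- s) by rewrite powR_gt0 ?cutoff_gt0.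
have yr0 : 0 < y `^ rho by rewrite powR_gt0.
set A := (cutoff N x / cutoff N y) `^ (- s) in cr *.
have A0 : 0 < A by rewrite powR_gt0 ?divr_gt0 ?cutoff_gt0.
have le : 1 <= (x / y) `^ rho * A^-1.
  by rewrite ler_pdivlMr// mul1r; exact: le_trans cr ra.
rewrite -[leLHS]mul1r.
have -> : (x / y) `^ rho * y `^ rho * (A^-1 * (cutoff N y `^ (- s))^-1) =
  (x / y) `^ rho * A^-1 * (y `^ rho * (cutoff N y `^ (- s))^-1) by ring.
by rewrite ler_pM2r ?mulr_gt0 ?invr_gt0.
Qed.

(* d is the margin that makes |n|^(- 1/2 - d) square summable, and N^(- beta) is
   the gain in the energy estimate. *)
Record kernel_params (R : realType) (rho s d beta : R) : Prop := KernelParams {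
  kp_rho : 1 / 2 < rho;
  kp_s_rho : - rho <= s;
  kp_d : 0 < d;
  kp_s : 3 / 2 - 3 * rho - s + d <= 0;
  kp_rho_d : 3 / 2 - 3 * rho + d <= 0;
  kp_beta_ge0 : 0 <= beta;
  kp_beta_rho : beta <= 2 * rho;
  kp_beta_d : beta <= 3 * rho - 3 / 2 - d }.

Lemma powR_gtD (R : realType) (x a b : R) : 0 < x -> x `^ a * x `^ b = x `^ (a + b).
Proof. by move=> x0; rewrite powRD// (gt_eqF x0) implybT. Qed.

Lemma powR_ge1_le (R : realType) (x a b : R) : 1 <= x -> a <= b -> x `^ a <= x `^ b.
Proof. by move=> x1 ab; exact: ler_powR. Qed.

Lemma mwt_inv_le (R : realType) (N s x : R) : 1 <= N -> 1 <= x ->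
  (mwt N s x)^-1 <= x `^ Num.max 0 (- s).
Proof.
move=> N1 x1; rewrite /mwt -powRN.
apply: (@le_trans _ _ (cutoff N x `^ Num.max 0 (- s))).
  by apply: powR_ge1_le; rewrite ?cutoff_ge1// le_max lexx orbT.
apply: ge0_ler_powR; rewrite ?nnegrE ?(ltW (cutoff_gt0 _ _))//; last exact: cutoff_le_id.
  by rewrite le_max lexx.
exact: le_trans x1.
Qed.

(** The kernel when all three frequencies have size [z]. The two signs of [s] use the two conditions
    [kp_s] and [kp_rho_d]. *)
Lemma kernel_base (R : realType) (N rho s d beta z : R) :
  kernel_params rho s d beta -> 1 <= N -> 1 <= z ->
  z `^ (1 - 3 * rho) / mwt N s z <= z `^ (- (1 / 2) - d).
Proof.
move=> [k1 k2 k3 k4 k5 k6 k7 k8] N1 z1; have z0 : 0 < z by lra.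
apply: (@le_trans _ _ (z `^ (1 - 3 * rho) * z `^ Num.max 0 (- s))).
  by apply: ler_wpM2l; [exact: powR_ge0|exact: mwt_inv_le].
rewrite powR_gtD//; apply: powR_ge1_le => //.
by have [s0|s0] := leP 0 (- s); move: k4 k5; clear; lra.
Qed.

Lemma qwt_doubling (R : realType) (N rho s x y : R) : 0 < N -> 0 < rho ->
  0 < y -> y <= x -> x <= 2 * y ->
  qwt N s rho y <= 2 `^ (rho + `|s|) * qwt N s rho x.
Proof.
move=> N0 rho0 y0 yx xy; have x0 : 0 < x by exact: lt_le_trans yx.
have [m1 _] := mwt_doubling s N0 y0 yx xy.
have [_ r1] := powR_doubling (- rho) y0 yx xy.
rewrite normrN ger0_norm in r1; last exact: ltW.
rewrite /qwt -powR_gtD// mulrACA; apply: ler_pM.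
- exact: powR_ge0.
- by rewrite invr_ge0 ltW// mwt_gt0.
- exact: r1.
by rewrite ler_pdivlMr ?mwt_gt0// mulrC ler_pdivrMr ?mwt_gt0.
Qed.

(** The two larger frequencies are within a factor [2], so for each choice of the output [o] two of
    the three factors [qwt] can be moved to [o], where they cancel the squared weight and leave
    [o ^ (1 - 2 rho)]. This decreases since [rho > 1 / 2], and what remains is [kernel_base] at the
    smallest frequency. *)
Lemma driver_kernel_le (R : realType) (N rho s d beta x y z : R) :
  kernel_params rho s d beta -> 1 <= N -> 1 <= z -> z <= y -> x = y + z ->
  forall o, o \in [:: x; y; z] ->
  o * mwt N s o ^+ 2 * (qwt N s rho x * qwt N s rho y * qwt N s rho z) <=
    2 `^ (rho + `|s|) * z `^ (- (1 / 2) - d).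
Proof.
move=> KP N1 z1 zy xE o; have [k1 k2 k3 k4 k5 k6 k7 k8] := KP.
have N0 : 0 < N by lra.
have rho0 : 0 < rho by lra.
have z0 : 0 < z by lra.
have y0 : 0 < y by lra.
have x0 : 0 < x by lra.
have yx : y <= x by lra.
have x2y : x <= 2 * y by lra.
have zx : z <= x by lra.
have base := kernel_base KP N1 z1.
have q0 u : 0 <= qwt N s rho u by exact: qwt_ge0.
have c1 : 1 <= 2 `^ (rho + `|s|) :> R.
  rewrite -[leLHS](powRr0 2); apply: powR_ge1_le; first lra.
  by rewrite addr_ge0// ltW.
have qd := qwt_doubling s N0 rho0 y0 yx x2y.
have qE u : 0 < u -> u * mwt N s u ^+ 2 * (qwt N s rho u * qwt N s rho u) =
    u `^ (1 - 2 * rho).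
  move=> u0; rewrite /qwt.
  have m0 := mwt_gt0 N s u.
  have -> : u `^ (1 - 2 * rho) = u * (u `^ (- rho) * u `^ (- rho)).
    rewrite powR_gtD// -{2}(powRr1 (ltW u0)) powR_gtD//; congr (_ `^ _); ring.
  by field; rewrite gt_eqF.
have bE : z `^ (1 - 2 * rho) * qwt N s rho z = z `^ (1 - 3 * rho) / mwt N s z.
  rewrite /qwt mulrA powR_gtD//; congr (_ `^ _ / _); ring.
have dec u : z <= u -> u `^ (1 - 2 * rho) <= z `^ (1 - 2 * rho).
  move=> zu; rewrite -(opprK (1 - 2 * rho)) !(powRN _ (- _)) lef_pV2 ?posrE ?powR_gt0//; last by lra.
  apply: ge0_ler_powR; rewrite ?nnegrE//; lra.
have B0 : 0 <= z `^ (1 - 3 * rho) / mwt N s z.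
  by rewrite divr_ge0 ?powR_ge0// ltW// mwt_gt0.
have one : z `^ (1 - 2 * rho) * qwt N s rho z <= z `^ (- (1 / 2) - d) by rewrite bE.
have fin A : A <= z `^ (1 - 2 * rho) * qwt N s rho z ->
    A <= 2 `^ (rho + `|s|) * z `^ (- (1 / 2) - d).
  move=> AB; apply: (le_trans AB); apply: (le_trans one).
  by rewrite ler_peMl// powR_ge0.
have m0 u : 0 <= u * mwt N s u ^+ 2 -> 0 <= u * mwt N s u ^+ 2 by [].
have om u : 0 < u -> 0 <= u * mwt N s u ^+ 2.
  by move=> u0; rewrite mulr_ge0 ?exprn_ge0// ltW// mwt_gt0.
rewrite !inE => /or3P[] /eqP ->.
- apply: (@le_trans _ _ (2 `^ (rho + `|s|) * (z `^ (1 - 2 * rho) * qwt N s rho z))); last first.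
    exact: ler_wpM2l.
  apply: (@le_trans _ _ (2 `^ (rho + `|s|) * (x `^ (1 - 2 * rho) * qwt N s rho z))); last first.
    by apply: ler_wpM2l => //; apply: ler_wpM2r => //; exact: dec.
  rewrite -(qE x x0).
  have : x * mwt N s x ^+ 2 * (qwt N s rho x * qwt N s rho y * qwt N s rho z) <=
     x * mwt N s x ^+ 2 * (qwt N s rho x * (2 `^ (rho + `|s|) * qwt N s rho x) * qwt N s rho z).
    apply: ler_wpM2l; first exact: om.
    by apply: ler_wpM2r => //; apply: ler_wpM2l.
  by move=> H; apply: (le_trans H); rewrite le_eqVlt; apply/orP; left; apply/eqP; ring.
- apply: fin; apply: (@le_trans _ _ (y `^ (1 - 2 * rho) * qwt N s rho z)); last first.
    by apply: ler_wpM2r => //; exact: dec.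
  rewrite -(qE y y0).
  have : y * mwt N s y ^+ 2 * (qwt N s rho x * qwt N s rho y * qwt N s rho z) <=
     y * mwt N s y ^+ 2 * (qwt N s rho y * qwt N s rho y * qwt N s rho z).
    apply: ler_wpM2l; first exact: om.
    by apply: ler_wpM2r => //; apply: ler_wpM2r => //; exact: qwt_decr.
  by move=> H; apply: (le_trans H); rewrite le_eqVlt; apply/orP; left; apply/eqP; ring.
- apply: fin; rewrite -(qE z z0).
  have : z * mwt N s z ^+ 2 * (qwt N s rho x * qwt N s rho y * qwt N s rho z) <=
     z * mwt N s z ^+ 2 * (qwt N s rho z * qwt N s rho z * qwt N s rho z).
    apply: ler_wpM2l; first exact: om.
    apply: ler_wpM2r => //; apply: ler_pM => //; exact: qwt_decr.
  by move=> H; apply: (le_trans H); rewrite le_eqVlt; apply/orP; left; apply/eqP; ring.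
Qed.

(* By the mean value theorem the two high frequencies x and y cancel up to the
   low frequency z. *)
Lemma symbol_le (R : realType) (N s x y z : R) : 1 <= N ->
  0 < z -> z <= y -> x = y + z ->
  `|x * mwt N s x ^+ 2 - y * mwt N s y ^+ 2 - z * mwt N s z ^+ 2| <=
    (2 + `|2 * s|) * 2 `^ `|2 * s| * z * (mwt N s x ^+ 2 + mwt N s z ^+ 2).
Proof.
move=> N1 z0 zy xE.
have N0 : 0 < N by lra.
have y0 : 0 < y by lra.
have yx : y <= x by lra.
have x2y : x <= 2 * y by lra.
have E u : mwt N s u ^+ 2 = cutoff N u `^ (2 * s).
  by rewrite -powR_mulrn ?powR_ge0// -powRrM mulrC.
rewrite !E.
set a := cutoff N x; set b := cutoff N y.
have b0 : 0 < b by exact: cutoff_gt0.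
have ba : b <= a by exact: cutoff_le.
have a2b : a <= 2 * b.
  have := cutoff_ratio N0 y0 yx; rewrite ler_pdivrMr// => /le_trans; apply.
  by rewrite ler_pM2r// ler_pdivrMr.
have [d1 d2] := powR_doubling (2 * s) b0 ba a2b.
have df := powR_diff_le (2 * s) b0 ba.
have rat : (a - b) / b <= z / y.
  have := cutoff_ratio N0 y0 yx; rewrite -/a -/b.
  rewrite mulrBl divff ?gt_eqF// => r.
  have : z / y = x / y - 1 by rewrite xE; field; rewrite gt_eqF.
  by move=> ->; move: r; clear; lra.
set A := a `^ (2 * s) in d1 d2 df *; set B := b `^ (2 * s) in d1 d2 df *.
set D := cutoff N z `^ (2 * s).
set c := 2 `^ `|2 * s| in d1 d2 *.
have c1 : 1 <= c.
  by rewrite /c -[leLHS](powRr0 2); apply: powR_ge1_le => //; lra.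
have A0 : 0 <= A by exact: powR_ge0.
have D0 : 0 <= D by exact: powR_ge0.
have mx : Num.max A B <= c * A.
  rewrite ge_max d2 andbT; have := ler_wpM2r A0 c1; clear; lra.
have yAB : y * `|A - B| <= `|2 * s| * z * (c * A).
  have yrat : y * ((a - b) / b) <= z by rewrite mulrC -ler_pdivlMr.
  have := ler_wpM2l (ltW y0) df.
  have step : `|2 * s| * (y * ((a - b) / b)) * Num.max A B <= `|2 * s| * z * (c * A).
    apply: ler_pM.
    - by rewrite mulr_ge0// mulr_ge0 ?(ltW y0)// divr_ge0 ?subr_ge0// ltW.
    - by rewrite le_max A0.
    - by apply: ler_wpM2l.
    - exact: mx.
  by move=> H; apply: (le_trans H); apply: le_trans step; rewrite le_eqVlt; apply/orP; left; apply/eqP; ring.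
have -> : x * A - y * B - z * D = z * A + y * (A - B) - z * D by rewrite xE; ring.
have t1 : `|z * A + y * (A - B) - z * D| <= z * A + y * `|A - B| + z * D.
  apply: le_trans (ler_normB _ _) _; apply: lerD; last by rewrite ger0_norm ?mulr_ge0// ltW.
  apply: le_trans (ler_normD _ _) _; rewrite [`|y * _|]normrM (ger0_norm (ltW y0)) lerD2r.
  by rewrite ger0_norm ?mulr_ge0// ltW.
apply: (le_trans t1).
have zA0 : 0 <= z * A by rewrite mulr_ge0// ltW.
have zD0 : 0 <= z * D by rewrite mulr_ge0// ltW.
have s0 : 0 <= `|2 * s| by [].
have p1 := ler_wpM2r zA0 c1; have p2 := ler_wpM2r zD0 c1.
have c0 : 0 <= c by exact: powR_ge0.
have p3 : 0 <= `|2 * s| * c * (z * D) by exact: mulr_ge0 (mulr_ge0 s0 c0) zD0.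
have p4 : 0 <= c * (z * D) by exact: mulr_ge0.
have p5 : 0 <= c * (z * A) by exact: mulr_ge0.
move: p1 p2 p3 p4 p5 yAB; clear; lra.
Qed.

Lemma mwt_eq1 (R : realType) (N s x : R) : 0 < N -> x <= N -> mwt N s x = 1.
Proof.
move=> N0 xN; rewrite /mwt /cutoff (max_idPl _) ?powR1//.
by rewrite ler_pdivrMr ?mul1r.
Qed.

(** If [x <= N] all weights are [1] and the symbol vanishes. Otherwise [symbol_le] trades the
    derivative for the low frequency [z], and the two factors [qwt] at the frequencies [x] and [y]
    of size at least comparable to [N] are available for the gain. *)
Lemma energy_kernel_le (R : realType) (N rho s d beta x y z : R) :
  kernel_params rho s d beta -> 1 <= N -> 1 <= z -> z <= y -> x = y + z ->
  `|x * mwt N s x ^+ 2 - y * mwt N s y ^+ 2 - z * mwt N s z ^+ 2|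
    * (qwt N s rho x * qwt N s rho y * qwt N s rho z) <=
    2 * (2 + `|2 * s|) * 2 `^ `|2 * s| * 2 `^ (rho + `|s|)
      * (N `^ (- beta) * z `^ (- (1 / 2) - d)).
Proof.
move=> KP N1 z1 zy xE; have [k1 k2 k3 k4 k5 k6 k7 k8] := KP.
have N0 : 0 < N by lra.
have rho0 : 0 < rho by lra.
have z0 : 0 < z by lra.
have y0 : 0 < y by lra.
have x0 : 0 < x by lra.
have yx : y <= x by lra.
have x2y : x <= 2 * y by lra.
have zx : z <= x by lra.
have [xN|Nx] := leP x N.
  have yN : y <= N by exact: le_trans xN.
  have zN : z <= N by exact: le_trans xN.
  rewrite !mwt_eq1// expr1n !mulr1 xE (_ : y + z - y - z = 0); last by ring.
  by rewrite normr0 mul0r !mulr_ge0 ?powR_ge0 ?addr_ge0.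
have {}Nx := ltW Nx.
have q0 u : 0 <= qwt N s rho u by exact: qwt_ge0.
have m0 u : 0 < mwt N s u by exact: mwt_gt0.
have sy := symbol_le s N1 z0 zy xE.
have qd := qwt_doubling s N0 rho0 y0 yx x2y.
set c := (2 + _) * _ in sy.
have c0 : 0 <= c by rewrite /c mulr_ge0 ?powR_ge0// addr_ge0.
have -> : 2 * (2 + `|2 * s|) * 2 `^ `|2 * s| * 2 `^ (rho + `|s|)
      * (N `^ (- beta) * z `^ (- (1 / 2) - d)) =
   c * 2 `^ (rho + `|s|) * (2 * (N `^ (- beta) * z `^ (- (1 / 2) - d))) by rewrite /c; ring.
clearbody c.
have c'0 : 0 <= 2 `^ (rho + `|s|) :> R by exact: powR_ge0.
set c' := 2 `^ _ in qd c'0 *; clearbody c'.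
set th := z `^ (- (1 / 2) - d).
have th0 : 0 <= th by exact: powR_ge0.
(* [E] is the exponent left of [z ^ (1 - rho)] once the square summable factor [th] is set aside. *)
pose E := 3 / 2 + d - rho.
have zE : z `^ (1 - rho) = th * z `^ E.
  by rewrite /th powR_gtD//; congr (_ `^ _); rewrite /E; field.
have zq : z * qwt N s rho z = z `^ (1 - rho) / mwt N s z.
  rewrite /qwt mulrA; congr (_ / _).
  by rewrite -{1}(powRr1 (ltW z0)) powR_gtD.
have xq : mwt N s x ^+ 2 * qwt N s rho x ^+ 2 = x `^ (- (2 * rho)).
  rewrite /qwt expr_div_n mulrCA mulfV ?mulr1 ?gt_eqF ?exprn_gt0//.
  by rewrite expr2 powR_gtD//; congr (_ `^ _); ring.
(* This determines [beta]: for [E <= 0] the exponent of [u] is [- 2 rho], for [E > 0] it is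
   [E - 2 rho = 3 / 2 + d - 3 rho]. *)
have CL u : z <= u -> N <= u -> z `^ E * u `^ (- (2 * rho)) <= N `^ (- beta).
  move=> zu Nu; have u1 : 1 <= u by exact: le_trans zu.
  have u0 : 0 < u by lra.
  have zuE : z `^ E <= u `^ Num.max 0 E.
    apply: (@le_trans _ _ (z `^ Num.max 0 E)).
      by apply: powR_ge1_le => //; rewrite le_max lexx orbT.
    by apply: ge0_ler_powR; rewrite ?nnegrE ?(ltW z0) ?(ltW u0)// le_max lexx.
  apply: (@le_trans _ _ (u `^ (- beta))).
    apply: (@le_trans _ _ (u `^ Num.max 0 E * u `^ (- (2 * rho)))).
      by apply: ler_wpM2r => //; exact: powR_ge0.
    rewrite powR_gtD//; apply: powR_ge1_le => //.
    by have [E0|E0] := leP 0 E; move: k7 k8; rewrite /E; clear; lra.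
  rewrite !powRN lef_pV2 ?posrE ?powR_gt0//.
  by apply: ge0_ler_powR; rewrite ?nnegrE ?(ltW N0) ?(ltW u0).
have main mu : mu = mwt N s x ^+ 2 \/ mu = mwt N s z ^+ 2 ->
    z * mu * qwt N s rho x ^+ 2 * qwt N s rho z <= N `^ (- beta) * th.
  (* For [s >= 0] the weight at [x] dominates and cancels against the two factors [qwt] at [x]. For
     [s < 0] the weight at [z] dominates, and monotonicity of [qwt] moves those factors to [N] or to
     [z]. *)
  have [s0|s0] := leP 0 s.
    have m_ge1 u : 1 <= mwt N s u.
      by rewrite -[leLHS](powRr0 (cutoff N u)); apply: powR_ge1_le; rewrite ?cutoff_ge1.
    have mzx : mwt N s z <= mwt N s x.
      by apply: ge0_ler_powR; rewrite ?nnegrE ?(ltW (cutoff_gt0 _ _)) ?cutoff_le.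
    have X1 : mu = mwt N s x ^+ 2 \/ mu = mwt N s z ^+ 2 -> mu <= mwt N s x ^+ 2.
      by case=> -> //; rewrite lerXn2r// nnegrE ltW.
    move=> /X1 mux.
    have le1 : z * mu * qwt N s rho x ^+ 2 * qwt N s rho z <=
        z * mwt N s x ^+ 2 * qwt N s rho x ^+ 2 * qwt N s rho z.
      apply: ler_wpM2r => //; apply: ler_wpM2r; first exact: exprn_ge0.
      by apply: ler_wpM2l => //; exact: ltW.
    apply: (le_trans le1).
    have -> : z * mwt N s x ^+ 2 * qwt N s rho x ^+ 2 * qwt N s rho z =
      (mwt N s x ^+ 2 * qwt N s rho x ^+ 2) * (z * qwt N s rho z) by ring.
    rewrite xq zq zE.
    apply: (@le_trans _ _ (x `^ (- (2 * rho)) * (th * z `^ E))).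
      apply: ler_wpM2l; first exact: powR_ge0.
      by rewrite ler_pdivrMr// ler_peMr// mulr_ge0// powR_ge0.
    have := ler_wpM2l th0 (CL x zx Nx).
    by rewrite (mulrC th (N `^ _)) => H; apply: le_trans H; rewrite le_eqVlt; apply/orP; left; apply/eqP; ring.
  have mzx : mwt N s x <= mwt N s z.
    have e u : mwt N s u = (cutoff N u `^ (- s))^-1 by rewrite -powRN opprK.
    rewrite !e lef_pV2 ?posrE ?powR_gt0 ?cutoff_gt0//.
    have ns : 0 <= - s by rewrite oppr_ge0 ltW.
    by apply: ge0_ler_powR; rewrite ?nnegrE ?(ltW (cutoff_gt0 _ _)) ?cutoff_le.
  have X1 : mu = mwt N s x ^+ 2 \/ mu = mwt N s z ^+ 2 -> mu <= mwt N s z ^+ 2.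
    by case=> -> //; rewrite lerXn2r// nnegrE ltW.
  move=> /X1 mux.
  have le1 : z * mu * qwt N s rho x ^+ 2 * qwt N s rho z <=
      z * mwt N s z ^+ 2 * qwt N s rho x ^+ 2 * qwt N s rho z.
    apply: ler_wpM2r => //; apply: ler_wpM2r; first exact: exprn_ge0.
    by apply: ler_wpM2l => //; exact: ltW.
  apply: (le_trans le1); clear le1 mux X1.
  have -> : z * mwt N s z ^+ 2 * qwt N s rho x ^+ 2 * qwt N s rho z =
    mwt N s z ^+ 2 * (z * qwt N s rho z) * qwt N s rho x ^+ 2 by ring.
  rewrite zq zE.
  have -> : mwt N s z ^+ 2 * (th * z `^ E / mwt N s z) = th * z `^ E * mwt N s z.
    by field; rewrite gt_eqF.
  rewrite [leRHS]mulrC -!mulrA; apply: ler_wpM2l => //.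
  have zE0 : 0 <= z `^ E by exact: powR_ge0.
  have [zN|Nz] := leP z N.
    rewrite (@mwt_eq1 _ N s z)// mul1r; apply: le_trans (CL N zN (lexx N)).
    apply: ler_wpM2l => //.
    have qN : qwt N s rho N = N `^ (- rho) by rewrite /qwt mwt_eq1// divr1.
    have := qwt_decr N0 rho0 k2 N0 Nx; rewrite qN => qx.
    have -> : N `^ (- (2 * rho)) = N `^ (- rho) ^+ 2.
      by rewrite expr2 powR_gtD//; congr (_ `^ _); ring.
    by rewrite lerXn2r ?nnegrE// powR_ge0.
  have Nz' := ltW Nz.
  have qx := qwt_decr N0 rho0 k2 z0 zx.
  apply: (@le_trans _ _ (z `^ E * (mwt N s z * qwt N s rho z ^+ 2))).
    apply: ler_wpM2l => //; apply: ler_wpM2l; first exact: ltW.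
    by rewrite lerXn2r ?nnegrE.
  have cz : cutoff N z = z / N.
    by apply/max_idPr; rewrite ler_pdivlMr// mul1r.
  have -> : mwt N s z * qwt N s rho z ^+ 2 = z `^ (- (2 * rho)) * (z / N) `^ (- s).
    have -> : z `^ (- (2 * rho)) = z `^ (- rho) ^+ 2.
      by rewrite expr2 powR_gtD//; congr (_ `^ _); ring.
    rewrite (powRN (z / N)) -cz -/(mwt N s z) /qwt.
    by field; rewrite gt_eqF.
  have -> : (z / N) `^ (- s) = z `^ (- s) * N `^ s.
    rewrite powRM ?invr_ge0 ?ltW//; congr (_ * _).
    by rewrite -(powR_inv1 (ltW N0)) -powRrM mulN1r opprK.
  have -> : z `^ E * (z `^ (- (2 * rho)) * (z `^ (- s) * N `^ s)) =
     z `^ (E - 2 * rho - s) * N `^ s by rewrite -!powR_gtD//; ring.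
  apply: (@le_trans _ _ (N `^ (E - 2 * rho - s) * N `^ s)).
    apply: ler_wpM2r; first exact: powR_ge0.
    have en : 0 <= - (E - 2 * rho - s) by rewrite /E; lra.
    rewrite -(opprK (E - 2 * rho - s)) !(powRN _ (- _)) lef_pV2 ?posrE ?powR_gt0//.
    by apply: ge0_ler_powR; rewrite ?nnegrE ?(ltW N0) ?(ltW z0).
  rewrite powR_gtD//; apply: powR_ge1_le => //; rewrite /E; lra.
apply: (@le_trans _ _ (c * z * (mwt N s x ^+ 2 + mwt N s z ^+ 2) *
   (qwt N s rho x * (c' * qwt N s rho x) * qwt N s rho z))).
  apply: ler_pM; [exact: normr_ge0|exact: mulr_ge0 (mulr_ge0 (q0 _) (q0 _)) (q0 _)|exact: sy|].
  by apply: ler_wpM2r => //; apply: ler_wpM2l.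
have M1 := main _ (or_introl erefl); have M2 := main _ (or_intror erefl).
have cc : 0 <= c * c' by exact: mulr_ge0.
have := ler_wpM2l cc (lerD M1 M2).
by move=> H; apply: le_trans (le_trans H _); rewrite le_eqVlt; apply/orP; left; apply/eqP; ring.
Qed.

(** * Sums over integers *)

(** Boxes symmetric under [n |-> - n], as conjugation requires; increasing limits over them replace
    sums over arbitrary finite sets. [locked] keeps the list from unfolding. *)
Definition zbox (K : nat) : seq int :=
  locked [seq i%:Z - K%:Z | i <- iota 0 K.*2.+1].

Lemma uniq_zbox K : uniq (zbox K).
Proof. by rewrite /zbox -lock map_inj_uniq ?iota_uniq// => i j; lia. Qed.

Lemma mem_zbox K (n : int) : (n \in zbox K) = (`|n|%N <= K)%N.
Proof.
rewrite /zbox -lock.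
apply/mapP/idP; first by case=> i; rewrite mem_iota => + ->; lia.
by move=> nK; exists (absz (n + K%:Z)); rewrite ?mem_iota; lia.
Qed.

Lemma zboxS K : perm_eq (zbox K.+1) [:: K.+1%:Z, - K.+1%:Z & zbox K].
Proof.
apply: uniq_perm; first exact: uniq_zbox.
  by rewrite 2!cons_uniq uniq_zbox in_cons !mem_zbox; lia.
by move=> n; rewrite mem_zbox 2!in_cons mem_zbox; lia.
Qed.

Lemma zbox_opp K : perm_eq (zbox K) [seq - n | n <- zbox K].
Proof.
apply: uniq_perm; [exact: uniq_zbox| |].
  by rewrite map_inj_uniq ?uniq_zbox//; exact: oppr_inj.
move=> n; apply/idP/mapP => [nK|]; first by exists (- n); rewrite ?opprK// mem_zbox abszN -mem_zbox.
by case=> m; rewrite !mem_zbox => + ->; rewrite abszN.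
Qed.

Lemma sum_zboxS (V : nmodType) K (F : int -> V) :
  \sum_(n <- zbox K.+1) F n = F K.+1%:Z + (F (- K.+1%:Z) + \sum_(n <- zbox K) F n).
Proof. by rewrite (perm_big _ (zboxS K)) 2!big_cons. Qed.

(** The optimal [t] is [B / A]; if [A] or [B] vanishes, another choice of [t] contradicts
    [S > 0]. *)
Lemma amgm_opt (R : realType) (S A B : R) : 0 <= A -> 0 <= B ->
  (forall t, 0 < t -> 2 * S <= t * A ^+ 2 + B ^+ 2 / t) -> S <= A * B.
Proof.
move=> A0 B0 H.
have [S0|S0] := leP S 0; first by apply: (le_trans S0); exact: mulr_ge0.
have [A1|A1] := eqVneq A 0.
  move: H; rewrite A1 expr0n/= mul0r => H.
  have t0 : 0 < (B ^+ 2 + 1) / S by rewrite divr_gt0// ltr_wpDl// exprn_ge0.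
  have := H _ t0; rewrite mulr0 add0r invf_div mulrA.
  have D0 : 0 < B ^+ 2 + 1 by rewrite ltr_wpDl// exprn_ge0.
  rewrite ler_pdivlMr// => H2.
  have : 0 <= S * B ^+ 2 by rewrite mulr_ge0 ?exprn_ge0// ltW.
  by move: H2 S0; clear; lra.
have A2 : 0 < A by rewrite lt0r A1.
have [B1|B1] := eqVneq B 0.
  move: H; rewrite B1 expr0n/= mulr0 => H.
  have t0 : 0 < S / A ^+ 2 by rewrite divr_gt0// exprn_gt0.
  have := H _ t0; rewrite mul0r addr0 divfK ?gt_eqF ?exprn_gt0//.
  by move: S0; clear; lra.
have B2 : 0 < B by rewrite lt0r B1.
have := H _ (divr_gt0 B2 A2).
have -> : B / A * A ^+ 2 + B ^+ 2 / (B / A) = 2 * (A * B).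
  by field; rewrite A1 B1.
by rewrite ler_pM2l.
Qed.

Lemma cauchy_schwarz_seq (R : realType) (I : Type) (r : seq I) (x y : I -> R) (A B : R) :
  0 <= A -> 0 <= B -> \sum_(i <- r) x i ^+ 2 <= A ^+ 2 ->
  \sum_(i <- r) y i ^+ 2 <= B ^+ 2 -> \sum_(i <- r) x i * y i <= A * B.
Proof.
move=> A0 B0 xA yB; apply: amgm_opt => // t t0.
apply: (@le_trans _ _ (t * (\sum_(i <- r) x i ^+ 2) + (\sum_(i <- r) y i ^+ 2) / t)).
  rewrite !mulr_sumr mulr_suml -big_split/=; apply: ler_sum => i _.
  have := sqr_ge0 (t * x i - y i).
  have -> : (t * x i - y i) ^+ 2 = t * (t * x i ^+ 2 + y i ^+ 2 / t - 2 * (x i * y i)).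
    by field; rewrite gt_eqF.
  by rewrite pmulr_rge0// subr_ge0.
apply: lerD; first by rewrite ler_pM2l.
by rewrite ler_pM2r ?invr_gt0.
Qed.

Lemma sum_zero_unique (R : realType) (K : nat) (m : int) (x : R) : 0 <= x ->
  \sum_(c <- zbox K) (if m + c == 0 then x else 0) <= x.
Proof.
move=> x0; have [mK|mK] := boolP (- m \in zbox K).
  rewrite (big_rem (- m) mK) subrr eqxx big1_seq; first by rewrite /= addr0.
  move=> c /andP[_].
  rewrite mem_rem_uniq ?uniq_zbox// inE => /andP[cm _].
  by rewrite ifN//; apply: contra cm => /eqP mc; rewrite -addr_eq0 addrC mc.
rewrite big1_seq// => c /andP[_ cK]; rewrite ifN//.
by apply: contra mK => /eqP mc; rewrite (_ : - m = c)//; apply/eqP; rewrite eq_sym -addr_eq0 addrC mc.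
Qed.

(** Summing over triples of sum zero gives the three functions of a trilinear form equal roles: the
    output frequency [n] enters as [- n], and permuting the functions is exchanging sums. *)
Definition tri (R : realType) (K : nat) (G : int -> int -> int -> R) : R :=
  \sum_(a <- zbox K) \sum_(b <- zbox K) \sum_(c <- zbox K)
    (if a + b + c == 0 then G a b c else 0).

(** For fixed [a] each of [b] and [c] determines the other, so this is the Cauchy-Schwarz
    inequality. *)
Lemma pair_sum_le (R : realType) (K : nat) (a : int) (f g : int -> R) (A B : R) :
  0 <= A -> 0 <= B ->
  \sum_(n <- zbox K) f n ^+ 2 <= A ^+ 2 -> \sum_(n <- zbox K) g n ^+ 2 <= B ^+ 2 ->
  \sum_(b <- zbox K) \sum_(c <- zbox K) (if a + b + c == 0 then f b * g c else 0) <= A * B.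
Proof.
move=> A0 B0 fA gB; apply: amgm_opt => // t t0.
apply: (@le_trans _ _ (t * (\sum_(n <- zbox K) f n ^+ 2) + (\sum_(n <- zbox K) g n ^+ 2) / t)); last first.
  by apply: lerD; [rewrite ler_pM2l|rewrite ler_pM2r ?invr_gt0].
apply: (@le_trans _ _ (t * (\sum_(b <- zbox K) \sum_(c <- zbox K) (if a + b + c == 0 then f b ^+ 2 else 0))
  + (\sum_(b <- zbox K) \sum_(c <- zbox K) (if a + b + c == 0 then g c ^+ 2 else 0)) / t)).
  rewrite !mulr_sumr mulr_suml -big_split/=; apply: ler_sum => b _.
  rewrite !mulr_sumr mulr_suml -big_split/=; apply: ler_sum => c _.
  case: ifP => _; last by rewrite !mulr0 mul0r addr0.
  have := sqr_ge0 (t * f b - g c).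
  have -> : (t * f b - g c) ^+ 2 = t * (t * f b ^+ 2 + g c ^+ 2 / t - 2 * (f b * g c)).
    by field; rewrite gt_eqF.
  by rewrite pmulr_rge0// subr_ge0.
apply: lerD.
  rewrite ler_pM2l//; apply: ler_sum => b _; apply: sum_zero_unique.
  exact: sqr_ge0.
rewrite ler_pM2r ?invr_gt0// exchange_big/=; apply: ler_sum => c _.
under eq_bigr do rewrite addrAC.
by apply: sum_zero_unique; exact: sqr_ge0.
Qed.

Lemma tri_swap12 (R : realType) (K : nat) (G : int -> int -> int -> R) :
  tri K G = tri K (fun a b c => G b a c).
Proof.
rewrite /tri exchange_big/=; apply: eq_bigr => a _; apply: eq_bigr => b _.
by apply: eq_bigr => c _; rewrite (addrC b).
Qed.

Lemma tri_swap23 (R : realType) (K : nat) (G : int -> int -> int -> R) :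
  tri K G = tri K (fun a b c => G a c b).
Proof.
rewrite /tri; apply: eq_bigr => a _; rewrite exchange_big/=.
by apply: eq_bigr => b _; apply: eq_bigr => c _; rewrite addrAC.
Qed.

Lemma ler_tri (R : realType) (K : nat) (F G : int -> int -> int -> R) :
  (forall a b c, a + b + c = 0 -> F a b c <= G a b c) -> tri K F <= tri K G.
Proof.
move=> FG; rewrite /tri; apply: ler_sum => a _; apply: ler_sum => b _.
by apply: ler_sum => c _; case: eqP => // /FG.
Qed.

Lemma triD (R : realType) (K : nat) (F G : int -> int -> int -> R) :
  tri K (fun a b c => F a b c + G a b c) = tri K F + tri K G.
Proof.
rewrite /tri -big_split/=; apply: eq_bigr => a _; rewrite -big_split/=.
apply: eq_bigr => b _; rewrite -big_split/=; apply: eq_bigr => c _.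
by case: ifP; rewrite ?addr0.
Qed.

Lemma triZ (R : realType) (K : nat) (k : R) (F : int -> int -> int -> R) :
  tri K (fun a b c => k * F a b c) = k * tri K F.
Proof.
rewrite /tri mulr_sumr; apply: eq_bigr => a _; rewrite mulr_sumr.
apply: eq_bigr => b _; rewrite mulr_sumr; apply: eq_bigr => c _.
by case: ifP; rewrite ?mulr0.
Qed.

Lemma tri_theta_le (R : realType) (K : nat) (th f g h : int -> R) (A B C D : R) :
  0 <= A -> 0 <= B -> 0 <= C -> 0 <= D ->
  (forall n, 0 <= th n) -> (forall n, 0 <= f n) -> 
  \sum_(n <- zbox K) th n ^+ 2 <= D ^+ 2 ->
  \sum_(n <- zbox K) f n ^+ 2 <= A ^+ 2 -> \sum_(n <- zbox K) g n ^+ 2 <= B ^+ 2 ->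
  \sum_(n <- zbox K) h n ^+ 2 <= C ^+ 2 ->
  tri K (fun a b c => th a * f a * (g b * h c)) <= D * A * B * C.
Proof.
move=> A0 B0 C0 D0 th0 f0 thD fA gB hC.
apply: (@le_trans _ _ (\sum_(a <- zbox K) th a * f a * (B * C))).
  apply: ler_sum => a _.
  apply: (@le_trans _ _ (th a * f a * (\sum_(b <- zbox K) \sum_(c <- zbox K)
      (if a + b + c == 0 then g b * h c else 0)))).
    rewrite mulr_sumr; apply: ler_sum => b _; rewrite mulr_sumr; apply: ler_sum => c _.
    by case: ifP; rewrite ?mulr0.
  by apply: ler_wpM2l; [exact: mulr_ge0|exact: pair_sum_le].
rewrite -mulr_suml -(mulrA (D * A)); apply: ler_wpM2r; first exact: mulr_ge0.
exact: cauchy_schwarz_seq.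
Qed.

(** If the kernel is bounded by a square summable function of one frequency, that frequency is
    summed absolutely, [th * f] being [l1], and the other two are paired by Cauchy-Schwarz. Which
    frequency is the smallest varies, hence the sum of the three possibilities. *)
Lemma tri_kernel_le (R : realType) (K : nat) (kappa D A B C : R) (th f g h : int -> R)
    (k : int -> int -> int -> R) :
  0 <= kappa -> 0 <= A -> 0 <= B -> 0 <= C -> 0 <= D ->
  (forall n, 0 <= th n) -> (forall n, 0 <= f n) -> (forall n, 0 <= g n) ->
  (forall n, 0 <= h n) ->
  (forall a b c, a + b + c = 0 -> k a b c <= kappa * (th a + th b + th c)) ->
  \sum_(n <- zbox K) th n ^+ 2 <= D ^+ 2 ->
  \sum_(n <- zbox K) f n ^+ 2 <= A ^+ 2 -> \sum_(n <- zbox K) g n ^+ 2 <= B ^+ 2 ->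
  \sum_(n <- zbox K) h n ^+ 2 <= C ^+ 2 ->
  tri K (fun a b c => k a b c * (f a * g b * h c)) <= 3 * D * kappa * (A * B * C).
Proof.
move=> k0 A0 B0 C0 D0 th0 f0 g0 h0 kP thD fA gB hC.
pose F1 a b c := th a * f a * (g b * h c).
pose F2 a b c := th b * g b * (f a * h c).
pose F3 a b c := th c * h c * (f a * g b).
apply: (@le_trans _ _ (kappa * (tri K F1 + tri K F2 + tri K F3))).
  rewrite -!triD -triZ; apply: ler_tri => a b c abc.
  apply: (@le_trans _ _ (kappa * (th a + th b + th c) * (f a * g b * h c))).
    by apply: ler_wpM2r; rewrite ?mulr_ge0//; exact: kP.
  by rewrite le_eqVlt /F1 /F2 /F3; apply/orP; left; apply/eqP; ring.
have H1 : tri K F1 <= D * A * B * C by exact: tri_theta_le.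
have H2 : tri K F2 <= D * B * A * C by rewrite tri_swap12; exact: tri_theta_le.
have H3 : tri K F3 <= D * C * A * B.
  by rewrite tri_swap23 tri_swap12; exact: tri_theta_le.
have := ler_wpM2l k0 (lerD (lerD H1 H2) H3).
by move=> H; apply: (le_trans H); rewrite le_eqVlt; apply/orP; left; apply/eqP; ring.
Qed.

(** The comparison of [n ^ (- 1 - p)] with an integral over [[n - 1, n]], in telescoping form; it
    follows from [ln r <= r - 1] for [r = (n - 1) / n]. *)
Lemma powR_telescope (R : realType) (p : R) (K : nat) : 0 < p ->
  K.+2%:R `^ (- (1 + p)) <= p^-1 * (K.+1%:R `^ (- p) - K.+2%:R `^ (- p)) :> R.
Proof.
move=> p0; rewrite -(ler_pM2l p0) mulrA divff ?gt_eqF// mul1r.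
set n : R := K.+2%:R; have n0 : 0 < n by rewrite ltr0n.
have mE : K.+1%:R = n - 1 :> R by rewrite /n -(natr1 K.+1) addrK.
have m0 : 0 < n - 1 by rewrite -mE ltr0n.
pose r := (n - 1) / n; have r0 : 0 < r by rewrite divr_gt0.
have -> : n `^ (- (1 + p)) = n^-1 * n `^ (- p).
  by rewrite opprD powRD ?(gt_eqF n0) ?implybT// powR_inv1// ltW.
have -> : K.+1%:R `^ (- p) = r `^ (- p) * n `^ (- p).
  by rewrite mE -powRM ?ltW// /r divfK// gt_eqF.
rewrite -{3}(mul1r (n `^ _)) -mulrBl mulrA.
apply: ler_wpM2r; first exact: powR_ge0.
have rE : r = 1 + - n^-1 by rewrite /r; field; rewrite gt_eqF.
have : ln r <= - n^-1.
  rewrite rE; apply: le_ln1Dx; rewrite ltrN2 invf_lt1// /n ltr1n//.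
have : 1 + - p * ln r <= r `^ (- p) by rewrite /powR gt_eqF// expR_ge1Dx.
move=> h1 h2; have {}h2 := ler_wpM2l (ltW p0) h2.
rewrite mulNr in h1; rewrite mulrN in h2.
move: h1 h2; move: (p * ln r) (p * n^-1) (r `^ (- p)) => X Y Z; clear; lra.
Qed.

Lemma theta_summable (R : realType) (d : R) : 0 < d -> exists2 D : R, 0 <= D &
  forall K, \sum_(n <- zbox K)
    (if n == 0 then 0 else (`|n|%N%:R : R) `^ (- (1 / 2) - d)) ^+ 2 <= D ^+ 2.
Proof.
move=> d0; pose p := 2 * d; have p0 : 0 < p by rewrite mulr_gt0.
have sqE (k : nat) : (k%:R `^ (- (1 / 2) - d)) ^+ 2 = k%:R `^ (- (1 + p)) :> R.
  by rewrite -powR_mulrn ?powR_ge0// -powRrM; congr (_ `^ _); rewrite /p; field.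
exists (Num.sqrt (2 * (1 + p^-1))); first exact: sqrtr_ge0.
move=> K; rewrite sqr_sqrtr; last by rewrite mulr_ge0// addr_ge0 ?invr_ge0 ?ltW.
have step k : \sum_(n <- zbox k.+1)
    (if n == 0 then 0 else (`|n|%N%:R : R) `^ (- (1 / 2) - d)) ^+ 2
    <= 2 * (1 + p^-1 - p^-1 * k.+1%:R `^ (- p)).
  elim: k => [|k IH].
    rewrite sum_zboxS /= !sqE powR1.
    rewrite big1_seq; last first.
      by move=> n /andP[_]; rewrite mem_zbox leqn0 absz_eq0 => /eqP ->; rewrite eqxx expr0n.
    by lra.
  rewrite sum_zboxS /= !sqE.
  have := powR_telescope k p0; move: IH; clear; lra.
case: K => [|K].
  rewrite big1_seq ?mulr_ge0 ?addr_ge0 ?invr_ge0 ?(ltW p0)//.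
  by move=> n /andP[_]; rewrite mem_zbox leqn0 absz_eq0 => /eqP ->; rewrite eqxx expr0n.
apply: le_trans (step K) _; rewrite ler_pM2l// gerBl.
by rewrite mulr_ge0 ?powR_ge0// invr_ge0 ltW.
Qed.

(** * Weighted square-summable families *)

Definition dotc (R : realType) (z w : R[i]) : R :=
  complex.Re z * complex.Re w + complex.Im z * complex.Im w.

Lemma dotc_normc (R : realType) (z : R[i]) : dotc z z = normc z ^+ 2.
Proof. by case: z => a b; rewrite /dotc /= sqr_sqrtr ?addr_ge0 ?sqr_ge0. Qed.

Lemma normc_ge0 (R : realType) (z : R[i]) : 0 <= normc z.
Proof. by case: z => a b; exact: sqrtr_ge0. Qed.

Lemma dotc_le (R : realType) (z w : R[i]) : `|dotc z w| <= normc z * normc w.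
Proof.
rewrite -(@ler_pXn2r _ 2)// ?nnegrE ?mulr_ge0 ?normc_ge0//.
rewrite exprMn -!dotc_normc -normrX ger0_norm ?sqr_ge0//.
case: z w => a b [c d]; rewrite /dotc /= -subr_ge0.
have -> : (a * a + b * b) * (c * c + d * d) - (a * c + b * d) ^+ 2 = (a * d - b * c) ^+ 2 by ring.
exact: sqr_ge0.
Qed.

Section WeightedL2.
Context {R : realType}.
Variable W : int -> {posnum R}.
Implicit Types f g : coeffs R.

Definition wdot f g (K : nat) : R :=
  \sum_(n <- zbox K) (W n)%:num ^+ 2 * dotc (f n) (g n).

Definition l2_prop f : Prop :=
  real_valued f /\ exists B, forall K, wdot f f K <= B.

Definition l2_pred : {pred coeffs R} := fun f => `[< l2_prop f >].

(** Real-valued families, so the space is a real inner product space. The weight is an argument of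
    the type: each choice of [N] has its own norm structure, and [l2v] gives the common
    coefficients. *)
Record l2 := L2 { l2v :> coeffs R ; l2vP : l2v \in l2_pred }.

HB.instance Definition _ := [isSub for l2v].
HB.instance Definition _ := [Choice of l2 by <:].

Lemma wdotDl f g h K : wdot (f + g) h K = wdot f h K + wdot g h K.
Proof.
rewrite /wdot -big_split/=; apply: eq_bigr => n _; rewrite -mulrDr; congr (_ * _).
by rewrite /dotc !raddfD/=; ring.
Qed.

Lemma wdotNl f g K : wdot (- f) g K = - wdot f g K.
Proof.
rewrite /wdot -sumrN; apply: eq_bigr => n _; rewrite -mulrN; congr (_ * _).
by rewrite /dotc !raddfN/=; ring.
Qed.

Lemma wdotC f g K : wdot f g K = wdot g f K.
Proof. by rewrite /wdot; apply: eq_bigr => n _; rewrite /dotc; congr (_ * _); ring. Qed.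

Lemma wdot_ge0 f K : 0 <= wdot f f K.
Proof.
rewrite /wdot; apply: sumr_ge0 => n _; rewrite mulr_ge0 ?sqr_ge0//.
by rewrite dotc_normc sqr_ge0.
Qed.

Lemma wdot_sqD f g K : wdot (f + g) (f + g) K = wdot f f K + 2 * wdot f g K + wdot g g K.
Proof.
by rewrite !wdotDl !(wdotC _ (f + g)) !wdotDl (wdotC g f); ring.
Qed.

Lemma wdot_nd f : nondecreasing_seq (wdot f f).
Proof.
apply/nondecreasing_seqP => K; rewrite /wdot sum_zboxS.
by rewrite addrA lerDr addr_ge0// mulr_ge0 ?sqr_ge0// dotc_normc sqr_ge0.
Qed.

Lemma l2_zmod_closed : zmod_closed l2_pred.
Proof.
split.
  apply/asboolP; split => [n|]; first by rewrite conjc0.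
  by exists 0 => K; rewrite /wdot big1// => n _; rewrite /dotc /=; ring.
move=> f g /asboolP[fr [A fA]] /asboolP[gr [B gB]]; apply/asboolP; split.
  by move=> n; rewrite /= -[(f - g) (- n)]/(f (- n) - g (- n)) fr gr -rmorphB.
exists (2 * A + 2 * B) => K.
(* The parallelogram identity bounds [f - g]. *)
have := wdot_ge0 (f + g) K.
have : wdot (f - g) (f - g) K + wdot (f + g) (f + g) K = 2 * wdot f f K + 2 * wdot g g K.
  by rewrite !wdot_sqD wdotNl !(wdotC _ (- g)) !wdotNl (wdotC g f); ring.
have := fA K; have := gB K; lra.
Qed.

HB.instance Definition _ := GRing.isZmodClosed.Build (coeffs R) l2_pred l2_zmod_closed.
HB.instance Definition _ := [SubChoice_isSubZmodule of l2 by <:].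

End WeightedL2.

Lemma limn_le_bound (R : realType) (u : R^nat) (l B : R) :
  u @ \oo --> l -> (forall k, u k <= B) -> l <= B.
Proof.
move=> ul uB; rewrite -(cvg_lim (@Rhausdorff R) ul).
by apply: limr_le; [apply/cvg_ex; exists l|apply: nearW].
Qed.

Lemma limn_ge_bound (R : realType) (u : R^nat) (l B : R) :
  u @ \oo --> l -> (forall k, B <= u k) -> B <= l.
Proof.
move=> ul uB; rewrite -(cvg_lim (@Rhausdorff R) ul).
by apply: limr_ge; [apply/cvg_ex; exists l|apply: nearW].
Qed.

Section L2Norm.
Context {R : realType} {W : int -> {posnum R}}.
Implicit Types f g h : l2 W.

Definition l2ip f g : R := limn (wdot W f g).

Lemma l2_real f : real_valued f.
Proof. by case: f => f /= /asboolP[]. Qed.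

Lemma cvg_wdot_sq f : wdot W f f @ \oo --> l2ip f f.
Proof.
case: f => f /= fP; have /asboolP[_ [B fB]] := fP.
apply: (nondecreasing_is_cvgn (wdot_nd W f)).
by exists B => _ [K _ <-].
Qed.

(** By polarisation from squares, whose box sums are monotone and bounded. *)
Lemma cvg_wdot f g : wdot W f g @ \oo --> l2ip f g.
Proof.
suff : cvgn (wdot W f g) by [].
have -> : wdot W f g = fun K => 2^-1 * (wdot W (f + g) (f + g) K - wdot W f f K - wdot W g g K).
  by apply/funext => K; rewrite wdot_sqD; field.
apply: is_cvgMr; apply: is_cvgB; first apply: is_cvgB.
- exact: (cvgP _ (@cvg_wdot_sq (f + g))).
- exact: (cvgP _ (@cvg_wdot_sq f)).
- exact: (cvgP _ (@cvg_wdot_sq g)).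
Qed.

Lemma l2ip_eq f g (l : R) : wdot W f g @ \oo --> l -> l2ip f g = l.
Proof. by move=> fl; exact: (cvg_unique (@Rhausdorff R) (@cvg_wdot f g) fl). Qed.

Lemma l2ipC f g : l2ip f g = l2ip g f.
Proof.
apply: l2ip_eq; rewrite (_ : wdot W f g = wdot W g f); first exact: cvg_wdot.
by apply/funext => K; exact: wdotC.
Qed.

Lemma l2ipDl f g h : l2ip (f + g) h = l2ip f h + l2ip g h.
Proof.
apply: l2ip_eq; rewrite (_ : wdot W (f + g)%R h = wdot W f h \+ wdot W g h).
  by apply: cvgD; exact: cvg_wdot.
by apply/funext => K; rewrite /= wdotDl.
Qed.

Lemma l2ipDr f g h : l2ip h (f + g) = l2ip h f + l2ip h g.
Proof. by rewrite l2ipC l2ipDl !(l2ipC _ h). Qed.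

Lemma l2ipNl f g : l2ip (- f) g = - l2ip f g.
Proof.
apply: l2ip_eq; rewrite (_ : wdot W (- f)%R g = \- wdot W f g).
  by apply: cvgN; exact: cvg_wdot.
by apply/funext => K; rewrite /= wdotNl.
Qed.

Lemma l2ip_ge0 f : 0 <= l2ip f f.
Proof. by apply: limn_ge_bound (@cvg_wdot f f) _ => K; exact: wdot_ge0. Qed.

Lemma wdot_le_l2ip f K : wdot W f f K <= l2ip f f.
Proof.
apply: (nondecreasing_cvgn_le (wdot_nd W f)).
exact: (cvgP _ (@cvg_wdot_sq f)).
Qed.

Definition l2norm f : R := Num.sqrt (l2ip f f).

Lemma l2norm_sq f : l2norm f ^+ 2 = l2ip f f.
Proof. by rewrite sqr_sqrtr// l2ip_ge0. Qed.

Lemma l2norm_ge0 f : 0 <= l2norm f.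
Proof. exact: sqrtr_ge0. Qed.

Lemma wdot_normc (f : coeffs R) K :
  wdot W f f K = \sum_(n <- zbox K) ((W n)%:num * normc (f n)) ^+ 2.
Proof. by apply: eq_bigr => n _; rewrite dotc_normc exprMn. Qed.

Lemma l2_partial_le f K :
  \sum_(n <- zbox K) ((W n)%:num * normc (f n)) ^+ 2 <= l2norm f ^+ 2.
Proof. by rewrite -wdot_normc l2norm_sq wdot_le_l2ip. Qed.

Lemma l2ip_le f g : `|l2ip f g| <= l2norm f * l2norm g.
Proof.
have up f1 g1 : l2ip f1 g1 <= l2norm f1 * l2norm g1.
  apply: limn_le_bound (@cvg_wdot f1 g1) _ => K.
  apply: (@le_trans _ _ (\sum_(n <- zbox K) ((W n)%:num * normc (f1 n)) * ((W n)%:num * normc (g1 n)))).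
    apply: ler_sum => n _; rewrite mulrACA -expr2; apply: ler_wpM2l; first exact: sqr_ge0.
    exact: le_trans (ler_norm _) (dotc_le _ _).
  by apply: cauchy_schwarz_seq; rewrite ?l2norm_ge0 ?l2_partial_le.
rewrite ler_norml up andbT lerNl -l2ipNl; apply: le_trans (up _ _) _.
by rewrite /l2norm l2ipNl l2ipC l2ipNl opprK.
Qed.

Lemma l2norm_sqD f g : l2norm (f + g) ^+ 2 = l2norm f ^+ 2 + 2 * l2ip f g + l2norm g ^+ 2.
Proof. by rewrite !l2norm_sq l2ipDl !l2ipDr (l2ipC g f); ring. Qed.

Lemma l2normD f g : l2norm (f + g) <= l2norm f + l2norm g.
Proof.
rewrite -(@ler_pXn2r _ 2)// ?nnegrE ?addr_ge0 ?l2norm_ge0// l2norm_sqD.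
have := le_trans (ler_norm _) (l2ip_le f g).
by move=> H; rewrite sqrrD -mulr_natl; lra.
Qed.

Lemma l2_coef_le f n : (W n)%:num * normc (f n) <= l2norm f.
Proof.
rewrite -(@ler_pXn2r _ 2)// ?nnegrE ?mulr_ge0 ?normc_ge0 ?l2norm_ge0//.
apply: le_trans (l2_partial_le f `|n|%N).
rewrite (big_rem n) ?mem_zbox//= lerDl sumr_ge0// => m _.
exact: sqr_ge0.
Qed.

Lemma l2norm0_eq0 f : l2norm f = 0 -> f = 0.
Proof.
move=> f0; apply: val_inj; apply/funext => n /=.
have := l2_coef_le f n; rewrite f0 pmulr_rle0// => nf.
apply: ComplexField.Normc.eq0_normc.
by apply/eqP; rewrite eq_le nf normc_ge0.
Qed.

Lemma l2normN f : l2norm (- f) = l2norm f.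
Proof. by rewrite /l2norm l2ipNl l2ipC l2ipNl opprK. Qed.

Lemma l2normMn f k : l2norm (f *+ k) = l2norm f *+ k.
Proof.
have ipMn g h : l2ip (g *+ k) h = l2ip g h *+ k.
  elim: k => [|k IH]; last by rewrite !mulrS l2ipDl IH.
  by rewrite !mulr0n -(subrr g) l2ipDl l2ipNl subrr.
rewrite /l2norm ipMn l2ipC ipMn -mulrnA -mulr_natr sqrtrM ?l2ip_ge0//.
by rewrite natrM -expr2 sqrtr_sqr ger0_norm// mulr_natr.
Qed.

HB.instance Definition _ := Num.Zmodule_isNormed.Build R (l2 W)
  l2normD l2norm0_eq0 l2normMn l2normN.

End L2Norm.

Lemma l2_normE (R : realType) (W : int -> {posnum R}) (f : l2 W) : `|f| = l2norm f.
Proof. by []. Qed.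

(** The way elements are constructed: one bound on all box sums yields both membership and the norm
    estimate. *)
Lemma l2_of (R : realType) (W : int -> {posnum R}) (f : coeffs R) (B : R) :
  real_valued f -> 0 <= B ->
  (forall K, \sum_(n <- zbox K) ((W n)%:num * normc (f n)) ^+ 2 <= B ^+ 2) ->
  exists2 g : l2 W, l2v g = f & `|g| <= B.
Proof.
move=> fr B0 fB.
have fP : f \in l2_pred W.
  by apply/asboolP; split=> //; exists (B ^+ 2) => K; rewrite wdot_normc.
exists (L2 fP) => //.
rewrite l2_normE -(@ler_pXn2r _ 2)// ?nnegrE ?l2norm_ge0// l2norm_sq.
by apply: limn_le_bound (@cvg_wdot _ _ (L2 fP) (L2 fP)) _ => K; rewrite wdot_normc.
Qed.

Lemma geometric_cvgn (R : realType) (a : R^nat) (C q : R) : 0 <= q < 1 ->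
  (forall k, `|a k.+1 - a k| <= C * q ^+ k) -> cvgn a.
Proof.
move=> /andP[q0 q1] aC.
have -> : a = (fun n => a 0%N + series (telescope a) n).
  by apply/funext => n; exact: eq_sum_telescope.
apply: is_cvgD; first exact: is_cvg_cst.
apply: (@normed_cvg R R); apply: (@series_le_cvg _ _ (geometric C q)).
- by move=> n; exact: normr_ge0.
- move=> n; exact: le_trans (aC n).
- by move=> n; exact: aC.
- by apply: is_cvg_geometric_series; rewrite ger0_norm.
Qed.

Lemma geometric_dist (R : realType) (V : normedZmodType R) (x : nat -> V) (K q : R) :
  0 <= q < 1 -> (forall k, `|x k.+1 - x k| <= K * q ^+ k) ->
  forall k m, `|x (k + m)%N - x k| <= K / (1 - q) * q ^+ k.
Proof.
move=> /andP[q0 q1] xK k m.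
have q10 : 0 < 1 - q by rewrite subr_gt0.
have K0 : 0 <= K by have := xK 0%N; rewrite expr0 mulr1; exact: le_trans.
suff H : `|x (k + m)%N - x k| <= K / (1 - q) * q ^+ k * (1 - q ^+ m).
  apply: (le_trans H); rewrite ler_piMr// ?lerBlDr ?lerDl ?exprn_ge0//.
  by rewrite mulr_ge0 ?exprn_ge0// divr_ge0// ltW.
elim: m => [|m IH]; first by rewrite addn0 subrr normr0 expr0 subrr mulr0.
rewrite addnS (_ : x _ - x k = (x (k + m).+1 - x (k + m)%N) + (x (k + m)%N - x k)); last by zmod.
apply: le_trans (ler_normD _ _) _; apply: le_trans (lerD (xK _) IH) _.
rewrite exprD exprSr le_eqVlt; apply/orP; left; apply/eqP; field.
by rewrite gt_eqF.
Qed.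

Lemma cvg_sum_seq (R : realType) (I : Type) (r : seq I) (F : I -> R^nat) (l : I -> R) :
  (forall i, F i @ \oo --> l i) -> (fun k => \sum_(i <- r) F i k) @ \oo --> \sum_(i <- r) l i.
Proof.
move=> Fl; elim: r => [|i r IH].
  by rewrite big_nil; under eq_fun do rewrite big_nil; exact: cvg_cst.
rewrite big_cons; under eq_fun do rewrite big_cons.
by apply: cvgD.
Qed.

Lemma cvg_sqrB (R : realType) (a : R^nat) (c l : R) : a @ \oo --> l ->
  (fun m => (c - a m) ^+ 2) @ \oo --> (c - l) ^+ 2.
Proof.
move=> al; have ca : (fun m => c - a m) @ \oo --> c - l.
  by apply: cvgB; [exact: cvg_cst|].
rewrite expr2 (_ : (fun m => _) = (fun m => (c - a m) * (c - a m))); first exact: (cvgM ca ca).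
by apply/funext => m; rewrite expr2.
Qed.

Lemma normc_ReIm_le (R : realType) (z : R[i]) :
  `|complex.Re z| <= normc z /\ `|complex.Im z| <= normc z.
Proof.
case: z => a b /=; rewrite -!(sqrtr_sqr (_ : R)).
by split; rewrite ler_wsqrtr// ?lerDl ?lerDr sqr_ge0.
Qed.

(** Each coefficient converges because [l2_coef_le] transfers the geometric increments to it. On a
    fixed box the bound on the distance from [x k] to [x (k + m)] passes to the limit in [m], and
    the result does not depend on the box. *)
Lemma l2_complete (R : realType) (W : int -> {posnum R}) :
  geometrically_complete (l2 W).
Proof.
move=> x K q q01 xK; have /andP[q0 q1] := q01.
have coef k n : normc ((x k.+1 - x k) n) <= K / (W n)%:num * q ^+ k.
  have := le_trans (l2_coef_le (x k.+1 - x k) n) (xK k).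
  by rewrite mulrAC ler_pdivlMr// mulrC.
have sub (f g : l2 W) n : (f - g) n = f n - g n by [].
have cre n : cvgn (fun k => complex.Re (x k n)).
  apply: (geometric_cvgn q01 (C := K / (W n)%:num)) => k.
  rewrite -raddfB /=; apply: le_trans (coef k n).
  by rewrite sub; case: (normc_ReIm_le (x k.+1 n - x k n)).
have cim n : cvgn (fun k => complex.Im (x k n)).
  apply: (geometric_cvgn q01 (C := K / (W n)%:num)) => k.
  rewrite -raddfB /=; apply: le_trans (coef k n).
  by rewrite sub; case: (normc_ReIm_le (x k.+1 n - x k n)).
pose l : coeffs R := fun n => (limn (fun k => complex.Re (x k n)) +i* limn (fun k => complex.Im (x k n)))%C.
have lr : real_valued l.
  move=> n; rewrite /l /=.
  have re k : x k (- n) = (x k n)^*%C by exact: l2_real.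
  congr (_ +i* _)%C.
    by congr (limn _); apply/funext => k; rewrite re; case: (x k n).
  rewrite -limN //; congr (limn _); apply/funext => k.
  by rewrite re -[RHS]/(- complex.Im (x k n)); case: (x k n : R[i]).
pose Bd k := K / (1 - q) * q ^+ k.
have Bd0 k : 0 <= Bd k.
  by apply: le_trans (geometric_dist q01 xK k 0); exact: normr_ge0.
have part k L : \sum_(n <- zbox L) ((W n)%:num * normc (x k n - l n)) ^+ 2 <= Bd k ^+ 2.
  have cv : (fun m => \sum_(n <- zbox L) ((W n)%:num ^+ 2 *
      ((complex.Re (x k n) - complex.Re (x (k + m)%N n)) ^+ 2
       + (complex.Im (x k n) - complex.Im (x (k + m)%N n)) ^+ 2))) @ \oo -->
      \sum_(n <- zbox L) ((W n)%:num ^+ 2 *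
      ((complex.Re (x k n) - complex.Re (l n)) ^+ 2
       + (complex.Im (x k n) - complex.Im (l n)) ^+ 2)).
    apply: cvg_sum_seq => n; apply: cvgM; first exact: cvg_cst.
    have sh (a : R^nat) : cvgn a -> (fun m => a (k + m)%N) @ \oo --> limn a.
      move=> ca; rewrite (_ : (fun m => a (k + m)%N) = [sequence a (m + k)%N]_m) ?cvg_shiftn//.
      by apply/funext => m; rewrite /= addnC.
    by apply: cvgD; apply: cvg_sqrB; apply: sh; [exact: cre|exact: cim].
  have E z : normc z ^+ 2 = complex.Re z ^+ 2 + complex.Im z ^+ 2 :> R.
    by rewrite -dotc_normc /dotc -!expr2.
  rewrite (eq_bigr (fun n => ((W n)%:num ^+ 2 *
      ((complex.Re (x k n) - complex.Re (l n)) ^+ 2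
       + (complex.Im (x k n) - complex.Im (l n)) ^+ 2)))); last first.
    by move=> n _; rewrite exprMn E !raddfB.
  apply: limn_le_bound cv _ => m.
  have := l2_partial_le (x k - x (k + m)%N) L.
  move=> H; apply: (@le_trans _ _ (l2norm (x k - x (k + m)%N) ^+ 2)).
    apply: le_trans H; rewrite le_eqVlt; apply/orP; left; apply/eqP; apply: eq_bigr => n _.
    by rewrite exprMn E sub !raddfB.
  rewrite lerXn2r ?nnegrE ?l2norm_ge0//.
  by have := geometric_dist q01 xK k m; rewrite distrC.
have l0 : exists y : l2 W, l2v y = l.
  have [|y0 y0E _] := @l2_of R W ((x 0%N : coeffs R) - l) (Bd 0%N) _ (Bd0 0%N) (part 0%N).
    by move=> n; rewrite -[(_ - l) (- n)]/(x 0%N (- n) - l (- n)) (l2_real (x 0%N)) lr -rmorphB.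
  exists (x 0%N - y0).
  rewrite -[l2v (_ - _)]/(l2v (x 0%N) - l2v y0) y0E.
  by apply/funext => n; rewrite /= opprB addrC subrK.
have [y yE] := l0; exists y => k.
have [|z zE zB] := @l2_of R W ((x k : coeffs R) - l) (Bd k) _ (Bd0 k) (part k).
  by move=> n; rewrite -[(_ - l) (- n)]/(x k (- n) - l (- n)) (l2_real (x k)) lr -rmorphB.
suff -> : x k - y = z by [].
by apply: val_inj; rewrite /= zE -yE.
Qed.

Lemma esum_le_zbox (R : realType) (F : int -> R) (B : R) : (forall n, 0 <= F n) ->
  (\esum_(n in [set: int]) (F n)%:E <= B%:E)%E <-> forall K, \sum_(n <- zbox K) F n <= B.
Proof.
move=> F0; split => [FB K|FB].
  rewrite -lee_fin; apply: le_trans FB; apply: esum_ge.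
  exists [set` zbox K]; first by split => //; exact: finite_seq.
  by rewrite -fsbig_seq ?uniq_zbox// sumEFin.
apply: ge_ereal_sup => _ [A [finA _] <-].
have [K AK] : exists K, A `<=` [set` zbox K].
  have [s ->] := (finite_seqP A).1 finA.
  exists (\max_(n <- s) `|n|%N)%N => n /= ns; rewrite mem_zbox.
  exact: (@leq_bigmax_seq _ s xpredT (fun n : int => `|n|%N) n ns isT).
apply: (@le_trans _ _ (\sum_(n \in [set` zbox K]) (F n)%:E)%E).
  apply: lee_fsum_nneg_subset => //; [exact: finite_seq|exact/subsetP|].
  by move=> n _; rewrite lee_fin.
by rewrite -fsbig_seq ?uniq_zbox// sumEFin lee_fin.
Qed.

Lemma zbox_nd (R : realType) (F : int -> R) : (forall n, 0 <= F n) ->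
  nondecreasing_seq (fun K => \sum_(n <- zbox K) F n).
Proof.
by move=> F0; apply/nondecreasing_seqP => K; rewrite sum_zboxS addrA lerDr addr_ge0.
Qed.

Lemma cvg_esum_zbox (R : realType) (F : int -> R) (B : R) : (forall n, 0 <= F n) ->
  (forall K, \sum_(n <- zbox K) F n <= B) ->
  (fun K => \sum_(n <- zbox K) F n) @ \oo --> fine (\esum_(n in [set: int]) (F n)%:E).
Proof.
move=> F0 FB; have nd := zbox_nd F0.
have cv : cvgn (fun K => \sum_(n <- zbox K) F n).
  by apply: nondecreasing_is_cvgn => //; exists B => _ [K _ <-].
suff -> : fine (\esum_(n in [set: int]) (F n)%:E) = limn (fun K => \sum_(n <- zbox K) F n) by [].
suff -> : \esum_(n in [set: int]) (F n)%:E = (limn (fun K => \sum_(n <- zbox K) F n))%:E by [].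
apply/eqP; rewrite eq_le; apply/andP; split.
  by apply/esum_le_zbox => // K; exact: nondecreasing_cvgn_le.
have e0 : (0 <= \esum_(n in [set: int]) (F n)%:E)%E.
  by apply: esum_ge0 => n _; rewrite lee_fin.
have eB : (\esum_(n in [set: int]) (F n)%:E <= B%:E)%E by apply/esum_le_zbox.
have fin : \esum_(n in [set: int]) (F n)%:E \is a fin_num.
  by rewrite ge0_fin_numE// (le_lt_trans eB)// ltry.
rewrite -(fineK fin) lee_fin; apply: limr_le => //; apply: nearW => K.
by move: K; apply/esum_le_zbox => //; rewrite fineK.
Qed.

Lemma cvg_rsum (R : realType) (D : set int) (F : int -> R) (B : R) :
  (forall K, \sum_(n <- zbox K) `|if n \in D then F n else 0| <= B) ->
  (fun K => \sum_(n <- zbox K) (if n \in D then F n else 0)) @ \oo --> rsum D F.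
Proof.
move=> FB; pose G n := if n \in D then F n else 0.
have mk (sgn : R -> R) : sgn 0 = 0 ->
    \esum_(n in D) (Num.max (sgn (F n)) 0)%:E = \esum_(n in [set: int]) (Num.max (sgn (G n)) 0)%:E.
  move=> s0; rewrite esum_mkcond; apply: eq_esum => n _; rewrite /G.
  by case: ifP => // _; rewrite s0 maxxx.
have max0 (x : R) : 0 <= Num.max x 0 by rewrite le_max lexx orbT.
have cvp (sgn : R -> R) : (forall x, sgn x <= `|x|) ->
    (fun K => \sum_(n <- zbox K) Num.max (sgn (G n)) 0) @ \oo -->
      fine (\esum_(n in [set: int]) (Num.max (sgn (G n)) 0)%:E).
  move=> sle; apply: (@cvg_esum_zbox _ _ B) => // K; apply: le_trans (FB K).
  by apply: ler_sum => n _; rewrite ge_max sle normr_ge0.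
rewrite /rsum (mk id)// (mk -%R) ?oppr0//.
rewrite (_ : (fun K => _) = (fun K => \sum_(n <- zbox K) Num.max (G n) 0 - \sum_(n <- zbox K) Num.max (- G n) 0)).
  apply: cvgB; first by apply: (cvp id) => x; exact: ler_norm.
  by apply: (cvp -%R) => x; rewrite -normrN ler_norm.
apply/funext => K; rewrite -sumrB; apply: eq_bigr => n _; rewrite -/(G n).
case: (leP (G n) 0) => h; first by rewrite (max_idPl _) ?oppr_ge0// sub0r opprK.
by rewrite (max_idPr _) ?subr0// oppr_le0 ltW.
Qed.

(** Convergence of complex box sums, real and imaginary parts apart. It replaces the definition of
    [csum] by positive and negative parts with a limit, for which additivity, conjugation and norm
    bounds are immediate. *)
Definition csums (R : realType) (G : int -> R[i]) (z : R[i]) : Prop :=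
  (fun K => complex.Re (\sum_(n <- zbox K) G n)) @ \oo --> complex.Re z /\
  (fun K => complex.Im (\sum_(n <- zbox K) G n)) @ \oo --> complex.Im z.

Lemma csums_csum (R : realType) (D : set int) (F : int -> R[i]) (B : R) :
  (forall K, \sum_(n <- zbox K) normc (if n \in D then F n else 0) <= B) ->
  csums (fun n => if n \in D then F n else 0) (csum D F).
Proof.
move=> FB; rewrite /csums /csum /=.
have ReE n : complex.Re (if n \in D then F n else 0) = if n \in D then complex.Re (F n) else 0.
  by case: ifP.
have ImE n : complex.Im (if n \in D then F n else 0) = if n \in D then complex.Im (F n) else 0.
  by case: ifP.
split.
  rewrite (_ : (fun K => _) = (fun K => \sum_(n <- zbox K) (if n \in D then complex.Re (F n) else 0))).
    apply: (@cvg_rsum _ _ _ B) => K; apply: le_trans (FB K); apply: ler_sum => n _.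
    by rewrite -ReE; case: (normc_ReIm_le (if n \in D then F n else 0)).
  by apply/funext => K; rewrite raddf_sum; apply: eq_bigr => n _; exact: ReE.
rewrite (_ : (fun K => _) = (fun K => \sum_(n <- zbox K) (if n \in D then complex.Im (F n) else 0))).
  apply: (@cvg_rsum _ _ _ B) => K; apply: le_trans (FB K); apply: ler_sum => n _.
  by rewrite -ImE; case: (normc_ReIm_le (if n \in D then F n else 0)).
by apply/funext => K; rewrite raddf_sum; apply: eq_bigr => n _; exact: ImE.
Qed.

Lemma csums_unique (R : realType) (G : int -> R[i]) (z w : R[i]) :
  csums G z -> csums G w -> z = w.
Proof.
case: z w => a b [c d] [/= h1 h2] [/= h3 h4].
by rewrite (cvg_unique (@Rhausdorff R) h1 h3) (cvg_unique (@Rhausdorff R) h2 h4).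
Qed.

Lemma csumsD (R : realType) (F G : int -> R[i]) (z w : R[i]) :
  csums F z -> csums G w -> csums (fun n => F n + G n) (z + w).
Proof.
move=> [h1 h2] [h3 h4]; split; rewrite raddfD.
  rewrite (_ : (fun K => _) = (fun K => complex.Re (\sum_(n <- zbox K) F n) + complex.Re (\sum_(n <- zbox K) G n))).
    exact: cvgD.
  by apply/funext => K; rewrite big_split raddfD.
rewrite (_ : (fun K => _) = (fun K => complex.Im (\sum_(n <- zbox K) F n) + complex.Im (\sum_(n <- zbox K) G n))).
  exact: cvgD.
by apply/funext => K; rewrite big_split raddfD.
Qed.

Lemma csums_conj (R : realType) (F : int -> R[i]) (z : R[i]) :
  csums F z -> csums (fun n => (F (- n))^*%C) (z^*)%C.
Proof.
have E K : \sum_(n <- zbox K) (F (- n))^*%C = (\sum_(n <- zbox K) F n)^*%C.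
  by rewrite [in RHS](perm_big _ (zbox_opp K)) big_map rmorph_sum.
move=> [h1 h2]; split.
  rewrite (_ : (fun K => _) = (fun K => complex.Re (\sum_(n <- zbox K) F n))).
    by case: z h1 h2.
  by apply/funext => K; rewrite E; case: (\sum_(n <- zbox K) F n).
rewrite (_ : (fun K => _) = (fun K => - complex.Im (\sum_(n <- zbox K) F n))).
  by case: z h1 h2 => a b /= _; exact: cvgN.
by apply/funext => K; rewrite E; case: (\sum_(n <- zbox K) F n).
Qed.

Lemma csums_normc_le (R : realType) (F : int -> R[i]) (z : R[i]) (B : R) :
  csums F z -> (forall K, normc (\sum_(n <- zbox K) F n) <= B) -> normc z <= B.
Proof.
move=> [h1 h2] FB.
have B0 : 0 <= B by apply: le_trans (FB 0%N); exact: normc_ge0.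
rewrite -(@ler_pXn2r _ 2)// ?nnegrE ?normc_ge0// -dotc_normc.
pose S K := \sum_(n <- zbox K) F n.
have cv : (fun K => dotc (S K) (S K)) @ \oo --> dotc z z.
  exact: (cvgD (cvgM h1 h1) (cvgM h2 h2)).
apply: limn_le_bound cv _ => K; rewrite dotc_normc.
by rewrite lerXn2r ?nnegrE ?normc_ge0//; exact: FB.
Qed.

Lemma normc_sum (R : realType) (I : Type) (r : seq I) (F : I -> R[i]) :
  normc (\sum_(i <- r) F i) <= \sum_(i <- r) normc (F i).
Proof.
elim: r => [|i r IH]; first by rewrite !big_nil ComplexField.Normc.normc0.
by rewrite !big_cons; apply: le_trans (le_normcD _ _) _; rewrite lerD2l.
Qed.

Lemma normcM (R : realType) (z w : R[i]) : normc (z * w) = normc z * normc w.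
Proof. exact: ComplexField.Normc.normcM. Qed.

(** * Kernel estimates for integer frequencies *)

Section IntKernels.
Context {R : realType}.
Implicit Types (N s rho d beta : R) (a b c n : int).

Definition iabs n : R := `|n|%N%:R.

Definition iwt N s n : {posnum R} := PosNum (mwt_gt0 N s (iabs n)).

Definition iqwt N s rho n : R := qwt N s rho (iabs n).

Definition theta d n : R := if n == 0 then 0 else iabs n `^ (- (1 / 2) - d).

Lemma theta_ge0 d n : 0 <= theta d n.
Proof. by rewrite /theta; case: ifP => // _; exact: powR_ge0. Qed.

Lemma iabs_ge0 n : 0 <= iabs n.
Proof. exact: ler0n. Qed.

Lemma iabsN n : iabs (- n) = iabs n.
Proof. by rewrite /iabs abszN. Qed.

Lemma iwtN N s n : (iwt N s (- n))%:num = (iwt N s n)%:num.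
Proof. by rewrite /= iabsN. Qed.

(* In a zero-sum triple of nonzero integers the two smallest moduli add up to
   the largest one, so up to permutation the triple is (-x, y, z) or (x, -y, -z). *)
Lemma zero_sum_cases (P : int -> int -> int -> Prop) :
  (forall a b c, P a b c -> P b a c) -> (forall a b c, P a b c -> P a c b) ->
  (forall a b c, P a b c -> P (- a) (- b) (- c)) ->
  (forall y z : nat, (0 < z <= y)%N -> P (y + z)%:Z (- y%:Z) (- z%:Z)) ->
  forall a b c, a != 0 -> b != 0 -> c != 0 -> a + b + c = 0 -> P a b c.
Proof.
move=> P12 P23 PN H a b c a0 b0 c0 abc.
have base x y z : x + y + z = 0 -> y != 0 -> z != 0 ->
    (`|x| = `|y| + `|z|)%N -> (`|z| <= `|y|)%N -> P x y z.
  move=> xyz y0 z0 xE zy.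
  have [x0|x0] := leP 0 x.
    have := H `|y|%N `|z|%N; rewrite zy lt0n absz_eq0 z0 => /(_ isT).
    have -> : (`|y| + `|z|)%:Z = x by lia.
    have -> : - `|y|%:Z = y by lia.
    by have -> : - `|z|%:Z = z by lia.
  have := H `|y|%N `|z|%N; rewrite zy lt0n absz_eq0 z0 => /(_ isT) /PN.
  have -> : - (`|y| + `|z|)%:Z = x by lia.
  have -> : - - `|y|%:Z = y by lia.
  by have -> : - - `|z|%:Z = z by lia.
have base' x y z : x + y + z = 0 -> y != 0 -> z != 0 ->
    (`|x| = `|y| + `|z|)%N -> P x y z.
  move=> xyz y0 z0 xE; have [zy|yz] := leqP `|z|%N `|y|%N; first exact: base.
  by apply: P23; apply: base => //; lia.
have [e|[e|e]] : (`|a| = `|b| + `|c| \/ (`|b| = `|a| + `|c| \/ `|c| = `|a| + `|b|))%N by lia.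
- exact: base'.
- by apply: P12; apply: base' => //; lia.
- by apply: P23; apply: P12; apply: base' => //; lia.
Qed.

Lemma driver_kernel_int N rho s d beta a b c :
  kernel_params rho s d beta -> 1 <= N -> a != 0 -> b != 0 -> c != 0 -> a + b + c = 0 ->
  iabs c * (iwt N s c)%:num ^+ 2 * (iqwt N s rho a * iqwt N s rho b * iqwt N s rho c) <=
    2 `^ (rho + `|s|) * (theta d a + theta d b + theta d c).
Proof.
move=> KP N1 a0 b0 c0 abc.
pose k o x y z : R := iabs o * (iwt N s o)%:num ^+ 2 * (iqwt N s rho x * iqwt N s rho y * iqwt N s rho z).
(* Quantifying over the output frequency makes the property invariant under permutations. *)
pose P x y z := forall o, o \in [:: x; y; z] ->
  k o x y z <= 2 `^ (rho + `|s|) * (theta d x + theta d y + theta d z).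
suff : P a b c by apply; rewrite !inE eqxx !orbT.
apply: (zero_sum_cases _ _ _ _ a0 b0 c0 abc).
- move=> x y z H o; rewrite !inE => ho.
  have -> : k o y x z = k o x y z by rewrite /k; ring.
  by rewrite (addrC (theta d y)); apply: H; rewrite !inE; case/or3P: ho => ->; rewrite ?orbT.
- move=> x y z H o; rewrite !inE => ho.
  have -> : k o x z y = k o x y z by rewrite /k; ring.
  by rewrite addrAC; apply: H; rewrite !inE; case/or3P: ho => ->; rewrite ?orbT.
- move=> x y z H o ho.
  have th n : theta d (- n) = theta d n by rewrite /theta oppr_eq0 iabsN.
  have q n : iqwt N s rho (- n) = iqwt N s rho n by rewrite /iqwt iabsN.
  rewrite !th /k !q -iabsN -iwtN; apply: (H (- o)); move: ho.
  by rewrite !inE !eqr_oppLR.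
move=> y z /andP[z0 zy] o ho.
have z1 : 1 <= z%:R :> R by rewrite ler1n.
have zyR : z%:R <= y%:R :> R by rewrite ler_nat.
have xE : (y + z)%:R = y%:R + z%:R :> R by rewrite natrD.
have := driver_kernel_le KP N1 z1 zyR xE (o := iabs o) _.
have inh : iabs o \in [:: (y + z)%:R; y%:R; z%:R : R].
  by move: ho; rewrite !inE => /or3P[] /eqP ->; rewrite ?iabsN /iabs absz_nat eqxx ?orbT.
move=> /(_ inh) H; apply: le_trans (le_trans H _); last first.
  apply: ler_wpM2l; first exact: powR_ge0.
  rewrite -[leLHS]add0r; apply: lerD; first by rewrite addr_ge0// theta_ge0.
  by rewrite /theta iabsN /iabs absz_nat ifN// oppr_eq0 -lt0n.
by rewrite /k /iqwt !iabsN /iabs !absz_nat.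
Qed.

Lemma energy_kernel_int N rho s d beta a b c :
  kernel_params rho s d beta -> 1 <= N -> a != 0 -> b != 0 -> c != 0 -> a + b + c = 0 ->
  `|a%:~R * (iwt N s a)%:num ^+ 2 + b%:~R * (iwt N s b)%:num ^+ 2
      + c%:~R * (iwt N s c)%:num ^+ 2|
    * (iqwt N s rho a * iqwt N s rho b * iqwt N s rho c) <=
  2 * (2 + `|2 * s|) * 2 `^ `|2 * s| * 2 `^ (rho + `|s|) * N `^ (- beta)
    * (theta d a + theta d b + theta d c).
Proof.
move=> KP N1 a0 b0 c0 abc.
set C := _ * N `^ (- beta).
pose m n : R := n%:~R * (iwt N s n)%:num ^+ 2.
pose P x y z := `|m x + m y + m z| * (iqwt N s rho x * iqwt N s rho y * iqwt N s rho z)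
  <= C * (theta d x + theta d y + theta d z).
apply: (zero_sum_cases (P := P) _ _ _ _ a0 b0 c0 abc); rewrite /P.
- move=> x y z H; rewrite (addrC (theta d y)) (addrC (m y)).
  by rewrite (mulrC (iqwt _ _ _ y)).
- move=> x y z H; rewrite (addrAC (theta d x)) (addrAC (m x)).
  by rewrite (mulrAC (iqwt _ _ _ x)).
- move=> x y z H.
  have th n : theta d (- n) = theta d n by rewrite /theta oppr_eq0 iabsN.
  have q n : iqwt N s rho (- n) = iqwt N s rho n by rewrite /iqwt iabsN.
  have mN n : m (- n) = - m n by rewrite /m iwtN mulrNz mulNr.
  by rewrite !th !q !mN -!opprD normrN.
move=> y z /andP[z0 zy].
have z1 : 1 <= z%:R :> R by rewrite ler1n.
have zyR : z%:R <= y%:R :> R by rewrite ler_nat.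
have xE : (y + z)%:R = y%:R + z%:R :> R by rewrite natrD.
have := energy_kernel_le KP N1 z1 zyR xE => H.
have E : m (y + z)%:Z + m (- y%:Z) + m (- z%:Z) =
   (y + z)%:R * mwt N s (y + z)%:R ^+ 2 - y%:R * mwt N s y%:R ^+ 2 - z%:R * mwt N s z%:R ^+ 2.
  by rewrite /m /= !iabsN /iabs !absz_nat !mulrNz !mulNr.
rewrite E /iqwt !iabsN /iabs !absz_nat; apply: (le_trans H).
rewrite /C -!mulrA; do 4!(apply: ler_wpM2l; first by rewrite ?powR_ge0 ?addr_ge0).
apply: ler_wpM2l; first exact: powR_ge0.
rewrite -[leLHS]add0r; apply: lerD; first by rewrite addr_ge0// theta_ge0.
by rewrite /theta iabsN /iabs absz_nat ifN// oppr_eq0 -lt0n.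
Qed.

End IntKernels.

(** * The driver as a bilinear operator *)

Lemma zbox_sum_homo (R : realType) (F : int -> R) (K L : nat) : (forall n, 0 <= F n) ->
  (K <= L)%N -> \sum_(n <- zbox K) F n <= \sum_(n <- zbox L) F n.
Proof. by move=> F0; exact: (zbox_nd F0). Qed.

Lemma zbox_sum_zero_unique (R : realType) (M : nat) (m : int) (F : int -> R) :
  (`|m| <= M)%N -> \sum_(b <- zbox M) (if m + b == 0 then F b else 0) = F (- m).
Proof.
move=> mM; have mz : - m \in zbox M by rewrite mem_zbox abszN.
rewrite (big_rem (- m) mz) subrr eqxx big1_seq; first by rewrite /= addr0.
move=> b /andP[_]; rewrite mem_rem_uniq ?uniq_zbox// inE => /andP[bm _].
by rewrite ifN//; apply: contra bm => /eqP mb; rewrite -addr_eq0 addrC mb.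
Qed.

Lemma tri_rot (R : realType) (K : nat) (G : int -> int -> int -> R) :
  tri K G = tri K (fun c a b => G a b c).
Proof. by rewrite tri_swap23 tri_swap12. Qed.

Lemma zbox_sum_opp (R : realType) (K : nat) (F : int -> R) :
  \sum_(n <- zbox K) F n = \sum_(n <- zbox K) F (- n).
Proof. by rewrite (perm_big _ (zbox_opp K)) big_map. Qed.

(** The pair [(n, m)] becomes the triple [(m, n - m, - n)], whose middle entry lies in the box of
    size [K + L]; nonnegativity allows enlarging the other two boxes to the same size. *)
Lemma shift_sum_le_tri (R : realType) (K L : nat) (G : int -> int -> int -> R) :
  (forall a b c, 0 <= G a b c) ->
  \sum_(n <- zbox K) \sum_(m <- zbox L) G m (n - m) (- n) <= tri (K + L) G.
Proof.
move=> G0; rewrite tri_rot zbox_sum_opp /tri.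
pose S c a := \sum_(b <- zbox (K + L)) (if c + a + b == 0 then G a b c else 0).
have S0 c a : 0 <= S c a by apply: sumr_ge0 => b _; case: ifP.
apply: (@le_trans _ _ (\sum_(c <- zbox K) \sum_(a <- zbox L) S c a)).
  rewrite big_seq [leRHS]big_seq; apply: ler_sum => c cK.
  rewrite big_seq [leRHS]big_seq; apply: ler_sum => a aL.
  rewrite /S (zbox_sum_zero_unique (fun b => G a b c)) ?opprK.
    by rewrite opprD.
  by move: cK aL; rewrite !mem_zbox; lia.
apply: (@le_trans _ _ (\sum_(c <- zbox K) \sum_(a <- zbox (K + L)) S c a)).
  by apply: ler_sum => c _; apply: zbox_sum_homo => //; exact: leq_addl.
by apply: zbox_sum_homo; [move=> c; exact: sumr_ge0|exact: leq_addr].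
Qed.

Section Driver.
Context {R : realType}.
Variables (N rho s d beta D : R).
Hypothesis KP : kernel_params rho s d beta.
Hypothesis N1 : 1 <= N.
Hypothesis D0 : 0 <= D.
Hypothesis thD : forall K, \sum_(n <- zbox K) theta d n ^+ 2 <= D ^+ 2.
Implicit Types (ph : int -> int -> R[i]) (P : R).

Local Notation W := (iwt N s).

Definition phase_le P ph := forall n m : int, n != 0 -> m != 0 -> n - m != 0 ->
  normc (ph n m) <= P * (iabs n `^ (- rho) * iabs m `^ (- rho) * iabs (n - m) `^ (- rho)).

Definition bilin_term ph (f g : coeffs R) (n m : int) : R[i] :=
  if m \in [set m | m != 0 /\ n - m != 0] then ph n m * f m * g (n - m) else 0.

Definition bilin ph (f g : coeffs R) : coeffs R := fun n =>
  ('i%C * n%:~R) * csum [set m | m != 0 /\ n - m != 0] (fun m => ph n m * f m * g (n - m)).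

Definition bilin_const : R := 3 * D * 2 `^ (rho + `|s|).

Lemma bilin_termE ph f g n m : bilin_term ph f g n m =
  if (m != 0) && (n - m != 0) then ph n m * f m * g (n - m) else 0.
Proof.
rewrite /bilin_term; congr (if _ then _ else _).
by apply/idP/andP => [|mn]; rewrite in_setE.
Qed.

Lemma bilin_const_ge0 : 0 <= bilin_const.
Proof. by rewrite /bilin_const !mulr_ge0 ?powR_ge0. Qed.

(** The operator bound in dual form: testing the output against a nonnegative [h] in [l2] restores
    the symmetry between the three frequencies. With moduli inside, it also yields absolute
    convergence of the series. [h'] cuts [h] off to its box, since the triples range over a larger
    one. *)
Lemma bilin_sum_le P ph (f g : l2 W) (h : int -> R) (H : R) (K L : nat) :
  0 <= P -> phase_le P ph -> (forall n, 0 <= h n) -> 0 <= H ->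
  \sum_(n <- zbox K) h n ^+ 2 <= H ^+ 2 ->
  \sum_(n <- zbox K) \sum_(m <- zbox L)
     iabs n * (W n)%:num * h n * normc (bilin_term ph f g n m)
   <= bilin_const * P * (H * (`|f| * `|g|)).
Proof.
move=> P0 phP h0 H0 hH.
pose k a b c : R := if [&& a != 0, b != 0 & c != 0] then
  iabs c * (W c)%:num ^+ 2 * (iqwt N s rho a * iqwt N s rho b * iqwt N s rho c) else 0.
pose F n := (W n)%:num * normc (f n); pose G n := (W n)%:num * normc (g n).
pose h' n := if (`|n|%N <= K)%N then h (- n) else 0.
have q0 n : 0 <= iqwt N s rho n by exact: qwt_ge0.
have k0 a b c : 0 <= k a b c.
  rewrite /k; case: ifP => // _; apply: mulr_ge0; last exact: mulr_ge0 (mulr_ge0 (q0 _) (q0 _)) (q0 _).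
  by apply: mulr_ge0; [exact: iabs_ge0|exact: exprn_ge0].
have F0 n : 0 <= F n by rewrite mulr_ge0 ?normc_ge0.
have G0 n : 0 <= G n by rewrite mulr_ge0 ?normc_ge0.
have h'0 n : 0 <= h' n by rewrite /h'; case: ifP.
have tri0 a b c : 0 <= P * (k a b c * (F a * G b * h' c)).
  exact: mulr_ge0 P0 (mulr_ge0 (k0 _ _ _) (mulr_ge0 (mulr_ge0 (F0 _) (G0 _)) (h'0 _))).
have h'H M : (K <= M)%N -> \sum_(n <- zbox M) h' n ^+ 2 <= H ^+ 2.
  move=> KM; apply: le_trans hH; rewrite zbox_sum_opp.
  have [j ->] : exists j, M = (K + j)%N by exists (M - K)%N; rewrite subnKC.
  elim: j => [|j IH].
    rewrite addn0 big_seq [leRHS]big_seq; apply: ler_sum => n; rewrite mem_zbox => nK.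
    by rewrite /h' abszN nK opprK.
  rewrite addnS sum_zboxS /h' !opprK !abszN absz_nat.
  by rewrite !ifN ?expr0n/= ?add0r//; rewrite -ltnNge ltnS leq_addr.
apply: (@le_trans _ _ (P * tri (K + L) (fun a b c => k a b c * (F a * G b * h' c)))).
  rewrite -triZ; apply: le_trans (shift_sum_le_tri _ _ _); last first.
    exact: tri0.
  rewrite big_seq [leRHS]big_seq; apply: ler_sum => n; rewrite mem_zbox => nK.
  apply: ler_sum => m _; rewrite bilin_termE.
  have [->|n0] := eqVneq n 0; first by rewrite /iabs absz0 !mul0r; exact: tri0.
  case: ifPn => [/andP[m0 nm0]|_]; last first.
    by rewrite ComplexField.Normc.normc0 mulr0; exact: tri0.
  rewrite !normcM.
  have np p : p != 0 -> (W p)%:num * iqwt N s rho p = iabs p `^ (- rho).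
    by move=> p0; rewrite /iqwt /qwt /= mulrCA mulfV ?mulr1// gt_eqF// mwt_gt0.
  have := phP n m n0 m0 nm0; rewrite -!np// => phn.
  have A0 : 0 <= iabs n * (W n)%:num * h n * (normc (f m) * normc (g (n - m))).
    by rewrite !mulr_ge0 ?iabs_ge0 ?normc_ge0.
  have := ler_wpM2l A0 phn.
  rewrite /k m0 nm0 oppr_eq0 n0 /= iabsN /iqwt iabsN /h' abszN nK opprK /F /G /=.
  by move=> le; apply: le_trans (le_trans le _); rewrite le_eqVlt; apply/orP; left; apply/eqP; rewrite /iqwt; ring.
have c0 : 0 <= 2 `^ (rho + `|s|) :> R by exact: powR_ge0.
have kth a b c : a + b + c = 0 ->
    k a b c <= 2 `^ (rho + `|s|) * (theta d a + theta d b + theta d c).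
  move=> abc; rewrite /k; case: ifPn => [/and3P[a0 b0 c1]|_].
    exact: driver_kernel_int KP N1 a0 b0 c1 abc.
  by rewrite mulr_ge0// !addr_ge0// theta_ge0.
have := tri_kernel_le c0 (l2norm_ge0 f) (l2norm_ge0 g) H0 D0 (@theta_ge0 R d) F0 G0 h'0 kth
  (thD (K + L)) (l2_partial_le f _) (l2_partial_le g _) (h'H _ (leq_addr _ _)).
move=> /(ler_wpM2l P0) le; apply: (le_trans le).
by rewrite le_eqVlt; apply/orP; left; apply/eqP; rewrite /bilin_const !l2_normE; ring.
Qed.

Lemma normc_in (n : int) : normc ('i%C * n%:~R : R[i]) = iabs n.
Proof.
rewrite normcM [normc 'i%C](_ : _ = 1); last by rewrite /= expr0n expr1n add0r sqrtr1.
rewrite mul1r; have -> : (n%:~R : R[i]) = (n%:~R : R)%:C%C by rewrite rmorph_int.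
by rewrite /= expr0n addr0 sqrtr_sqr -intr_norm /iabs -abszE.
Qed.

Lemma bilin_summable P ph (f g : l2 W) (n : int) : 0 <= P -> phase_le P ph -> n != 0 ->
  exists B, forall L, \sum_(m <- zbox L) normc (bilin_term ph f g n m) <= B.
Proof.
move=> P0 phP n0.
have n1 : 0 < (iabs n : R) by rewrite /iabs ltr0n absz_gt0.
exists (bilin_const * P * (1 * (`|f| * `|g|)) / (iabs n * (W n)%:num)) => L.
have nW : 0 < iabs n * (W n)%:num by rewrite mulr_gt0.
rewrite ler_pdivlMr// mulrC.
(* Testing against the indicator of [n] isolates one output coefficient. *)
pose h m : R := if m == n then 1 else 0.
have hz : n \in zbox `|n| by rewrite mem_zbox.
have h0 m : 0 <= h m by rewrite /h; case: ifP.
have pick (F : int -> R) : (forall m, m != n -> F m = 0) -> \sum_(m <- zbox `|n|) F m = F n.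
  move=> Fn; rewrite (big_rem n hz) big1_seq; first by rewrite /= addr0.
  by move=> m /andP[_]; rewrite mem_rem_uniq ?uniq_zbox// inE => /andP[mn _]; exact: Fn.
have := @bilin_sum_le P ph f g h 1 `|n|%N L P0 phP h0 ler01.
rewrite pick; last by move=> m mn; rewrite /h (negbTE mn) expr0n.
rewrite {1}/h eqxx expr1n => /(_ (lexx _)).
rewrite pick; last first.
  move=> m mn; apply: big1 => p _; rewrite /h (negbTE mn); ring.
by rewrite {1}/h eqxx mulr1 -mulr_sumr.
Qed.

Lemma bilin_csums P ph (f g : l2 W) (n : int) : 0 <= P -> phase_le P ph -> n != 0 ->
  csums (bilin_term ph f g n)
    (csum [set m | m != 0 /\ n - m != 0] (fun m => ph n m * f m * g (n - m))).
Proof.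
by move=> P0 phP n0; have [B BP] := bilin_summable f g P0 phP n0; exact: csums_csum BP.
Qed.

Lemma bilin_partial_le P ph (f g : l2 W) (K : nat) : 0 <= P -> phase_le P ph ->
  \sum_(n <- zbox K) ((W n)%:num * normc (bilin ph f g n)) ^+ 2
    <= (bilin_const * P * (`|f| * `|g|)) ^+ 2.
Proof.
move=> P0 phP.
pose Y L n : R := if n == 0 then 0 else \sum_(m <- zbox L) normc (bilin_term ph f g n m).
have Y0 L n : 0 <= Y L n.
  by rewrite /Y; case: ifP => // _; apply: sumr_ge0 => m _; exact: normc_ge0.
have cvY n : cvgn (fun L => Y L n).
  rewrite /Y; have [n0|n0] := boolP (n == 0); first exact: is_cvg_cst.
  have [B BP] := bilin_summable f g P0 phP n0.
  apply: nondecreasing_is_cvgn; last by exists B => _ [L _ <-].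
  by apply: zbox_nd => m; exact: normc_ge0.
pose y n := limn (fun L => Y L n).
have ndY n L : Y L n <= y n.
  apply: nondecreasing_cvgn_le => //; rewrite /Y; have [n0|n0] := boolP (n == 0) => //.
  by apply: zbox_nd => m; exact: normc_ge0.
have bY n : normc (bilin ph f g n) <= iabs n * y n.
  rewrite /bilin normcM normc_in; have [->|n0] := eqVneq n 0.
    by rewrite /iabs absz0 !mul0r.
  apply: ler_wpM2l; first exact: iabs_ge0.
  apply: csums_normc_le (bilin_csums f g P0 phP n0) _ => L.
  apply: le_trans (normc_sum _ _) _; have := ndY n L.
  by rewrite /Y (negbTE n0).
set B := bilin_const * P * (`|f| * `|g|).
have B0 : 0 <= B by exact: mulr_ge0 (mulr_ge0 bilin_const_ge0 P0) (mulr_ge0 (normr_ge0 _) (normr_ge0 _)).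
have part L : \sum_(n <- zbox K) (iabs n * (W n)%:num * Y L n) ^+ 2 <= B ^+ 2.
  (* Duality: the output, with moduli inside and truncated to [L], is tested against itself;
     dividing by the square root of [S] leaves its norm. *)
  pose h n := iabs n * (W n)%:num * Y L n.
  have h0 n : 0 <= h n by rewrite /h !mulr_ge0 ?iabs_ge0.
  set S := \sum_(n <- zbox K) _; have S0 : 0 <= S by apply: sumr_ge0 => n _; exact: sqr_ge0.
  have SE : S <= Num.sqrt S ^+ 2 by rewrite sqr_sqrtr.
  have := @bilin_sum_le P ph f g h (Num.sqrt S) K L P0 phP h0 (sqrtr_ge0 _) SE.
  have -> : \sum_(n <- zbox K) \sum_(m <- zbox L)
      iabs n * (W n)%:num * h n * normc (bilin_term ph f g n m) = Num.sqrt S ^+ 2.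
    rewrite sqr_sqrtr// /S; apply: eq_bigr => n _; rewrite -mulr_sumr /h.
    rewrite /Y; case: eqVneq => [->|n0]; last by ring.
    by rewrite /iabs absz0 !mul0r expr0n.
  move=> le; have : Num.sqrt S * Num.sqrt S <= Num.sqrt S * B.
    by rewrite -expr2; apply: (le_trans le); rewrite /B le_eqVlt; apply/orP; left; apply/eqP; ring.
  have [->|Sn0] := eqVneq S 0; first by rewrite exprn_ge0.
  rewrite ler_pM2l ?sqrtr_gt0 ?lt0r ?Sn0// => SB.
  by rewrite -(sqr_sqrtr S0) lerXn2r ?nnegrE ?sqrtr_ge0.
apply: (@le_trans _ _ (\sum_(n <- zbox K) (iabs n * (W n)%:num * y n) ^+ 2)).
  apply: ler_sum => n _; rewrite lerXn2r ?nnegrE ?mulr_ge0 ?normc_ge0 ?iabs_ge0//.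
    by apply: le_trans (ndY n 0%N).
  by rewrite (mulrC (iabs n)) -mulrA; apply: ler_wpM2l.
apply: limn_le_bound part.
apply: cvg_sum_seq => n.
have c1 : (fun L => iabs n * (W n)%:num * Y L n) @ \oo --> iabs n * (W n)%:num * y n.
  by apply: cvgM; [exact: cvg_cst|exact: cvY].
rewrite expr2 (_ : (fun L => _) = (fun L => (iabs n * (W n)%:num * Y L n) * (iabs n * (W n)%:num * Y L n))).
  exact: (cvgM c1 c1).
by apply/funext => L; rewrite expr2.
Qed.

End Driver.

Lemma zbox_sum_support (R : realType) (F : int -> R) (K L : nat) :
  (forall n : int, (K < `|n|)%N -> F n = 0) -> (K <= L)%N ->
  \sum_(n <- zbox L) F n = \sum_(n <- zbox K) F n.
Proof.
move=> F0 KL; have [j ->] : exists j, L = (K + j)%N by exists (L - K)%N; rewrite subnKC.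
elim: j => [|j IH]; first by rewrite addn0.
by rewrite addnS sum_zboxS IH !F0 ?add0r// ?abszN absz_nat ltnS leq_addr.
Qed.

Lemma zbox_sum_support_tail (R : realType) (F : int -> R) (K j : nat) :
  \sum_(n <- zbox (K + j)) (if (`|n| <= K)%N then 0 else F n) =
  \sum_(n <- zbox (K + j)) F n - \sum_(n <- zbox K) F n.
Proof.
elim: j => [|j IH].
  rewrite addn0 subrr big_seq big1// => n.
  by rewrite mem_zbox => ->.
rewrite addnS !sum_zboxS IH !ifN ?abszN ?absz_nat; last 2 first.
- by rewrite -ltnNge ltnS leq_addr.
- by rewrite -ltnNge ltnS leq_addr.
by rewrite !addrA.
Qed.

Lemma l2_truncate (R : realType) (W : int -> {posnum R}) (f : l2 W) (eps : R) : 0 < eps ->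
  exists (K : nat) (g : l2 W), [/\ forall n : int, (K < `|n|)%N -> g n = 0,
    `|g| <= `|f| & `|f - g| <= eps].
Proof.
move=> eps0; pose F n := ((W n)%:num * normc (f n)) ^+ 2.
have cv : (fun K => \sum_(n <- zbox K) F n) @ \oo --> `|f| ^+ 2.
  rewrite l2_normE l2norm_sq (_ : (fun K => _) = wdot W f f); first exact: cvg_wdot.
  by apply/funext => K; rewrite wdot_normc.
have [K KP] : exists K, `|f| ^+ 2 - \sum_(n <- zbox K) F n <= eps ^+ 2.
  have /cvgrPdist_le/(_ (eps ^+ 2)) := cv.
  rewrite exprn_gt0// => /(_ isT) [K _ /(_ K (leqnn K)) H].
  by exists K; apply: le_trans H; exact: ler_norm.
pose g : coeffs R := fun n => if (`|n| <= K)%N then f n else 0.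
have gr : real_valued g.
  by move=> n; rewrite /g abszN; case: ifP => _; [exact: l2_real|rewrite conjc0].
have n0 : normc (0 : R[i]) = 0 by exact: ComplexField.Normc.normc0.
have gle L : \sum_(n <- zbox L) ((W n)%:num * normc (g n)) ^+ 2 <= `|f| ^+ 2.
  apply: le_trans (l2_partial_le f L); apply: ler_sum => n _; rewrite /g.
  by case: ifP => // _; rewrite n0 mulr0 expr0n; exact: sqr_ge0.
have [g' g'E gle'] := l2_of gr (normr_ge0 f) gle.
exists K, g'; split => // [n Kn|].
  by rewrite g'E /g leqNgt Kn.
have tl L : \sum_(n <- zbox L) ((W n)%:num * normc (((f : coeffs R) - g) n)) ^+ 2 <= eps ^+ 2.
  apply: le_trans (zbox_sum_homo _ (leq_addl K L)) _; first by move=> n; exact: sqr_ge0.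
  rewrite (eq_bigr (fun n => if (`|n| <= K)%N then 0 else F n)); last first.
    move=> n _; rewrite -[(_ - g) n]/(f n - g n) /g; case: ifP => _.
      by rewrite subrr n0 mulr0 expr0n.
    by rewrite subr0.
  rewrite zbox_sum_support_tail; apply: le_trans KP; rewrite lerD2r.
  exact: l2_partial_le.
have fgr : real_valued ((f : coeffs R) - g).
  by move=> n; rewrite -[(_ - g) (- n)]/(f (- n) - g (- n)) (l2_real f) gr -rmorphB.
have [z zE zB] := l2_of fgr (ltW eps0) tl.
suff -> : f - g' = z by [].
by apply: val_inj; rewrite /= zE -g'E.
Qed.

Lemma shift_sum_eq_tri (R : realType) (K : nat) (G : int -> int -> int -> R) :
  (forall a b c : int, (K < `|a|)%N || (K < `|c|)%N -> G a b c = 0) ->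
  \sum_(n <- zbox K) \sum_(m <- zbox K) G m (n - m) (- n) = tri (K + K) G.
Proof.
move=> G0; rewrite tri_rot zbox_sum_opp /tri.
pose S c a := \sum_(b <- zbox (K + K)) (if c + a + b == 0 then G a b c else 0).
rewrite -[RHS]/(\sum_(c <- zbox (K + K)) \sum_(a <- zbox (K + K)) S c a).
have S0 c a : (K < `|a|)%N || (K < `|c|)%N -> S c a = 0.
  by move=> ac; apply: big1 => b _; rewrite G0//; case: ifP.
rewrite [RHS](@zbox_sum_support _ _ K) ?leq_addr//; last first.
  by move=> c cK; apply: big1 => a _; rewrite S0// cK orbT.
rewrite big_seq [RHS]big_seq; apply: eq_bigr => c cK.
rewrite [RHS](@zbox_sum_support _ _ K) ?leq_addr//; last first.
  by move=> a aK; rewrite S0// aK.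
rewrite big_seq [RHS]big_seq; apply: eq_bigr => a aK.
rewrite /S (zbox_sum_zero_unique (fun b => G a b c)) ?opprK ?opprD//.
by move: cK aK; rewrite !mem_zbox; lia.
Qed.

Lemma ler_norm_tri (R : realType) (K : nat) (G : int -> int -> int -> R) :
  `|tri K G| <= tri K (fun a b c => `|G a b c|).
Proof.
rewrite /tri; apply: le_trans (ler_norm_sum _ _ _) _; apply: ler_sum => a _.
apply: le_trans (ler_norm_sum _ _ _) _; apply: ler_sum => b _.
apply: le_trans (ler_norm_sum _ _ _) _; apply: ler_sum => c _.
by case: ifP; rewrite ?normr0.
Qed.

Lemma dotcE (R : realType) (z w : R[i]) : dotc z w = complex.Re (z^*%C * w).
Proof. by case: z w => a b [c d] /=; rewrite /dotc /=; ring. Qed.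

Lemma dotc_sumr (R : realType) (I : Type) (r : seq I) (z : R[i]) (F : I -> R[i]) :
  dotc z (\sum_(i <- r) F i) = \sum_(i <- r) dotc z (F i).
Proof.
elim: r => [|i r IH]; first by rewrite !big_nil /dotc /=; ring.
by rewrite !big_cons -IH /dotc !raddfD/=; ring.
Qed.

Lemma csums_support (R : realType) (F : int -> R[i]) (z : R[i]) (K : nat) :
  (forall n : int, (K < `|n|)%N -> F n = 0) -> csums F z -> z = \sum_(n <- zbox K) F n.
Proof.
move=> F0 Fz; apply: (csums_unique Fz).
have E L : (K <= L)%N -> \sum_(n <- zbox L) F n = \sum_(n <- zbox K) F n.
  move=> KL; have [j ->] : exists j, L = (K + j)%N by exists (L - K)%N; rewrite subnKC.
  elim: j => [|j IH]; first by rewrite addn0.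
  by rewrite addnS sum_zboxS IH !F0 ?add0r// ?abszN absz_nat ltnS leq_addr.
by split; apply: cvg_near_cst; exists K => // L KL; rewrite E.
Qed.

Section BilinearOperator.
Context {R : realType}.
Variables (N rho s d beta D : R).
Hypothesis KP : kernel_params rho s d beta.
Hypothesis N1 : 1 <= N.
Hypothesis D0 : 0 <= D.
Hypothesis thD : forall K, \sum_(n <- zbox K) theta d n ^+ 2 <= D ^+ 2.
Implicit Types (ph : int -> int -> R[i]) (P : R) (Psi : R -> R[i]).

Local Notation W := (iwt N s).
Local Notation cst := (bilin_const rho s D).

Definition phase_real ph := forall n m : int, ph (- n) (- m) = ((ph n m)^*)%C.

Lemma conjc_i : (('i%C : R[i])^*)%C = - 'i%C.
Proof. by apply/eqP; rewrite eq_complex /= oppr0 !eqxx. Qed.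

Lemma bilin_real P ph (f g : l2 W) : 0 <= P -> phase_le rho P ph -> phase_real ph ->
  real_valued (bilin ph f g).
Proof.
move=> P0 phP phr n; have [->|n0] := eqVneq n 0.
  by rewrite oppr0 /bilin mulr0z mulr0 mul0r conjc0.
have nn0 : - n != 0 by rewrite oppr_eq0.
have c1 := csums_conj (bilin_csums KP N1 D0 thD f g P0 phP n0).
have c2 := bilin_csums KP N1 D0 thD f g P0 phP nn0.
rewrite /bilin rmorphM rmorphM rmorph_int /= -[X in _ = X * _ * _]/(('i%C)^*%C) conjc_i.
rewrite mulrNz mulrN !mulNr; congr (- (_ * _)).
apply: (csums_unique c2); move: c1; congr (csums _ _); apply/funext => m.
rewrite !bilin_termE oppr_eq0 -[n - - m]opprK opprD opprK oppr_eq0.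
have -> : - n - m = - (n + m) by rewrite opprD.
case: ifP => _; last by rewrite conjc0.
rewrite !rmorphM /= -phr opprK; congr (_ * _ * _).
  by rewrite -(l2_real f) opprK.
by rewrite -(l2_real g) opprK opprD.
Qed.

(** [insubd] makes the operator total, so that its algebra can be stated without proof arguments;
    [bopP] shows that it agrees with [bilin] for the phases considered. *)
Definition bop ph (f g : l2 W) : l2 W := insubd (0 : l2 W) (bilin ph f g).

Lemma bopP P ph (f g : l2 W) : 0 <= P -> phase_le rho P ph -> phase_real ph ->
  l2v (bop ph f g) = bilin ph f g /\ `|bop ph f g| <= cst * P * (`|f| * `|g|).
Proof.
move=> P0 phP phr.
have B0 : 0 <= cst * P * (`|f| * `|g|).
  exact: mulr_ge0 (mulr_ge0 (bilin_const_ge0 _ _ D0) P0) (mulr_ge0 (normr_ge0 _) (normr_ge0 _)).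
have [y yE yB] := l2_of (bilin_real f g P0 phP phr) B0
  (fun K => bilin_partial_le KP N1 D0 thD f g K P0 phP).
have E : bop ph f g = y.
  by apply: val_inj; rewrite /bop val_insubd -yE (l2vP y).
by rewrite E.
Qed.

Lemma bilin_add P ph (f1 g1 f2 g2 f3 g3 : l2 W) ph1 ph2 ph3 (n : int) : 0 <= P ->
  phase_le rho P ph1 -> phase_le rho P ph2 -> phase_le rho P ph3 ->
  (forall m, bilin_term ph3 f3 g3 n m = bilin_term ph1 f1 g1 n m + bilin_term ph2 f2 g2 n m) ->
  bilin ph3 f3 g3 n = bilin ph1 f1 g1 n + bilin ph2 f2 g2 n.
Proof.
move=> P0 p1 p2 p3 H; have [->|n0] := eqVneq n 0.
  by rewrite /bilin mulr0z mulr0 !mul0r addr0.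
have c1 := bilin_csums KP N1 D0 thD f1 g1 P0 p1 n0.
have c2 := bilin_csums KP N1 D0 thD f2 g2 P0 p2 n0.
have c3 := bilin_csums KP N1 D0 thD f3 g3 P0 p3 n0.
rewrite /bilin -mulrDr; congr (_ * _); apply: (csums_unique c3).
by move: (csumsD c1 c2); congr (csums _ _); apply/funext => m; rewrite H.
Qed.

Lemma bopDl P ph (f g k : l2 W) : 0 <= P -> phase_le rho P ph -> phase_real ph ->
  bop ph (f + g) k = bop ph f k + bop ph g k.
Proof.
move=> P0 pP pr; apply: val_inj; apply/funext => n.
rewrite /= (bopP _ _ P0 pP pr).1 -[RHS]/(l2v (bop ph f k) n + l2v (bop ph g k) n).
rewrite !(bopP _ _ P0 pP pr).1; apply: (@bilin_add P) => // m.
rewrite !bilin_termE; case: ifP => _; last by rewrite addr0.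
by rewrite -mulrDl -mulrDr.
Qed.

Lemma bopDr P ph (f g k : l2 W) : 0 <= P -> phase_le rho P ph -> phase_real ph ->
  bop ph k (f + g) = bop ph k f + bop ph k g.
Proof.
move=> P0 pP pr; apply: val_inj; apply/funext => n.
rewrite /= (bopP _ _ P0 pP pr).1 -[RHS]/(l2v (bop ph k f) n + l2v (bop ph k g) n).
rewrite !(bopP _ _ P0 pP pr).1; apply: (@bilin_add P) => // m.
rewrite !bilin_termE; case: ifP => _; last by rewrite addr0.
by rewrite -mulrDr.
Qed.

Lemma bopBl P ph (f g k : l2 W) : 0 <= P -> phase_le rho P ph -> phase_real ph ->
  bop ph (f - g) k = bop ph f k - bop ph g k.
Proof.
move=> P0 pP pr; apply/eqP; rewrite -subr_eq0 opprB addrA subr_eq0; apply/eqP.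
by rewrite -(bopDl _ _ _ P0 pP pr) subrK.
Qed.

Lemma bopBr P ph (f g k : l2 W) : 0 <= P -> phase_le rho P ph -> phase_real ph ->
  bop ph k (f - g) = bop ph k f - bop ph k g.
Proof.
move=> P0 pP pr; apply/eqP; rewrite -subr_eq0 opprB addrA subr_eq0; apply/eqP.
by rewrite -(bopDr _ _ _ P0 pP pr) subrK.
Qed.

Lemma bop_phaseD P ph1 ph2 ph3 (f g : l2 W) : 0 <= P ->
  phase_le rho P ph1 -> phase_le rho P ph2 -> phase_le rho P ph3 ->
  phase_real ph1 -> phase_real ph2 -> phase_real ph3 ->
  (forall n m, ph3 n m = ph1 n m + ph2 n m) ->
  bop ph3 f g = bop ph1 f g + bop ph2 f g.
Proof.
move=> P0 p1 p2 p3 r1 r2 r3 H; apply: val_inj; apply/funext => n.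
rewrite /= (bopP _ _ P0 p3 r3).1 -[RHS]/(l2v (bop ph1 f g) n + l2v (bop ph2 f g) n).
rewrite (bopP _ _ P0 p1 r1).1 (bopP _ _ P0 p2 r2).1; apply: (@bilin_add P) => // m.
rewrite !bilin_termE H; case: ifP => _; last by rewrite addr0.
by rewrite !mulrDl.
Qed.

(* The dispersive phase n^3 - m^3 - (n - m)^3 = 3 n m (n - m), up to sign. *)
Definition dphase Psi (n m : int) : R[i] := Psi (- 3 * n%:~R * m%:~R * (n - m)%:~R).

Lemma dphase_real Psi : (forall x, Psi (- x) = ((Psi x)^*)%C) -> phase_real (dphase Psi).
Proof.
move=> Pr n m; rewrite /dphase -Pr; congr Psi.
by rewrite -opprD !mulrNz; ring.
Qed.

Lemma dphase_le P Psi : 0 <= P -> (forall x, normc (Psi x) <= P * japanese x `^ (- rho)) ->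
  phase_le rho P (dphase Psi).
Proof.
move=> P0 Psile n m n0 m0 nm0; apply: (le_trans (Psile _)); apply: ler_wpM2l => //.
set x := _ * (n - m)%:~R.
have r0 : 0 < rho by have := kp_rho KP; lra.
have pos (k : int) : k != 0 -> 0 < (iabs k : R) by move=> k0; rewrite ltr0n absz_gt0.
rewrite -!powRM ?mulr_ge0 ?iabs_ge0// !powRN lef_pV2 ?posrE ?powR_gt0 ?mulr_gt0 ?pos//; last first.
  by rewrite /japanese sqrtr_gt0 ltr_pwDl// sqr_ge0.
apply: ge0_ler_powR; rewrite ?nnegrE ?mulr_ge0 ?iabs_ge0 ?sqrtr_ge0//; first exact: ltW.
have iE (k : int) : iabs k = `|k%:~R| :> R by rewrite /iabs -intr_norm -abszE.
apply: (@le_trans _ _ `|x|).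
  rewrite /x !normrM normrN normr_nat !iE -!mulrA.
  by rewrite ler_peMl ?ler1n// !mulr_ge0.
by rewrite /japanese -(sqrtr_sqr x) ler_wsqrtr// lerDr.
Qed.

End BilinearOperator.

(** * Almost conservation of the energy *)

Section TrilinearEnergy.
Context {R : realType}.
Variables (N rho s d beta D P : R) (Psi : R -> R[i]).
Hypothesis KP : kernel_params rho s d beta.
Hypothesis N1 : 1 <= N.
Hypothesis D0 : 0 <= D.
Hypothesis thD : forall K, \sum_(n <- zbox K) theta d n ^+ 2 <= D ^+ 2.
Hypothesis P0 : 0 <= P.
Hypothesis PsiN : forall x, Psi (- x) = ((Psi x)^*)%C.
Hypothesis Psi_le : forall x, normc (Psi x) <= P * japanese x `^ (- rho).

Local Notation W := (iwt N s).
Local Notation X := (bop (dphase Psi)).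

Let phP : phase_le rho P (dphase Psi) := dphase_le KP P0 Psi_le.
Let phr : phase_real (dphase Psi) := dphase_real PsiN.

Definition energy_const : R :=
  3 * D * (2 * (2 + `|2 * s|) * 2 `^ `|2 * s| * 2 `^ (rho + `|s|)).

(** The summand of [l2ip h (X f g)] for input frequencies [a], [b] and output frequency [- c]. *)
Definition tri_term (f g h : coeffs R) (a b c : int) : R :=
  (W c)%:num ^+ 2 * dotc (h (- c)) (('i%C * (- c)%:~R) *
    (if (a != 0) && (b != 0) then Psi (- 3 * (- c)%:~R * a%:~R * b%:~R) * f a * g b else 0)).

(** Finite supports turn the inner product into a finite sum, so the symmetrisation involves no
    interchange of limits. *)
Lemma ip_bop_tri (f g h : l2 W) (K : nat) :
  (forall n : int, (K < `|n|)%N -> f n = 0) -> (forall n : int, (K < `|n|)%N -> h n = 0) ->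
  l2ip h (X f g) = tri (K + K) (tri_term f g h).
Proof.
move=> fK hK.
have dot0 z : dotc (0 : R[i]) z = 0 by rewrite /dotc /=; ring.
have dot0r z : dotc z (0 : R[i]) = 0 by rewrite /dotc /=; ring.
transitivity (wdot W h (X f g) K).
  apply: l2ip_eq; apply: cvg_near_cst; exists K => // L /= KL.
  by apply: zbox_sum_support => // n nK; rewrite hK// dot0 mulr0.
rewrite -shift_sum_eq_tri; last first.
  move=> a b c /orP[aK|cK]; rewrite /tri_term.
    by rewrite (fK a)// mulr0 mul0r if_same mulr0 dot0r mulr0.
  by rewrite hK ?abszN// dot0 mulr0.
apply: eq_bigr => n _; rewrite /tri_term opprK iwtN -mulr_sumr; congr (_ * _).
rewrite (bopP KP N1 D0 thD f g P0 phP phr).1 -dotc_sumr; congr dotc.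
rewrite -mulr_sumr /bilin; have [->|n0] := eqVneq n 0; first by rewrite mulr0z mulr0 !mul0r.
congr (_ * _).
have c1 := bilin_csums KP N1 D0 thD f g P0 phP n0.
rewrite (csums_support _ c1 (K := K)); last first.
  by move=> m mK; rewrite bilin_termE fK// mulr0 mul0r if_same.
by apply: eq_bigr => m _; rewrite bilin_termE.
Qed.

Lemma Re_iM (z : R[i]) (x : int) : complex.Re (('i%C * (- x)%:~R) * z) = x%:~R * complex.Im z.
Proof.
have -> : ((- x)%:~R : R[i]) = ((- x)%:~R : R)%:C%C by rewrite rmorph_int.
by case: z => u v /=; rewrite mulrNz; ring.
Qed.

(** The three cyclic terms contain the same imaginary part of [z]: the phase depends only on the
    product [a * b * c], and real-valuedness turns the conjugate of the test function at [- c] into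
    its coefficient at [c]. Only the weights differ, and they add up to the symbol of the cubic
    form. *)
Lemma tri_term_sum_le (f g h : l2 W) (a b c : int) : a + b + c = 0 ->
  `|tri_term f g h a b c + (tri_term g h f b c a + tri_term h f g c a b)| <=
  (if [&& a != 0, b != 0 & c != 0] then
     P * (`|a%:~R * (W a)%:num ^+ 2 + b%:~R * (W b)%:num ^+ 2 + c%:~R * (W c)%:num ^+ 2|
      * (iqwt N s rho a * iqwt N s rho b * iqwt N s rho c)) else 0)
  * (((W a)%:num * normc (f a)) * ((W b)%:num * normc (g b)) * ((W c)%:num * normc (h c))).
Proof.
move=> abc.
have dot0r z : dotc z (0 : R[i]) = 0 by rewrite /dotc /=; ring.
rewrite /tri_term.
have [->|a0] := eqVneq a 0.
  by rewrite oppr0 !mulr0z !andbF /= !mulr0 !mul0r !dot0r !mulr0 !addr0 normr0.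
have [->|b0] := eqVneq b 0.
  by rewrite oppr0 !mulr0z !andbF /= !mulr0 !mul0r !dot0r !mulr0 !addr0 normr0.
have [->|c0] := eqVneq c 0.
  by rewrite oppr0 !mulr0z !andbF /= !mulr0 !mul0r !dot0r !mulr0 !addr0 normr0.
pose x : R := 3 * a%:~R * b%:~R * c%:~R.
pose z := Psi x * f a * g b * h c.
have co (k : l2 W) n : ((k (- n))^*)%C = k n.
  by rewrite -(l2_real k) opprK.
have e1 : dotc (h (- c)) ('i%C * (- c)%:~R * (Psi (- 3 * (- c)%:~R * a%:~R * b%:~R) * f a * g b))
    = c%:~R * complex.Im z.
  rewrite dotcE co -Re_iM; congr complex.Re.
  have -> : - 3 * (- c)%:~R * a%:~R * b%:~R = x by rewrite /x mulrNz; ring.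
  by rewrite /z; ring.
have e2 : dotc (f (- a)) ('i%C * (- a)%:~R * (Psi (- 3 * (- a)%:~R * b%:~R * c%:~R) * g b * h c))
    = a%:~R * complex.Im z.
  rewrite dotcE co -Re_iM; congr complex.Re.
  have -> : - 3 * (- a)%:~R * b%:~R * c%:~R = x by rewrite /x mulrNz; ring.
  by rewrite /z; ring.
have e3 : dotc (g (- b)) ('i%C * (- b)%:~R * (Psi (- 3 * (- b)%:~R * c%:~R * a%:~R) * h c * f a))
    = b%:~R * complex.Im z.
  rewrite dotcE co -Re_iM; congr complex.Re.
  have -> : - 3 * (- b)%:~R * c%:~R * a%:~R = x by rewrite /x mulrNz; ring.
  by rewrite /z; ring.
rewrite e1 e2 e3.
pose S := a%:~R * (W a)%:num ^+ 2 + b%:~R * (W b)%:num ^+ 2 + c%:~R * (W c)%:num ^+ 2.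
rewrite -/S.
have -> : (W c)%:num ^+ 2 * (c%:~R * complex.Im z) + ((W a)%:num ^+ 2 * (a%:~R * complex.Im z)
   + (W b)%:num ^+ 2 * (b%:~R * complex.Im z)) = S * complex.Im z by rewrite /S; ring.
rewrite normrM.
have zle : `|complex.Im z| <= P * ((iqwt N s rho a * iqwt N s rho b * iqwt N s rho c)
   * (((W a)%:num * normc (f a)) * ((W b)%:num * normc (g b)) * ((W c)%:num * normc (h c)))).
  apply: le_trans (normc_ReIm_le z).2 _; rewrite /z !normcM.
  have m0 : b + a != 0 by move: abc c0; clear; lia.
  have := phP (n := b + a) (m := a) m0 a0; rewrite addrK => /(_ b0).
  rewrite /dphase addrK => le.
  have np p : p != 0 -> (W p)%:num * iqwt N s rho p = iabs p `^ (- rho).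
    by move=> p0; rewrite /iqwt /qwt /= mulrCA mulfV ?mulr1// gt_eqF// mwt_gt0.
  have xE : - 3 * (b + a)%:~R * a%:~R * b%:~R = x.
    have -> : b + a = - c by move: abc; clear; lia.
    by rewrite /x mulrNz; ring.
  have cE : iabs (b + a) = iabs c :> R.
    have -> : b + a = - c by move: abc; clear; lia.
    by rewrite iabsN.
  move: le; rewrite xE cE -!np// => le.
  have F0 : 0 <= normc (f a) * (normc (g b) * normc (h c)) by rewrite !mulr_ge0 ?normc_ge0.
  have := ler_wpM2r F0 le.
  by move=> H; apply: le_trans (le_trans H _); rewrite le_eqVlt; apply/orP; left; apply/eqP; ring.
have := ler_wpM2l (normr_ge0 S) zle => H; apply: (le_trans H).
rewrite (_ : [&& ~~ false, ~~ false & ~~ false] = true)//.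
by rewrite le_eqVlt; apply/orP; left; apply/eqP; ring.
Qed.

(** The cyclic symmetrisation of [l2ip h (X f g)], equal to three times the cubic form on the
    diagonal. Three arguments are kept so that differences of cubic forms can be expanded. *)
Definition tri_form (f g h : l2 W) : R :=
  l2ip h (X f g) + (l2ip f (X g h) + l2ip g (X h f)).

Local Notation kap := (energy_const * N `^ (- beta) * P).

Lemma energy_const_ge0 : 0 <= energy_const.
Proof. by rewrite /energy_const !mulr_ge0 ?powR_ge0 ?addr_ge0. Qed.

Lemma tri_form_support_le (f g h : l2 W) (K : nat) :
  (forall n : int, (K < `|n|)%N -> f n = 0) -> (forall n : int, (K < `|n|)%N -> g n = 0) ->
  (forall n : int, (K < `|n|)%N -> h n = 0) ->
  `|tri_form f g h| <= kap * (`|f| * `|g| * `|h|).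
Proof.
move=> fK gK hK; rewrite /tri_form !(@ip_bop_tri _ _ _ K)//.
rewrite (tri_rot _ (tri_term g h f)) (tri_rot _ (tri_term h f g)).
rewrite (tri_rot _ (fun c a b => tri_term h f g a b c)).
rewrite -!triD; apply: le_trans (ler_norm_tri _ _) _.
pose k a b c : R := if [&& a != 0, b != 0 & c != 0] then
     P * (`|a%:~R * (W a)%:num ^+ 2 + b%:~R * (W b)%:num ^+ 2 + c%:~R * (W c)%:num ^+ 2|
      * (iqwt N s rho a * iqwt N s rho b * iqwt N s rho c)) else 0.
pose C := 2 * (2 + `|2 * s|) * 2 `^ `|2 * s| * 2 `^ (rho + `|s|) * N `^ (- beta) * P.
have C0 : 0 <= C by rewrite /C !mulr_ge0 ?powR_ge0 ?addr_ge0.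
pose F (f : l2 W) n := (W n)%:num * normc (f n).
have F0 (u : l2 W) n : 0 <= F u n by rewrite mulr_ge0 ?normc_ge0.
have kth a b c : a + b + c = 0 -> k a b c <= C * (theta d a + theta d b + theta d c).
  move=> abc; rewrite /k; case: ifPn => [/and3P[a0 b0 c0]|_]; last first.
    by rewrite mulr_ge0// !addr_ge0// theta_ge0.
  have := ler_wpM2l P0 (energy_kernel_int KP N1 a0 b0 c0 abc).
  by move=> H; apply: (le_trans H); rewrite le_eqVlt; apply/orP; left; apply/eqP; rewrite /C; ring.
apply: (@le_trans _ _ (tri (K + K) (fun a b c => k a b c * (F f a * F g b * F h c)))).
  by apply: ler_tri => a b c abc; exact: tri_term_sum_le.
have := tri_kernel_le C0 (l2norm_ge0 f) (l2norm_ge0 g) (l2norm_ge0 h) D0 (@theta_ge0 R d)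
  (F0 f) (F0 g) (F0 h) kth (thD (K + K)) (l2_partial_le f _) (l2_partial_le g _) (l2_partial_le h _).
move=> H; apply: (le_trans H); rewrite !l2_normE le_eqVlt; apply/orP; left; apply/eqP.
by rewrite /C /energy_const; ring.
Qed.

Lemma tri_formBl (f f' g h : l2 W) : tri_form (f - f') g h = tri_form f g h - tri_form f' g h.
Proof.
rewrite /tri_form (bopBl KP N1 D0 thD _ _ _ P0 phP phr) (bopBr KP N1 D0 thD _ _ _ P0 phP phr).
have Bl (u v k : l2 W) : l2ip (u - v) k = l2ip u k - l2ip v k by rewrite l2ipDl l2ipNl.
have Br (u v k : l2 W) : l2ip k (u - v) = l2ip k u - l2ip k v.
  by rewrite l2ipC Bl !(l2ipC k).
by rewrite Bl !Br; zmod.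
Qed.

Lemma tri_form_rot (f g h : l2 W) : tri_form f g h = tri_form g h f.
Proof. by rewrite /tri_form; zmod. Qed.

(** No gain in [N] here: this bound only supplies the continuity needed to pass from finitely
    supported families to all. *)
Lemma tri_form_crude (f g h : l2 W) :
  `|tri_form f g h| <= 3 * bilin_const rho s D * P * (`|f| * `|g| * `|h|).
Proof.
have one (u v w : l2 W) : `|l2ip u (X v w)| <= bilin_const rho s D * P * (`|v| * `|w| * `|u|).
  apply: le_trans (l2ip_le _ _) _.
  have := (bopP KP N1 D0 thD v w P0 phP phr).2; rewrite !l2_normE => H.
  have := ler_wpM2l (l2norm_ge0 u) H.
  by move=> H2; apply: (le_trans H2); rewrite le_eqVlt; apply/orP; left; apply/eqP; ring.
rewrite /tri_form; apply: le_trans (ler_normD _ _) _.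
apply: le_trans (lerD (one _ _ _) (ler_normD _ _)) _.
apply: le_trans (lerD (lexx _) (lerD (one _ _ _) (one _ _ _))) _.
by rewrite le_eqVlt; apply/orP; left; apply/eqP; ring.
Qed.

Lemma tri_form_le (f g h : l2 W) : `|tri_form f g h| <= kap * (`|f| * `|g| * `|h|).
Proof.
pose A := 3 * bilin_const rho s D * P * (`|f| * `|g| + `|g| * `|h| + `|h| * `|f|).
have Q0 : 0 <= 3 * bilin_const rho s D * P.
  by apply: mulr_ge0 => //; apply: mulr_ge0 => //; exact: bilin_const_ge0.
have A0 : 0 <= A by apply: mulr_ge0 => //; nneg.
apply/ler_addgt0Pr => eps eps0.
have e0 : 0 < eps / (A + 1) by rewrite divr_gt0// ltr_wpDl.
have [K1 [f' [f'K f'f fd]]] := l2_truncate f e0.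
have [K2 [g' [g'K g'g gd]]] := l2_truncate g e0.
have [K3 [h' [h'K h'h hd]]] := l2_truncate h e0.
set e := eps / (A + 1) in e0 fd gd hd.
pose K := maxn K1 (maxn K2 K3).
have S : `|tri_form f' g' h'| <= kap * (`|f'| * `|g'| * `|h'|).
  apply: (@tri_form_support_le _ _ _ K) => n nK; [apply: f'K|apply: g'K|apply: h'K];
  move: nK; rewrite /K; clear; lia.
have -> : tri_form f g h = tri_form (f - f') g h + tri_form f' (g - g') h
    + tri_form f' g' (h - h') + tri_form f' g' h'.
  rewrite (tri_form_rot f' (g - g') h) (tri_form_rot f' g' (h - h')) (tri_form_rot g' (h - h') f').
  rewrite !tri_formBl -(tri_form_rot f' g h) -(tri_form_rot f' g' h).
  rewrite (tri_form_rot h f' g') (tri_form_rot h' f' g').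
  by zmod.
apply: le_trans (ler_normD _ _) _; rewrite addrC; apply: lerD.
  apply: (le_trans S); apply: ler_wpM2l.
    by rewrite mulr_ge0 ?powR_ge0// mulr_ge0 ?energy_const_ge0 ?powR_ge0.
  by apply: ler_pM; rewrite ?mulr_ge0//; apply: ler_pM.
have t1 : `|tri_form (f - f') g h| <= 3 * bilin_const rho s D * P * (e * `|g| * `|h|).
  apply: le_trans (tri_form_crude _ _ _) _; apply: ler_wpM2l => //.
  by apply: ler_wpM2r => //; apply: ler_wpM2r.
have t2 : `|tri_form f' (g - g') h| <= 3 * bilin_const rho s D * P * (`|f| * e * `|h|).
  apply: le_trans (tri_form_crude _ _ _) _; apply: ler_wpM2l => //.
  by apply: ler_wpM2r => //; apply: ler_pM.
have t3 : `|tri_form f' g' (h - h')| <= 3 * bilin_const rho s D * P * (`|f| * `|g| * e).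
  apply: le_trans (tri_form_crude _ _ _) _; apply: ler_wpM2l => //.
  by apply: ler_pM => //; exact: ler_pM.
apply: le_trans (ler_normD _ _) _.
apply: le_trans (lerD (ler_normD _ _) (lexx _)) _.
apply: le_trans (lerD (lerD t1 t2) t3) _.
have -> : 3 * bilin_const rho s D * P * (e * `|g| * `|h|)
  + 3 * bilin_const rho s D * P * (`|f| * e * `|h|)
  + 3 * bilin_const rho s D * P * (`|f| * `|g| * e) = A * e by rewrite /A; ring.
apply: (@le_trans _ _ ((A + 1) * e)).
  by rewrite mulrDl lerDl mul1r ltW.
by rewrite /e mulrCA divff ?mulr1// gt_eqF// ltr_wpDl.
Qed.

(** Invariance under rotation telescopes the difference of the diagonal values through the arguments
    [(f - g, f, f)], [(f - g, f, g)] and [(f - g, g, g)]. *)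
Lemma ip_bop_diff_le (f g : l2 W) :
  `|l2ip f (X f f) - l2ip g (X g g)| <= kap * (`|f - g| * (`|f| + `|g|) ^+ 2).
Proof.
have E u : l2ip u (X u u) = tri_form u u u / 3.
  by rewrite /tri_form; move: (l2ip _ _) => y; field.
have -> : l2ip f (X f f) - l2ip g (X g g) =
  (tri_form (f - g) f f + tri_form (f - g) f g + tri_form (f - g) g g) / 3.
  rewrite !E !tri_formBl.
  rewrite (tri_form_rot g f f) (tri_form_rot f f g) (tri_form_rot f g f).
  rewrite (tri_form_rot f g g) (tri_form_rot g g f) -mulrBl; congr (_ / 3).
  by zmod.
have k0 : 0 <= kap.
  by rewrite mulr_ge0 ?powR_ge0// mulr_ge0 ?energy_const_ge0 ?powR_ge0.
rewrite normrM [`|3^-1|]ger0_norm// ler_pdivrMr//.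
apply: le_trans (ler_normD _ _) _.
apply: le_trans (lerD (ler_normD _ _) (lexx _)) _.
apply: le_trans (lerD (lerD (tri_form_le _ _ _) (tri_form_le _ _ _)) (tri_form_le _ _ _)) _.
rewrite -2!mulrDr -(mulrA kap); apply: ler_wpM2l => //.
set x := `|f - g|; have x0 : 0 <= x by exact: normr_ge0.
have -> : x * `|f| * `|f| + x * `|f| * `|g| + x * `|g| * `|g| =
  x * (`|f| * `|f| + `|f| * `|g| + `|g| * `|g|) by ring.
rewrite -(mulrA x); apply: ler_wpM2l => //.
have : 0 <= `|f| * `|g| by exact: mulr_ge0.
by have := sqr_ge0 `|f|; have := sqr_ge0 `|g|; nra.
Qed.

End TrilinearEnergy.

(** * The oscillatory integral of the modulation and the driver it defines *)

Section Phase.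
Context {R : realType}.
Variable w : R -> R.
Hypothesis wc : {within `[0, +oo[, continuous w}.

Lemma Phi_integrable (h : R -> R) (a r t : R) : continuous h -> 0 <= r ->
  (@lebesgue_measure R).-integrable `[r, t] (EFin \o (fun x => h (a * w x))).
Proof.
move=> hc r0; apply: continuous_compact_integrable; first exact: segment_compact.
have wrt : {within `[r, t], continuous w}.
  apply: continuous_subspaceW wc => x /=; rewrite !in_itv/= => /andP[rx _].
  by rewrite andbT (le_trans r0).
have gc : continuous (fun y => h (a * y)).
  move=> y; apply: (@continuous_comp _ _ _ (fun y => a * y) h); last exact: hc.
  by apply: cvgM; [exact: cvg_cst|exact: cvg_id].
by apply: (@within_continuous_comp _ _ _ _ w (fun y => h (a * y))) => // y _; exact: gc.
Qed.

Lemma Rintegral_chasles (h : R -> R) (a r m t : R) : continuous h -> 0 <= r <= m -> m <= t ->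
  \int[lebesgue_measure]_(x in `[r, t]) h (a * w x) =
  \int[lebesgue_measure]_(x in `[m, t]) h (a * w x)
  + \int[lebesgue_measure]_(x in `[r, m]) h (a * w x).
Proof.
move=> hc /andP[r0 rm] mt; apply/eqP; rewrite -subr_eq; apply/eqP.
rewrite Rintegral_itvB ?bnd_simp//; last exact: Phi_integrable.
apply: Rintegral_itv_obnd_cbnd.
have := @Phi_integrable h a m t hc (le_trans r0 rm).
by apply: integrableS => //; exact: subset_itv_oc_cc.
Qed.

Lemma Phi_chasles (a r m t : R) : 0 <= r <= m -> m <= t ->
  Phi w t r a = Phi w t m a + Phi w m r a.
Proof.
move=> rm mt; rewrite /Phi (@Rintegral_chasles (@cos R) a r m t)//; last exact: continuous_cos.
rewrite (@Rintegral_chasles (@sin R) a r m t)//; exact: continuous_sin.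
Qed.

Lemma Phi_conj (a r t : R) : 0 <= r -> Phi w t r (- a) = ((Phi w t r a)^*)%C.
Proof.
move=> r0; rewrite /Phi /=; congr (_ +i* _)%C.
  by apply: eq_Rintegral => x _; rewrite mulNr cosN.
rewrite -mulN1r -RintegralZl//; last first.
  by apply: (@Phi_integrable (@sin R)) => //; exact: continuous_sin.
by apply: eq_Rintegral => x _; rewrite mulNr sinN mulN1r.
Qed.

Lemma Phi_diag (a t : R) : Phi w t t a = 0.
Proof. by rewrite /Phi set_itv1 !Rintegral_set1. Qed.

(** The supremum in [Wnorm] ranges over [r < t], so the diagonal, where the phase is [0], is treated
    apart. The maximum with [1] makes the constant positive. *)
Lemma Phi_le (rho gamma T : R) : 0 < gamma -> irregular_on rho gamma T w ->
  exists2 Cw : R, 0 < Cw & forall a r t, 0 <= r <= t -> t <= T ->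
    normc (Phi w t r a) <= Cw * (t - r) `^ gamma * japanese a `^ (- rho).
Proof.
move=> g0 irr; pose Cw := Num.max 1 (fine (Wnorm rho gamma T w)).
have Cw0 : 0 < Cw by rewrite lt_max ltr01.
exists Cw => // a r t /andP[r0 rt] tT.
have [->|rnt] := eqVneq r t.
  by rewrite Phi_diag ComplexField.Normc.normc0 !mulr_ge0 ?powR_ge0// ltW.
have r_lt : r < t by rewrite lt_neqAle rnt.
have tr0 : 0 < t - r by rewrite subr_gt0.
have j0 : 0 < japanese a by rewrite /japanese sqrtr_gt0 ltr_pwDl// sqr_ge0.
have : ((japanese a `^ rho * (normc (Phi w t r a) / `|t - r| `^ gamma))%:E <= Cw%:E)%E.
  apply: (@le_trans _ _ (Wnorm rho gamma T w)).
    by apply: ereal_sup_ubound; exists a, r, t.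
  have W0 : (0 <= Wnorm rho gamma T w)%E.
    apply: le_trans (ereal_sup_ubound _); last by exists a, r, t.
    rewrite lee_fin mulr_ge0 ?powR_ge0// divr_ge0 ?powR_ge0//.
    exact: normc_ge0.
  rewrite -[leLHS]fineK; last by rewrite ge0_fin_numE.
  by rewrite lee_fin le_max lexx orbT.
rewrite lee_fin gtr0_norm// powRN.
rewrite mulrA ler_pdivrMr ?powR_gt0// => H.
by rewrite ler_pdivlMr ?powR_gt0// mulrC.
Qed.

End Phase.

Section L2Driver.
Context {R : realType}.
Variables (w : R -> R) (N rho s d beta D gamma T Cw : R).
Hypothesis wc : {within `[0, +oo[, continuous w}.
Hypothesis KP : kernel_params rho s d beta.
Hypothesis N1 : 1 <= N.
Hypothesis D0 : 0 <= D.
Hypothesis thD : forall K, \sum_(n <- zbox K) theta d n ^+ 2 <= D ^+ 2.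
Hypothesis gP : 1 / 2 < gamma < 1.
Hypothesis T0 : 0 <= T.
Hypothesis Cw0 : 0 < Cw.
Hypothesis PhiP : forall a r t, 0 <= r <= t -> t <= T ->
    normc (Phi w t r a) <= Cw * (t - r) `^ gamma * japanese a `^ (- rho).

Local Notation W := (iwt N s).

Definition l2driver (t r : R) : l2 W -> l2 W -> l2 W := bop (dphase (Phi w t r)).

Let P (t r : R) := Cw * (t - r) `^ gamma.

Let P0 t r : 0 <= P t r.
Proof. by rewrite /P mulr_ge0 ?powR_ge0// ltW. Qed.

Let phle t r : 0 <= r <= t -> t <= T -> phase_le rho (P t r) (dphase (Phi w t r)).
Proof. by move=> rt tT; apply: (dphase_le KP (P0 t r)) => x; exact: PhiP. Qed.

Let phre t r : 0 <= r -> phase_real (dphase (Phi w t r)).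
Proof. by move=> r0; apply: dphase_real => x; exact: Phi_conj. Qed.

Definition driver_const : R := bilin_const rho s D * Cw + 1.

Lemma l2driverE t r (f g : l2 W) : 0 <= r <= t -> t <= T ->
  l2v (l2driver t r f g) = driver w t r f g.
Proof.
move=> rt tT; have r0 : 0 <= r by case/andP: rt.
exact: (bopP KP N1 D0 thD f g (P0 t r) (phle rt tT) (phre t r0)).1.
Qed.

Lemma l2_young_driver : young_driver T driver_const gamma l2driver.
Proof.
have bc0 : 0 <= bilin_const rho s D by exact: bilin_const_ge0.
have c0 : 0 <= bilin_const rho s D * Cw by rewrite mulr_ge0// ltW.
split => //; first by rewrite /driver_const ltr_wpDl.
- move=> t r rt tT f g k; have r0 : 0 <= r by case/andP: rt.
  exact: (bopBl KP N1 D0 thD f g k (P0 t r) (phle rt tT) (phre t r0)).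
- move=> t r rt tT f g k; have r0 : 0 <= r by case/andP: rt.
  exact: (bopBr KP N1 D0 thD f g k (P0 t r) (phle rt tT) (phre t r0)).
- move=> t m r rm mt tT f g; case/andP: (rm) => r0 rm'.
  have m0 : 0 <= m by exact: le_trans rm'.
  (* [bop_phaseD] wants one bound [P] for the three phases; that of the whole interval serves for
     its parts. *)
  have mono t1 r1 : r <= r1 -> r1 <= t1 -> t1 <= t ->
      phase_le rho (P t r) (dphase (Phi w t1 r1)).
    move=> rr1 r1t1 t1t; have r10 : 0 <= r1 by exact: le_trans rr1.
    have rt1 : 0 <= r1 <= t1 by rewrite r10.
    move=> n k n0 k0 nk0; apply: le_trans (phle rt1 (le_trans t1t tT) n0 k0 nk0) _.
    apply: ler_wpM2r; first by rewrite !mulr_ge0 ?powR_ge0.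
    rewrite /P; apply: ler_wpM2l; first exact: ltW.
    apply: ge0_ler_powR; rewrite ?nnegrE ?subr_ge0//; last exact: lerB.
      by case/andP: gP => ? ?; lra.
    exact: le_trans mt.
  apply: (@bop_phaseD _ N rho s d beta D KP N1 D0 thD (P t r)) => //.
  + exact: mono.
  + exact: mono.
  + by apply: mono => //; exact: le_trans mt.
  + exact: phre.
  + exact: phre.
  + exact: phre.
  + by move=> n k; exact: Phi_chasles.
- move=> t r rt tT f g; have r0 : 0 <= r by case/andP: rt.
  apply: le_trans (bopP KP N1 D0 thD f g (P0 t r) (phle rt tT) (phre t r0)).2 _.
  apply: ler_wpM2r; first exact: mulr_ge0.
  rewrite /driver_const /P mulrA; apply: ler_wpM2r; first exact: powR_ge0.
  by rewrite lerDl.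
Qed.

Lemma l2_driver_energy :
  driver_energy T (energy_const rho s D * N `^ (- beta) * Cw) gamma l2driver l2ip.
Proof.
split.
- rewrite mulr_ge0 ?(ltW Cw0)// mulr_ge0 ?powR_ge0//; exact: energy_const_ge0.
- by move=> f g; rewrite !l2_normE l2norm_sqD.
- by move=> f g k; rewrite l2ipDr.
- by move=> f g; rewrite !l2_normE; exact: l2ip_le.
- move=> t r rt tT f g; have r0 : 0 <= r by case/andP: rt.
  have := ip_bop_diff_le KP N1 D0 thD (P0 t r) (fun x => Phi_conj wc x t r0) (fun x => PhiP x rt tT) f g.
  by rewrite /P mulrA.
Qed.

End L2Driver.

(** * Sobolev norms and admissible exponents *)

Lemma japanese_gt0 (R : realType) (a : R) : 0 < japanese a.
Proof. by rewrite /japanese sqrtr_gt0 ltr_pwDl// sqr_ge0. Qed.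

Lemma Hnorm_ge0 (R : realType) (s : R) (f : coeffs R) : (0 <= Hnorm s f)%E.
Proof. exact: poweR_ge0. Qed.

Lemma Hnorm_le (R : realType) (s B : R) (f : coeffs R) : 0 <= B ->
  (Hnorm s f <= B%:E)%E <->
  forall K, \sum_(n <- zbox K) (japanese (n%:~R : R) `^ s * normc (f n)) ^+ 2 <= B ^+ 2.
Proof.
move=> B0; rewrite -esum_le_zbox; last by move=> n; exact: sqr_ge0.
rewrite /Hnorm; under eq_esum => n _.
  rewrite (_ : _ * _ = (japanese (n%:~R : R) `^ s * normc (f n)) ^+ 2); last first.
    by rewrite exprMn (mulrC 2 s) powRrM powR_mulrn ?powR_ge0.
  over.
set E := (\esum_(n in _) _)%E.
have E0 : (0 <= E)%E by apply: esum_ge0 => n _; rewrite lee_fin sqr_ge0.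
rewrite poweR12_sqrt//; case: E E0 => [e|_|//]; last by rewrite /= !leye_eq.
rewrite !lee_fin => e0; split => [H|H].
  by rewrite -(sqr_sqrtr e0) lerXn2r// nnegrE ?sqrtr_ge0.
by rewrite -(ger0_norm B0) -sqrtr_sqr ler_wsqrtr.
Qed.

Lemma Hs_bound (R : realType) (s : R) (f : coeffs R) : Hs s f ->
  exists2 B : R, 0 <= B & (Hnorm s f <= B%:E)%E.
Proof.
move=> [_ fin]; exists (fine (Hnorm s f)); first exact/fine_ge0/Hnorm_ge0.
by rewrite fineK// ge0_fin_numE// Hnorm_ge0.
Qed.

Lemma le_Hnorm (R : realType) (s : R) (f g : coeffs R) :
  (forall n, normc (f n) <= normc (g n)) -> (Hnorm s f <= Hnorm s g)%E.
Proof.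
move=> fg; apply: gt0_ler_poweR; rewrite ?invr_ge0// ?in_itv/= ?andbT ?leey ?andbT.
- by apply: esum_ge0 => n _; rewrite lee_fin mulr_ge0 ?powR_ge0 ?sqr_ge0.
- by apply: esum_ge0 => n _; rewrite lee_fin mulr_ge0 ?powR_ge0 ?sqr_ge0.
apply: le_esum => n _; rewrite lee_fin; apply: ler_wpM2l; first exact: powR_ge0.
by rewrite lerXn2r// nnegrE normc_ge0.
Qed.

Lemma eq_Hnorm (R : realType) (s : R) (f g : coeffs R) :
  (forall n, normc (f n) = normc (g n)) -> Hnorm s f = Hnorm s g.
Proof.
by move=> fg; apply/eqP; rewrite eq_le; apply/andP; split; apply: le_Hnorm => n; rewrite fg.
Qed.

(** The two constants are kept apart because [c] alone decides the size of the data in the new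
    norm. *)
Record sobolev_weight (R : realType) (s c C : R) (W : int -> {posnum R}) : Prop :=
  SobolevWeight {
    sobolev_c_gt0 : 0 < c;
    sobolev_C_gt0 : 0 < C;
    sobolev_lower : forall n, c * (W n)%:num <= japanese (n%:~R : R) `^ s;
    sobolev_upper : forall n, japanese (n%:~R : R) `^ s <= C * (W n)%:num }.

Section SobolevL2.
Context {R : realType} (s c C : R) (W : int -> {posnum R}).
Hypothesis SW : sobolev_weight s c C W.
Implicit Types f g : l2 W.

Lemma Hnorm_l2_le f : (Hnorm s f <= (C * `|f|)%:E)%E.
Proof.
have C0 := sobolev_C_gt0 SW.
have B0 : 0 <= C * `|f| by rewrite mulr_ge0 ?(ltW C0).
apply/(Hnorm_le _ _ B0) => K.
rewrite exprMn; apply: (@le_trans _ _ (C ^+ 2 * \sum_(n <- zbox K) ((W n)%:num * normc (f n)) ^+ 2)).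
  rewrite mulr_sumr; apply: ler_sum => n _; rewrite -exprMn.
  rewrite lerXn2r ?nnegrE ?mulr_ge0 ?powR_ge0 ?normc_ge0 ?(ltW C0)//.
  rewrite mulrA; apply: ler_wpM2r; [exact: normc_ge0|exact: sobolev_upper SW n].
by apply: ler_wpM2l; [exact: sqr_ge0|exact: l2_partial_le].
Qed.

Lemma l2_Hs f : Hs s f.
Proof.
split; first exact: l2_real.
exact: le_lt_trans (Hnorm_l2_le f) (ltry _).
Qed.

Lemma Hs_l2_le (f : coeffs R) (B : R) : real_valued f -> 0 <= B -> (Hnorm s f <= B%:E)%E ->
  exists2 g : l2 W, l2v g = f & `|g| <= B / c.
Proof.
move=> fr B0 /(Hnorm_le _ _ B0) fB; have c0 := sobolev_c_gt0 SW.
apply: l2_of => //; first by rewrite divr_ge0// ltW.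
move=> K; rewrite expr_div_n ler_pdivlMr ?exprn_gt0// mulrC.
apply: le_trans (fB K); rewrite mulr_sumr; apply: ler_sum => n _.
rewrite -exprMn lerXn2r ?nnegrE ?mulr_ge0 ?powR_ge0 ?normc_ge0 ?(ltW c0)//.
rewrite mulrA; apply: ler_wpM2r; [exact: normc_ge0|exact: sobolev_lower SW n].
Qed.

Lemma Hs_l2 (f : coeffs R) : Hs s f -> exists g : l2 W, l2v g = f.
Proof.
move=> fH; have [B B0 fB] := Hs_bound fH.
by have [g gE _] := Hs_l2_le fH.1 B0 fB; exists g.
Qed.

Lemma l2_le_Hnorm f (B : R) : 0 <= B -> (Hnorm s f <= B%:E)%E -> `|f| <= B / c.
Proof.
move=> B0 fB; have [g gE] := Hs_l2_le (@l2_real _ _ f) B0 fB.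
by rewrite (val_inj gE).
Qed.

End SobolevL2.

Lemma japanese_cutoff (R : realType) (N : R) (n : int) : 1 <= N ->
  cutoff N (iabs n) <= japanese (n%:~R : R) /\ japanese (n%:~R : R) <= 2 * N * cutoff N (iabs n).
Proof.
move=> N1; have N0 : 0 < N by lra.
have a0 := @iabs_ge0 R n.
have E : japanese (n%:~R : R) = Num.sqrt (1 + iabs n ^+ 2).
  by rewrite /japanese /iabs natr_absz intr_norm real_normK// num_real.
have c1 := cutoff_ge1 N (iabs n).
rewrite E; split.
  rewrite /cutoff ge_max; apply/andP; split.
    by rewrite -[leLHS]sqrtr1 ler_wsqrtr// lerDl sqr_ge0.
  apply: (@le_trans _ _ (iabs n)); first by rewrite ler_pdivrMr// ler_peMr.
  by rewrite -[leLHS](ger0_norm a0) -sqrtr_sqr ler_wsqrtr// lerDr.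
apply: (@le_trans _ _ (1 + iabs n)).
  rewrite -[leRHS]ger0_norm ?addr_ge0// -sqrtr_sqr ler_wsqrtr//.
  by rewrite sqrrD expr1n lerD2r lerDl mulrn_wge0// mul1r.
have : iabs n <= N * cutoff N (iabs n).
  by rewrite mulrC -ler_pdivrMr// /cutoff le_max lexx orbT.
have : 1 * 1 <= N * cutoff N (iabs n) by apply: ler_pM.
set x := N * _; rewrite -mulrA -/x; lra.
Qed.

(** [cutoff] and [japanese] differ by at most the factor [2 * N]. The sign of [s] decides which
    inequality loses a power of [N]; for negative [s] it is the lower one, which enlarges the
    data. *)
Lemma sobolev_iwt (R : realType) (N s : R) : 1 <= N ->
  sobolev_weight s ((2 * N) `^ Num.max 0 (- s))^-1 ((2 * N) `^ Num.max 0 s) (iwt N s).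
Proof.
move=> N1; have N20 : 0 < 2 * N by lra.
split; rewrite ?invr_gt0 ?powR_gt0// => n; have [cj jc] := japanese_cutoff n N1.
  have j0 := japanese_gt0 (n%:~R : R).
  have c0 := cutoff_gt0 N (iabs n).
  rewrite mulrC ler_pdivrMr ?powR_gt0//= /mwt.
  have [s0|s0] := leP 0 (- s).
    have H : japanese (n%:~R : R) `^ (- s) <= (2 * N * cutoff N (iabs n)) `^ (- s).
      by apply: ge0_ler_powR; rewrite // ?nnegrE ?(ltW j0) ?(le_trans (ltW j0) jc).
    move: H; rewrite powRM ?(ltW N20) ?(ltW c0)// [X in X <= _]powRN.
    rewrite [X in _ <= _ * X]powRN ler_pdivlMr ?powR_gt0// => H.
    have jp : 0 < japanese (n%:~R : R) `^ s by rewrite powR_gt0.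
    by move: H; rewrite mulrC ler_pdivrMr// mulrC.
  rewrite powRr0 mulr1; apply: ge0_ler_powR; rewrite ?nnegrE ?(ltW j0) ?(ltW c0)//.
  by move: s0; clear; lra.
have j0 := japanese_gt0 (n%:~R : R).
have c0 := cutoff_gt0 N (iabs n); rewrite /= /mwt.
have [s0|s0] := leP 0 s.
  rewrite -powRM ?(ltW N20) ?(ltW c0)//.
  by apply: ge0_ler_powR; rewrite // ?nnegrE ?(ltW j0) ?(le_trans (ltW j0) jc).
rewrite powRr0 mul1r -[s]opprK [X in X <= _]powRN [X in _ <= X]powRN lef_pV2 ?posrE ?powR_gt0//.
apply: ge0_ler_powR; rewrite ?nnegrE ?(ltW j0) ?(ltW c0)//.
by move: s0; clear; lra.
Qed.

(* The threshold (iii.b) of the paper is not sharp for this argument: since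
   rho >= 3/2 there, s >= - rho already implies the last inequality. *)
Definition subcritical (R : realType) (rho gamma s : R) : Prop :=
  [/\ 1 / 2 < rho, - rho <= s & (3 / 2 - 3 * rho) * gamma < s].

Lemma subcritical_large_rho (R : realType) (rho gamma s : R) :
  1 / 2 < gamma -> 3 / 2 <= rho -> - rho <= s -> subcritical rho gamma s.
Proof.
move=> g2 r2 sr; split => //; first by lra.
apply: lt_le_trans sr; have : 0 <= (rho - 3 / 2) * (gamma - 1 / 2) by apply: mulr_ge0; lra.
lra.
Qed.

Lemma admissible_subcritical (R : realType) (rho gamma s : R) :
  1 / 2 < rho -> 1 / 2 < gamma < 1 ->
  [/\ 1 / 2 < rho, rho <= 3 * gamma / (6 * gamma - 2)
    & s > (3 / 2 - 3 * rho) * gamma] \/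
  [/\ 3 * gamma / (6 * gamma - 2) < rho, rho <= 3 / 2 & s >= - rho] \/
  (1 / 2 < gamma < (Num.sqrt 5 - 1) / 2 /\
    ([/\ 3 / 2 <= rho,
         rho < 3 * (1 - gamma) ^+ 2 / (2 * (- gamma ^+ 2 - gamma + 1))
       & s >= - rho] \/
     (rho >= 3 * (1 - gamma) ^+ 2 / (2 * (- gamma ^+ 2 - gamma + 1)) /\
      s > - ((4 * rho * (2 * gamma - 1) + 3 * (1 - gamma) ^+ 2)
             / (2 * (- gamma ^+ 2 + 3 * gamma - 1)))))) \/
  [/\ (Num.sqrt 5 - 1) / 2 <= gamma < 1, rho >= 3 / 2 & s >= - rho] ->
  subcritical rho gamma s.
Proof.
move=> r2 /andP[g2 g1]; have g6 : 0 < 6 * gamma - 2 by lra.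
case=> [[_ rle sgt]|[[rgt _ sge]|[[/andP[_ g5]]|[_ r3 sge]]]].
- split => //; apply/ltW; apply: le_lt_trans sgt.
  by move: rle; rewrite ler_pdivlMr//; lra.
- split => //; apply: lt_le_trans sge.
  by move: rgt; rewrite ltr_pdivrMr//; lra.
- case=> [[r3 _ sge]|[rge sgt]]; first exact: subcritical_large_rho.
  (* The bound on [gamma] by [(sqrt 5 - 1) / 2] is [(2 gamma + 1) ^ 2 < 5], that is, positivity of
     this polynomial. *)
  have p1 : 0 < - gamma ^+ 2 - gamma + 1.
    have : (gamma * 2 + 1) ^+ 2 < 5.
      rewrite -[ltRHS](@sqr_sqrtr R 5)// ltrXn2r ?nnegrE ?sqrtr_ge0//; first by lra.
      by rewrite -ltrBrDr -ltr_pdivlMr.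
    by rewrite sqrrD; lra.
  have p2 : 0 < - gamma ^+ 2 + 3 * gamma - 1.
    have : 0 < (gamma - 1 / 2) * (1 - gamma) by rewrite mulr_gt0; lra.
    by lra.
  have {}rge : 3 * (1 - gamma) ^+ 2 <= rho * (2 * (- gamma ^+ 2 - gamma + 1)).
    by rewrite -ler_pdivrMr// mulr_gt0.
  apply: subcritical_large_rho => //.
    have : 3 / 2 * (2 * (- gamma ^+ 2 - gamma + 1)) <= rho * (2 * (- gamma ^+ 2 - gamma + 1)).
      apply: le_trans rge; have : 0 <= gamma * (gamma - 1 / 2) by apply: mulr_ge0; lra.
      by lra.
    by rewrite ler_pM2r// mulr_gt0.
  (* With the denominator cleared, the inequality between [- rho] and the threshold is [rge]
     itself. *)
  apply/ltW; apply: le_lt_trans sgt; rewrite lerN2 ler_pdivrMr ?mulr_gt0//.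
  by lra.
- exact: subcritical_large_rho.
Qed.

Lemma subcritical_kernel_params (R : realType) (rho gamma s : R) :
  1 / 2 < gamma < 1 -> subcritical rho gamma s ->
  exists d beta, [/\ kernel_params rho s d beta, 0 < beta & - s < gamma * beta].
Proof.
move=> /andP[g2 g1] [r2 sr sc].
pose p := 3 * rho - 3 / 2.
have p0 : 0 < p by rewrite /p; lra.
have pg : 0 < s + p * gamma by move: sc; rewrite /p; lra.
have pg1 : p * gamma < p by rewrite -[ltRHS]mulr1 ltr_pM2l.
(* Half of the room in [0 < p] and in [- s < p * gamma]. Then [- s < gamma * (p - d)] because
   [gamma * d < d], and [- s <= rho < gamma * (2 * rho)] because [gamma > 1 / 2]. *)
pose d := Num.min (p / 2) ((s + p * gamma) / 2).
have d0 : 0 < d by rewrite lt_min !divr_gt0.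
have d1 : d <= p / 2 by rewrite ge_min lexx.
have d2 : d <= (s + p * gamma) / 2 by rewrite ge_min lexx orbT.
have dg : gamma * d < d by rewrite -[ltRHS]mul1r ltr_pM2r.
have rg : 0 < rho * (2 * gamma - 1) by rewrite mulr_gt0; lra.
exists d, (Num.min (2 * rho) (p - d)); split.
- split => //.
  + by rewrite /p in pg pg1 d2; lra.
  + by rewrite /p in p0 d1; lra.
  + by rewrite le_min; apply/andP; split; lra.
  + by rewrite ge_min lexx.
  + by rewrite ge_min /p lexx orbT.
- by rewrite lt_min; apply/andP; split; lra.
- by have [_|_] := leP (2 * rho) (p - d); lra.
Qed.

(** [tau] saturates the sewing condition: [A * M * tau ^ gamma = 1]. As [M] is proportional to
    [N ^ a], [tau] is proportional to [N ^ (- a / gamma)], and the energy condition asks that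
    [N ^ (- b)] be small for [b = beta - a / gamma], which is positive. *)
Lemma young_params_exist (R : realType) (T C kappa gamma beta a B : R) :
  0 < T -> 0 < C -> 0 <= kappa -> 1 / 2 < gamma -> 0 <= a -> a < gamma * beta ->
  exists N M tau, [/\ 1 <= N, (2 * N) `^ a * B <= M
    & young_params T C (kappa * N `^ (- beta)) gamma M tau].
Proof.
move=> T0 C0 k0 g2 a0 ab; have g0 : 0 < gamma by lra.
have sew0 : 0 < sew_const (2 * gamma) by apply: lt_le_trans ltr01 (sew_const_ge1 _); lra.
pose A := 32 * sew_const (2 * gamma) * C.
have A0 : 0 < A by rewrite /A !mulr_gt0.
have AE : A = 32 * sew_const (2 * gamma) * C by [].
clearbody A.
(* The second entry ensures [tau <= T]. *)
pose B' := Num.max B (T `^ (- gamma) / A).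
have Tg0 : 0 < T `^ (- gamma) by exact: powR_gt0.
have B0 : 0 < B' by rewrite lt_max divr_gt0 ?orbT.
pose G := 240 * T * kappa / A.
have G0 : 0 <= G by apply: divr_ge0; [apply: mulr_ge0; [apply: mulr_ge0; [exact: ler0n|exact: ltW]|]|exact: ltW].
pose P := (A * (2 `^ a * B')) `^ gamma^-1.
have AB0 : 0 < A * (2 `^ a * B') by rewrite !mulr_gt0// powR_gt0.
have P0 : 0 < P by exact: powR_gt0.
pose b := beta - a / gamma.
have b0 : 0 < b by rewrite subr_gt0 ltr_pdivrMr// mulrC.
have e0 : 0 < (G * P + 1)^-1 by rewrite invr_gt0 ltr_wpDl// mulr_ge0// ltW.
have [eta eta0 etaP] := powR_small b0 e0.
pose N := Num.max 1 eta^-1.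
have N1 : 1 <= N by rewrite le_max lexx.
have N0 : 0 < N by lra.
pose M := (2 * N) `^ a * B'.
have N2a : 1 <= (2 * N) `^ a.
  by rewrite -[leLHS](powRr0 (2 * N)); apply: ler_powR => //; lra.
have M0 : 0 < M by rewrite mulr_gt0//; lra.
have AM0 : 0 < A * M by rewrite mulr_gt0.
exists N, M, ((A * M) `^ (- gamma^-1)).
have taug : ((A * M) `^ (- gamma^-1)) `^ gamma = (A * M)^-1.
  by rewrite -powRrM mulNr mulVf ?gt_eqF// -powR_inv1// ltW.
split; first exact: N1.
  by apply: ler_wpM2l; [exact: powR_ge0|rewrite le_max lexx].
have tau0 : 0 < (A * M) `^ (- gamma^-1) by exact: powR_gt0.
have TG : T `^ (- gamma) <= A * M.
  rewrite mulrC -ler_pdivrMr// /M; apply: (@le_trans _ _ B'); last by rewrite ler_peMl// ltW.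
  by rewrite le_max lexx orbT.
split; [exact: T0|exact: M0|exact: tau0| | |].
- have : (A * M) `^ (- gamma^-1) <= (T `^ (- gamma)) `^ (- gamma^-1).
    have H : (T `^ (- gamma)) `^ gamma^-1 <= (A * M) `^ gamma^-1.
      by apply: ge0_ler_powR; rewrite ?nnegrE ?invr_ge0 ?(ltW g0) ?(ltW Tg0) ?(ltW AM0).
    have Tgg0 : 0 < (T `^ (- gamma)) `^ gamma^-1 by exact: powR_gt0.
    have AMg0 : 0 < (A * M) `^ gamma^-1 by exact: powR_gt0.
    by rewrite !(powRN _ gamma^-1) lef_pV2 ?posrE.
  by rewrite -powRrM mulrNN mulfV ?gt_eqF// powRr1// ltW.
- rewrite taug AE; have -> : sew_const (2 * gamma) * C * M / (32 * sew_const (2 * gamma) * C * M) = 1 / 32.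
    by field; rewrite !gt_eqF.
  exact: lexx.
rewrite -mulrA taug.
have -> : 240 * T * (kappa * N `^ (- beta)) * (M / (A * M)) = G * N `^ (- beta).
  by rewrite /G; field; rewrite !gt_eqF.
have -> : A * M = A * (2 `^ a * B') * N `^ a.
  by rewrite /M powRM ?(ltW N0)//; ring.
rewrite powRM ?(ltW AB0) ?powR_ge0// (powRN _ gamma^-1) -/P -powRrM mulrN.
rewrite (ler_pdivlMl _ _ P0).
have h : N^-1 `^ b <= (G * P + 1)^-1.
  rewrite etaP// invr_ge0 (ltW N0)/=.
  by rewrite -[leRHS]invrK lef_pV2 ?posrE ?invr_gt0// le_max lexx orbT.
have -> : N `^ (- beta) = N `^ (- (a / gamma)) * N^-1 `^ b.
  rewrite -(@powR_inv1 _ N) ?(ltW N0)// -powRrM -powRD; last by rewrite (gt_eqF N0) implybT.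
  by congr (_ `^ _); rewrite /b; ring.
have Na0 : 0 < N `^ (- (a / gamma)) by exact: powR_gt0.
have -> : P * (G * (N `^ (- (a / gamma)) * N^-1 `^ b)) = N `^ (- (a / gamma)) * (G * P * N^-1 `^ b).
  by ring.
rewrite ler_piMr ?(ltW Na0)//.
have GP0 : 0 <= G * P := mulr_ge0 G0 (ltW P0).
apply: (le_trans (ler_wpM2l GP0 h)).
by rewrite ler_pdivrMr ?ltr_wpDl// mul1r lerDl.
Qed.

(** * Solutions as paths with a superlinear remainder *)

Lemma l2v_sum (R : realType) (W : int -> {posnum R}) (I : Type) (r : seq I) (F : I -> l2 W) :
  l2v (\sum_(i <- r) F i) = \sum_(i <- r) l2v (F i).
Proof. exact: (big_morph (@l2v R W) (fun _ _ => erefl) erefl). Qed.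

Lemma partition_mono (R : realType) (t : R) (m : nat) (tau : nat -> R) :
  partition_of t m tau -> forall i j, (i <= j <= m)%N -> tau j <= tau i.
Proof.
move=> [_ _ dec] i j /andP[ij]; elim: j ij => [|j IH]; first by rewrite leqn0 => /eqP ->.
rewrite leq_eqVlt => /orP[/eqP -> //|ij jm].
exact: le_trans (ltW (dec _ jm)) (IH ij (ltnW jm)).
Qed.

Lemma grid_exists0 (R : realType) (t eta : R) : 0 <= t -> 0 < eta ->
  exists n h, 0 < h <= eta /\ n%:R * h = t.
Proof.
move=> t0 eta0; have [->|tn0] := eqVneq t 0; last by apply: grid_exists; rewrite // lt0r tn0.
by exists 0%N, eta; rewrite eta0 lexx mul0r.
Qed.

Section YoungIntegral.
Context {R : realType}.
Variables (w : R -> R) (gamma s T c C A : R) (W : int -> {posnum R}).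
Variable X : R -> R -> l2 W -> l2 W -> l2 W.
Hypothesis SW : sobolev_weight s c C W.
Hypothesis XP : young_driver T A gamma X.
Hypothesis XE : forall t r f g, 0 <= r <= t -> t <= T ->
  l2v (X t r f g) = driver w t r f g.
Variables (x : R -> l2 W) (u : R -> coeffs R).
Hypothesis ux : forall t, 0 <= t <= T -> u t = l2v (x t).

Lemma davie_holder (z B : R) : gamma <= z -> davie T X z x ->
  (forall t, 0 <= t <= T -> `|x t| <= B) ->
  exists2 H : R, 0 <= H & forall t r, 0 <= r <= t -> t <= T ->
    `|x t - x r| <= H * (t - r) `^ gamma.
Proof.
move=> gz [K K0 xP] xB; have g2 : 1 / 2 < gamma by case/andP: (driver_gamma XP).
have T0 := driver_T_ge0 XP; have A0 := driver_C_gt0 XP.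
exists (K * T `^ (z - gamma) + A * B ^+ 2).
  by rewrite addr_ge0// mulr_ge0 ?powR_ge0 ?sqr_ge0// ltW.
move=> t r rt tT; have /andP[r0 rt'] := rt.
have xr : `|x r| <= B by apply: xB; rewrite r0 (le_trans rt').
have -> : x t - x r = (x t - x r - X t r (x r) (x r)) + X t r (x r) (x r) by rewrite subrK.
apply: le_trans (ler_normD _ _) _; rewrite mulrDl; apply: lerD.
  apply: le_trans (xP _ _ rt tT) _; rewrite -mulrA; apply: ler_wpM2l => //.
  apply: (@le_trans _ _ ((t - r) `^ (z - gamma) * (t - r) `^ gamma)).
    by rewrite -powRD subrK// gt_eqF//; lra.
  apply: ler_wpM2r; first exact: powR_ge0.
  apply: ge0_ler_powR; rewrite ?nnegrE ?subr_ge0//; lra.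
apply: le_trans (driver_le XP rt tT _ _) _.
rewrite mulrAC; apply: ler_wpM2r; first exact: powR_ge0.
by apply: ler_wpM2l; [exact: ltW|rewrite expr2; apply: ler_pM].
Qed.

(** Telescoping over the partition: each remainder is at most [K * eta ^ (z - 1)] times the length
    of its interval, and the lengths add up to [t]. *)
Lemma partition_remainder_le (K z eta t : R) (m : nat) (tau : nat -> R) :
  0 <= K -> 1 <= z -> t <= T ->
  (forall t' r, 0 <= r <= t' -> t' <= T ->
    `|x t' - x r - X t' r (x r) (x r)| <= K * (t' - r) `^ z) ->
  partition_of t m tau -> (forall j, (j < m)%N -> tau j - tau j.+1 <= eta) ->
  `|x t - x 0 - \sum_(j < m) X (tau j) (tau j.+1) (x (tau j.+1)) (x (tau j.+1))|
    <= K * eta `^ (z - 1) * t.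
Proof.
move=> K0 z1 tT xP ptau mesh; have mono := partition_mono ptau.
have [tau0 taum dec] := ptau.
have in0T j : (j <= m)%N -> 0 <= tau j <= T.
  move=> jm; rewrite -{1}taum mono ?jm//=; apply: le_trans tT.
  by rewrite -tau0; apply: mono.
have tel (V : zmodType) (y : R -> V) : y t - y 0 = \sum_(j < m) (y (tau j) - y (tau j.+1)).
  rewrite -tau0 -taum -(big_mkord xpredT (fun j => y (tau j) - y (tau j.+1))).
  elim: (m) => [|k IH]; first by rewrite big_geq// subrr.
  by rewrite big_nat_recr//= -IH; zmod.
rewrite tel -sumrB; apply: le_trans (ler_norm_sum _ _ _) _.
rewrite -[t in leRHS]subr0 (tel _ id) mulr_sumr; apply: ler_sum => j _ /=.
have jm := ltn_ord j; have /andP[t1 _] := in0T _ jm; have /andP[_ t2] := in0T _ (ltnW jm).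
have d0 := ltW (dec _ jm).
have e0 : 0 <= tau j - tau j.+1 by rewrite subr_ge0.
apply: le_trans (xP _ _ _ t2) _; first by rewrite t1.
rewrite -mulrA; apply: ler_wpM2l => //.
rewrite -mulr_powRB1//; last by lra.
rewrite mulrC; apply: ler_wpM2r => //.
apply: ge0_ler_powR; rewrite ?nnegrE ?subr_ge0//; first exact: le_trans (mesh _ jm).
exact: mesh.
Qed.

Lemma young_sum_l2 (t : R) (m : nat) (tau : nat -> R) : t <= T -> partition_of t m tau ->
  young_sum w u m tau =
  l2v (\sum_(j < m) X (tau j) (tau j.+1) (x (tau j.+1)) (x (tau j.+1))).
Proof.
move=> tT ptau; have mono := partition_mono ptau; have [tau0 taum dec] := ptau.
rewrite l2v_sum; apply: eq_bigr => j _; have jm := ltn_ord j.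
have t1 : 0 <= tau j.+1 <= tau j by rewrite -taum !mono// ?leqnSn ?leqnn ?jm ?(ltnW jm).
have t2 : tau j <= T by apply: le_trans tT; rewrite -tau0 mono// (ltnW jm).
by rewrite XE// ux// (le_trans _ t2) ?andbT; case/andP: t1.
Qed.

Lemma davie_young_integral (z t : R) : 1 < z -> davie T X z x -> 0 <= t <= T ->
  is_young_integral w s u t (l2v (x t - x 0)).
Proof.
move=> z1 [K K0 xP] /andP[t0 tT]; split; first exact: (l2_Hs SW).
have C0 := sobolev_C_gt0 SW; have T0 := driver_T_ge0 XP.
move=> eps eps0; have z10 : 0 < z - 1 by lra.
have D0 : 0 < C * (K * T + 1) by rewrite mulr_gt0// ltr_wpDl// mulr_ge0.
have e0 : 0 < eps / 2 / (C * (K * T + 1)) by rewrite !divr_gt0.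
have [eta eta0 etaP] := powR_small z10 e0.
exists eta => // m tau ptau mesh.
rewrite (young_sum_l2 tT ptau).
have := partition_remainder_le K0 (ltW z1) tT xP ptau (fun j jm => ltW (mesh j jm)).
set S := \sum_(j < m) _ => H.
rewrite -[l2v S - _]/(l2v (S - (x t - x 0))).
apply: le_lt_trans (Hnorm_l2_le SW _) _; rewrite lte_fin distrC.
apply: (@le_lt_trans _ _ (eps / 2)); last by rewrite ltr_pdivrMr// ltr_pMr// ltr1n.
have E : eta `^ (z - 1) <= eps / 2 / (C * (K * T + 1)) by rewrite etaP// (ltW eta0) lexx.
apply: (le_trans (ler_wpM2l (ltW C0) H)).
apply: (@le_trans _ _ (eta `^ (z - 1) * (C * (K * T + 1)))); last by rewrite -ler_pdivlMr.
have -> : C * (K * eta `^ (z - 1) * t) = eta `^ (z - 1) * (C * (K * t)) by ring.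
apply: ler_wpM2l; first exact: powR_ge0.
apply: ler_wpM2l; first exact: ltW.
by apply: (@le_trans _ _ (K * T)); [exact: ler_wpM2l|rewrite lerDl].
Qed.

End YoungIntegral.

Section YoungIntegralDavie.
Context {R : realType}.
Variables (w : R -> R) (gamma s T c C A : R) (W : int -> {posnum R}).
Variable X : R -> R -> l2 W -> l2 W -> l2 W.
Hypothesis SW : sobolev_weight s c C W.
Hypothesis XP : young_driver T A gamma X.
Hypothesis XE : forall t r f g, 0 <= r <= t -> t <= T ->
  l2v (X t r f g) = driver w t r f g.
Variables (x : R -> l2 W) (u : R -> coeffs R).
Hypothesis ux : forall t, 0 <= t <= T -> u t = l2v (x t).

Definition grid_sum (a h : R) (i j : nat) : l2 W :=
  \sum_(i <= l < j) X (a + l.+1%:R * h) (a + l%:R * h) (x (a + l%:R * h)) (x (a + l%:R * h)).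

(** Sewing for the Riemann sums of a given Hölder path: the defect of additivity is of order
    [alpha + gamma], and a single step carries no error. *)
Lemma grid_sum_near (alpha H B a h : R) (n : nat) :
  0 <= H -> 0 <= alpha -> 1 < alpha + gamma -> 0 <= a -> 0 <= h -> a + n%:R * h <= T ->
  (forall t, 0 <= t <= T -> `|x t| <= B) ->
  (forall t r, 0 <= r <= t -> t <= T -> `|x t - x r| <= H * (t - r) `^ alpha) ->
  (0 < n)%N ->
  `|grid_sum a h 0 n - X (a + n%:R * h) a (x a) (x a)|
    <= sew_const (alpha + gamma) * (2 * A * B * H) * (n%:R * h) `^ (alpha + gamma).
Proof.
move=> H0 al0 z1 a0 h0 nT xB xH n0.
have A0 := driver_C_gt0 XP; have g2 : 1 / 2 < gamma by case/andP: (driver_gamma XP).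
have g0 : 0 <= gamma by lra.
have z0 : 0 < alpha + gamma by lra.
have aT : 0 <= a <= T.
  by rewrite a0/=; apply: le_trans nT; rewrite lerDl mulr_ge0.
have B0 : 0 <= B by apply: le_trans (xB a aT).
pose p i := a + i%:R * h.
pose r i j := `|grid_sum a h i j - X (p j) (p i) (x (p i)) (x (p i))|.
have L0 : 0 <= 2 * A * B * H by rewrite !mulr_ge0// ltW.
have r1 i : (i < n)%N -> r i i.+1 <= 0 * h.
  by move=> _; rewrite /r /grid_sum big_nat1 subrr normr0 mul0r.
have rs i k l : (0 < k)%N -> (0 < l)%N -> (k + l <= n)%N -> (i + (k + l) <= n)%N ->
    r i (i + (k + l))%N <= r i (i + k)%N + r (i + k)%N (i + k + l)%N
      + 2 * A * B * H * ((k + l)%:R * h) `^ (alpha + gamma).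
  move=> k0 l0 kln ikl.
  have ik : (i <= i + k <= n)%N by rewrite leq_addr (leq_trans _ ikl) ?leq_add2l ?leq_addr.
  have kl : (i + k <= i + (k + l) <= n)%N by rewrite ikl andbT leq_add2l leq_addr.
  have [g1 g1T] := grid_le a0 h0 nT ik; have [g3 g3T] := grid_le a0 h0 nT kl.
  have /andP[g10 g11] := g1; have /andP[g30 g31] := g3.
  rewrite /r -(addnA i k l) -/(p (i + k)%N).
  rewrite (driver_chasles XP g1 g31 g3T).
  rewrite {1}/grid_sum (big_cat_nat (n := (i + k)%N)) ?leq_add2l ?leq_addr//=.
  rewrite -![\sum_(_ <= _ < _) _]/(grid_sum a h _ _).
  set S1 := grid_sum _ _ _ _; set S2 := grid_sum _ _ _ _.
  set Xa := X _ _ _ _; set Xb := X _ _ _ _; set Xc := X _ _ (x (p (i + k)%N)) _.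
  have -> : S1 + S2 - (Xa + Xb) = (S1 - Xb) + (S2 - Xc) + (Xc - Xa) by zmod.
  apply: le_trans (ler_normD _ _) _; apply: lerD; first exact: ler_normD.
  have := driver_quadB XP g3 g3T (x (p (i + k)%N)) (x (p i)).
  rewrite -/Xc -/Xa => H1; apply: (le_trans H1).
  have pk : p (i + k)%N - p i = k%:R * h by rewrite /p gridB.
  have pl : p (i + (k + l))%N - p (i + k)%N = l%:R * h by rewrite /p addnA gridB.
  have dx := xH _ _ g1 (le_trans g31 g3T).
  rewrite -/(p _) -/(p (i + k)%N) pk in dx; rewrite -/(p (i + k)%N) -/(p (i + (k + l))%N) pl.
  have bx : `|x (p (i + k)%N)| + `|x (p i)| <= 2 * B.
    rewrite mulr_natl; apply: lerD; apply: xB.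
      by rewrite g30 (le_trans g31).
    by rewrite g10 (le_trans g11)// (le_trans g31).
  have kh : k%:R * h <= (k + l)%:R * h by apply: ler_wpM2r => //; rewrite ler_nat leq_addr.
  have lh : l%:R * h <= (k + l)%:R * h by apply: ler_wpM2r => //; rewrite ler_nat leq_addl.
  have k0h : 0 <= k%:R * h by rewrite mulr_ge0.
  have l0h : 0 <= l%:R * h by rewrite mulr_ge0.
  have kl0h : 0 <= (k + l)%:R * h by rewrite mulr_ge0.
  have pa : (k%:R * h) `^ alpha <= ((k + l)%:R * h) `^ alpha.
    by apply: ge0_ler_powR; rewrite ?nnegrE.
  have pg : (l%:R * h) `^ gamma <= ((k + l)%:R * h) `^ gamma.
    by apply: ge0_ler_powR; rewrite ?nnegrE//; exact: g0.
  rewrite [in leRHS]powRD; last by rewrite (gt_eqF z0).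
  set y := ((k + l)%:R * h) `^ alpha in pa *; set z := ((k + l)%:R * h) `^ gamma in pg *.
  have -> : 2 * A * B * H * (y * z) = A * z * (H * y * (2 * B)) by ring.
  apply: ler_pM; [by apply: mulr_ge0; [exact: ltW|exact: powR_ge0]|by apply: mulr_ge0; [exact: normr_ge0|apply: addr_ge0; exact: normr_ge0]| |].
    by apply: ler_wpM2l => //; exact: ltW.
  apply: ler_pM; [exact: normr_ge0|by apply: addr_ge0; exact: normr_ge0| |exact: bx].
  by apply: (le_trans dx); apply: ler_wpM2l.
have nn : (0 < n <= n)%N by rewrite n0 leqnn.
have := sewing_grid h0 (lexx 0) L0 z1 r1 rs (i := 0%N) nn (leqnn n).
by rewrite /r /p ?add0n ?mulr0n ?mul0r ?mulr0 ?addr0.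
Qed.

(** The same limit in the [l2] norm and along increasing grids, which reverse the order of
    [partition_of]. Here the mesh may equal its bound, hence [eta / 2]. *)
Lemma young_integral_near (t eps : R) : 0 <= t <= T ->
  is_young_integral w s u t (l2v (x t - x 0)) -> 0 < eps ->
  exists2 eta : R, 0 < eta & forall (n : nat) (g : nat -> R),
    g 0%N = 0 -> g n = t -> (forall i, (i < n)%N -> 0 < g i.+1 - g i <= eta) ->
    `|\sum_(i < n) X (g i.+1) (g i) (x (g i)) (x (g i)) - (x t - x 0)| <= eps.
Proof.
move=> /andP[t0 tT] [_ lim] eps0; have c0 := sobolev_c_gt0 SW.
have [eta eta0 etaP] := lim (eps * c) (mulr_gt0 eps0 c0).
have eta20 : 0 < eta / 2 by rewrite divr_gt0.
exists (eta / 2) => // n g g0 gn gP.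
pose tau j := g (n - j)%N.
have tauS j : (j < n)%N -> 0 < tau j - tau j.+1 <= eta / 2.
  by move=> jn; rewrite /tau -(subnSK jn); apply: gP; rewrite ltn_subrL (leq_trans _ jn).
have ptau : partition_of t n tau.
  split; rewrite /tau ?subn0 ?subnn//.
  by move=> j /tauS /andP[]; rewrite subr_gt0.
have := etaP n tau ptau _; rewrite (young_sum_l2 XE ux tT ptau).
set S := \sum_(j < n) _; rewrite -[l2v S - _]/(l2v (S - (x t - x 0))) => H.
have SE : S = \sum_(i < n) X (g i.+1) (g i) (x (g i)) (x (g i)).
  rewrite /S (reindex_inj rev_ord_inj) /=; apply: eq_bigr => i _.
  have im := ltn_ord i; rewrite /tau; have -> : (n - (n - i.+1).+1 = i)%N by lia.
  by rewrite subKn.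
rewrite -SE -[leRHS](mulfK (lt0r_neq0 c0)).
apply: (l2_le_Hnorm SW); first by rewrite mulr_ge0// ltW.
apply/ltW/H => j /tauS /andP[_ h]; apply: le_lt_trans h _.
by rewrite ltr_pdivrMr// ltr_pMr// ltr1n.
Qed.

(** The increment of [x] over [[r, t]] is the difference of the integrals over [[0, t]] and
    [[0, r]]. Both are approximated along one grid through [r], so that the sums over [[0, r]]
    cancel, and [grid_sum_near] compares what is left with the driver at [x r]. *)
Lemma young_integral_davie (alpha H : R) : 0 <= H -> 0 <= alpha -> 1 < alpha + gamma ->
  (forall t r, 0 <= r <= t -> t <= T -> `|x t - x r| <= H * (t - r) `^ alpha) ->
  (forall t, 0 <= t <= T -> is_young_integral w s u t (l2v (x t - x 0))) ->
  davie T X (alpha + gamma) x.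
Proof.
move=> H0 al0 z1 xH xI; have T0 := driver_T_ge0 XP; have A0 := driver_C_gt0 XP.
pose B := `|x 0| + H * T `^ alpha.
have xB t : 0 <= t <= T -> `|x t| <= B.
  move=> /andP[t0 tT]; rewrite -[x t](subrK (x 0)) addrC; apply: le_trans (ler_normD _ _) _.
  rewrite lerD2l; apply: le_trans (xH _ _ _ tT) _; first by rewrite lexx.
  by rewrite subr0; apply: ler_wpM2l => //; apply: ge0_ler_powR; rewrite ?nnegrE.
have B0 : 0 <= B by apply: le_trans (xB 0 _); rewrite ?lexx.
have K0 : 0 <= sew_const (alpha + gamma) * (2 * A * B * H).
  apply: mulr_ge0; first by apply: le_trans ler01 (sew_const_ge1 z1).
  by rewrite !mulr_ge0// ltW.
exists (sew_const (alpha + gamma) * (2 * A * B * H)) => // t r rt tT.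
have /andP[r0] := rt; rewrite le_eqVlt => /orP[/eqP <-|r_lt].
  rewrite !subrr sub0r normrN; apply: le_trans (driver_le XP _ _ _ _) _.
  - by rewrite r0 lexx.
  - by case/andP: rt => _ /le_trans; apply.
  have g0 : gamma != 0 by rewrite gt_eqF//; case/andP: (driver_gamma XP) => ? ?; lra.
  by rewrite subrr powR0// mulr0 mul0r mulr_ge0// powR_ge0.
apply/ler_addgt0Pr => eps eps0.
have e20 : 0 < eps / 2 by rewrite divr_gt0.
have tI : 0 <= t <= T by rewrite (le_trans r0 (ltW r_lt)).
have rI : 0 <= r <= T by rewrite r0 (le_trans (ltW r_lt)).
have [eta1 eta10 P1] := young_integral_near tI (xI t tI) e20.
have [eta2 eta20 P2] := young_integral_near rI (xI r rI) e20.
have eta0 : 0 < Num.min eta1 eta2 by rewrite lt_min eta10.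
have tr0 : 0 < t - r by rewrite subr_gt0.
have [n [h [hP nh]]] := grid_exists tr0 eta0.
have [m [h' [h'P mh]]] := grid_exists0 r0 eta0.
have /andP[h0 hle] := hP; have /andP[h'0 h'le] := h'P.
have n0 : (0 < n)%N.
  by rewrite lt0n; apply/eqP => n0; move: nh tr0; rewrite n0 mul0r => <-; rewrite ltxx.
(* The grid of [m] steps of size [h'] up to [r], continued by [n] steps of size [h]; [r = 0]
   corresponds to [m = 0]. *)
pose g i := if (i <= m)%N then i%:R * h' else r + (i - m)%:R * h.
have g1 i : (i <= m)%N -> g i = i%:R * h' by rewrite /g => ->.
have g2 i : g (m + i)%N = r + i%:R * h.
  rewrite /g; case: ifP => [|_]; last by rewrite addKn.
  by rewrite -{2}(addn0 m) leq_add2l leqn0 => /eqP ->; rewrite addn0 mul0r addr0.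
have gS1 i : (i < m)%N -> 0 < g i.+1 - g i <= Num.min eta1 eta2.
  by move=> im; rewrite !g1// 1?ltnW// -mulrBl -natrB// subSnn mul1r.
have gS2 i : 0 < g (m + i).+1 - g (m + i)%N <= Num.min eta1 eta2.
  by rewrite -addnS !g2 opprD addrACA subrr add0r -mulrBl -natrB// subSnn mul1r.
have gS i : (i < m + n)%N -> 0 < g i.+1 - g i <= Num.min eta1 eta2.
  move=> _; have [im|mi] := ltnP i m; first exact: gS1.
  by rewrite -(subnKC mi).
have eta1P i : (i < m + n)%N -> 0 < g i.+1 - g i <= eta1.
  by move=> /gS; rewrite le_min => /and3P[-> -> _].
have eta2P i : (i < m)%N -> 0 < g i.+1 - g i <= eta2.
  by move=> /gS1; rewrite le_min => /and3P[-> _ ->].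
have g00 : g 0%N = 0 by rewrite g1// mul0r.
have gm : g m = r by rewrite g1.
have gmn : g (m + n)%N = t by rewrite g2 nh addrC subrK.
have Q1 := P1 _ g g00 gmn eta1P; have Q2 := P2 _ g g00 gm eta2P.
rewrite big_split_ord/= in Q1; move: Q1 Q2.
set S := \sum_(i < m) _; set S' := \sum_(i < n) _ => Q1 Q2.
have nT : r + n%:R * h <= T by rewrite nh addrC subrK.
have := grid_sum_near H0 al0 z1 r0 (ltW h0) nT xB xH n0.
have -> : grid_sum r h 0 n = S'.
  by rewrite /grid_sum big_mkord; apply: eq_bigr => i _; rewrite -addnS !g2.
rewrite nh [r + _]addrC subrK => Q3.
have -> : x t - x r - X t r (x r) (x r) =
    (S' - X t r (x r) (x r)) + ((S - (x r - x 0)) - (S + S' - (x t - x 0))) by zmod.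
apply: le_trans (ler_normD _ _) _; apply: lerD => //.
apply: le_trans (ler_normB _ _) _; move: Q1 Q2; set a := `|_|; set b := `|_|; lra.
Qed.

End YoungIntegralDavie.

(** * Phase rotations of weighted families *)

Lemma expi0 (R : realType) : expi (0 : R) = 1.
Proof. by rewrite /expi cos0 sin0. Qed.

Lemma expiD (R : realType) (a b : R) : expi (a + b) = expi a * expi b.
Proof. by rewrite /expi cosD sinD; congr (_ +i* _)%C; rewrite addrC. Qed.

Lemma normc_expi (R : realType) (a : R) : normc (expi a) = 1.
Proof. by rewrite /expi /= cos2Dsin2 sqrtr1. Qed.

Lemma conj_expi (R : realType) (a : R) : (expi a)^*%C = expi (- a).
Proof. by rewrite /expi /= cosN sinN. Qed.

Lemma normc_expiM (R : realType) (a : R) (z : R[i]) : normc (expi a * z) = normc z.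
Proof. by rewrite normcM normc_expi mul1r. Qed.

Lemma normc_le_ReIm (R : realType) (z : R[i]) :
  normc z <= `|complex.Re z| + `|complex.Im z|.
Proof.
case: z => a b /=; rewrite -[leRHS]ger0_norm ?addr_ge0// -sqrtr_sqr ler_wsqrtr//.
rewrite sqrrD !real_normK ?num_real// lerD2r lerDl mulrn_wge0// mulr_ge0//.
Qed.

Lemma expi_near (R : realType) (eps : R) : 0 < eps -> exists2 eta : R, 0 < eta &
  forall a b : R, `|a - b| <= eta -> normc (expi a - expi b) <= eps.
Proof.
move=> eps0; have e20 : 0 < eps / 2 by rewrite divr_gt0.
have /cvgrPdist_le/(_ _ e20)/nbhs_norm0P[d1 d10 H1] := @continuous_cos R 0.
have /cvgrPdist_le/(_ _ e20)/nbhs_norm0P[d2 d20 H2] := @continuous_sin R 0.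
have m0 : 0 < Num.min d1 d2 by rewrite lt_min; apply/andP.
exists (Num.min d1 d2 / 2); first by rewrite divr_gt0.
move=> a b ab; have {}ab : `|a - b| < Num.min d1 d2.
  by apply: le_lt_trans ab _; rewrite ltr_pdivrMr// ltr_pMr// ltr1n.
move: ab; rewrite lt_min => /andP[ab1 ab2].
have -> : normc (expi a - expi b) = normc (expi (a - b) - 1).
  rewrite -(normc_expiM b (expi (a - b) - 1)); congr normc.
  by rewrite mulrBr mulr1 -expiD (addrC b) subrK.
apply: le_trans (normc_le_ReIm _) _.
have := H1 _ ab1; have := H2 _ ab2; rewrite /= cos0 sin0 sub0r normrN subr0 distrC => s1 c1.
by rewrite [leRHS]splitr lerD.
Qed.

Section Rotation.
Context {R : realType} {W : int -> {posnum R}}.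
Implicit Types (f g : l2 W) (th : int -> R).

Definition oddphase th := forall n : int, th (- n) = - th n.

(** Odd phases preserve real-valuedness, and cover both the propagator and the translations. *)
Definition rot th f : l2 W := insubd (0 : l2 W) (fun n => expi (th n) * f n).

Lemma l2_bound f (h : coeffs R) (B : R) : real_valued h -> 0 <= B ->
  (forall n, normc (h n) <= B * normc (f n)) ->
  exists2 g : l2 W, l2v g = h & `|g| <= B * `|f|.
Proof.
move=> hr B0 hB; apply: l2_of => //; first exact: mulr_ge0.
move=> K; rewrite exprMn.
apply: le_trans (ler_wpM2l (sqr_ge0 B) (l2_partial_le f K)).
rewrite mulr_sumr; apply: ler_sum => n _; rewrite -exprMn.
rewrite lerXn2r ?nnegrE ?mulr_ge0 ?normc_ge0//.
by rewrite mulrCA; apply: ler_wpM2l.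
Qed.

Lemma real_rot th (f : coeffs R) : oddphase th -> real_valued f ->
  real_valued (fun n => expi (th n) * f n).
Proof. by move=> thN fr n; rewrite thN fr rmorphM -conj_expi. Qed.

Lemma rotE th f : oddphase th -> l2v (rot th f) = (fun n => expi (th n) * f n).
Proof.
move=> thN; have [n|g gE _] := @l2_bound f _ 1 (real_rot thN (@l2_real _ _ f)) ler01.
  by rewrite normc_expiM mul1r.
by rewrite /rot -gE; exact: (congr1 (@l2v R W) (valKd _ g)).
Qed.

Lemma norm_rot_le th f : oddphase th -> `|rot th f| <= `|f|.
Proof.
move=> thN; have [n|g gE gf] := @l2_bound f _ 1 (real_rot thN (@l2_real _ _ f)) ler01.
  by rewrite normc_expiM mul1r.
have -> : rot th f = g by apply: val_inj; rewrite /= rotE.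
by rewrite -[leRHS]mul1r.
Qed.

Lemma rotB th f g : oddphase th -> rot th (f - g) = rot th f - rot th g.
Proof.
move=> thN; apply: val_inj; rewrite /= !rotE//; apply/funext => n.
by rewrite -[RHS]/(expi (th n) * f n - expi (th n) * g n) -mulrBr.
Qed.

(** Continuity in the phase holds for each fixed [f]: once the high frequencies of [f] are cut off,
    the phases need to be close on a finite box only. *)
Lemma rot_near f (eps : R) : 0 < eps -> exists (K : nat) (eta : R), 0 < eta /\
  forall th th', oddphase th -> oddphase th' ->
    (forall n : int, (`|n| <= K)%N -> `|th n - th' n| <= eta) -> `|rot th f - rot th' f| <= eps.
Proof.
move=> eps0; have e4 : 0 < eps / 4 by rewrite divr_gt0.
have [K [g [gK gf fg]]] := l2_truncate f e4.
have e5 : 0 < eps / 4 / (`|f| + 1) by rewrite divr_gt0.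
have [eta eta0 etaP] := expi_near e5.
exists K, eta; split => // th th' thN thN' near.
have gE : `|rot th g - rot th' g| <= eps / 4.
  have hr : real_valued (l2v (rot th g - rot th' g)) by exact: l2_real.
  have [n|h hE hg] := @l2_bound g _ _ hr (ltW e5).
    rewrite -[l2v _ n]/(l2v (rot th g) n - l2v (rot th' g) n) !rotE// -mulrBl normcM.
    have [nK|Kn] := leqP `|n|%N K; last by rewrite gK// ComplexField.Normc.normc0 !mulr0.
    by apply: ler_wpM2r; [exact: normc_ge0|exact/etaP/near].
  rewrite -(val_inj hE); apply: (le_trans hg); rewrite mulrAC ler_pdivrMr//.
  by apply: ler_wpM2l; [exact: ltW|apply: (le_trans gf); rewrite lerDl].
have -> : rot th f - rot th' f =
    rot th (f - g) - rot th' (f - g) + (rot th g - rot th' g).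
  by rewrite !rotB//; zmod.
apply: le_trans (ler_normD _ _) _.
have H1 := le_trans (norm_rot_le (f - g) thN) fg.
have H2 := le_trans (norm_rot_le (f - g) thN') fg.
have H3 := ler_normB (rot th (f - g)) (rot th' (f - g)).
move: gE H1 H2 H3; set a := `|_|; set b := `|_|; set c := `|_|; set e := `|_|; lra.
Qed.

Lemma rot_near_seq (fs : seq (l2 W)) (eps : R) : 0 < eps -> exists (K : nat) (eta : R), 0 < eta /\
  forall f th th', f \in fs -> oddphase th -> oddphase th' ->
    (forall n : int, (`|n| <= K)%N -> `|th n - th' n| <= eta) -> `|rot th f - rot th' f| <= eps.
Proof.
move=> eps0; elim: fs => [|f fs [K [eta [eta0 IH]]]]; first by exists 0%N, 1.
have [K1 [eta1 [eta10 H1]]] := rot_near f eps0.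
exists (maxn K K1), (Num.min eta eta1); split; first by rewrite lt_min eta0.
move=> g th th'; rewrite inE => gfs thN thN' near.
have nearE n : (`|n| <= maxn K K1)%N -> `|th n - th' n| <= eta /\ `|th n - th' n| <= eta1.
  by move/near; rewrite le_min => /andP.
case/orP: gfs => [/eqP ->|gfs].
  by apply: H1 => // n nK; apply: (nearE n _).2; rewrite leq_max nK orbT.
by apply: IH => // n nK; apply: (nearE n _).1; rewrite leq_max nK.
Qed.

Definition l2const (a : R) : l2 W := insubd (0 : l2 W) (const_coeffs a).

Lemma l2constP (a : R) :
  l2v (l2const a) = const_coeffs a /\ `|l2const a| <= (W 0)%:num * `|a|.
Proof.
have cr : real_valued (const_coeffs a).
  by move=> n; rewrite /const_coeffs oppr_eq0; case: ifP => _; rewrite ?conjc_real ?conjc0.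
have Wa0 : 0 <= (W 0)%:num * `|a| by rewrite mulr_ge0.
have [|g gE gB] := l2_of cr Wa0 (W := W).
  move=> K; rewrite /const_coeffs (big_rem 0%Z) ?mem_zbox//= big1_seq ?addr0 => [|n /andP[_]].
    by rewrite ?eqxx /= expr0n addr0 sqrtr_sqr.
  rewrite mem_rem_uniq ?uniq_zbox// inE /= => /andP[/negbTE -> _].
  by rewrite ComplexField.Normc.normc0 mulr0 expr0n.
have -> : l2const a = g by rewrite /l2const -gE; exact: valKd.
by split.
Qed.

End Rotation.

Lemma airyK (R : realType) (a : R) (f : coeffs R) : airy (- a) (airy a f) = f.
Proof.
apply/funext => n; rewrite /airy mulrA -expiD -mulrDl addNr mul0r expi0.
by rewrite mul1r.
Qed.

(** * From solutions of the equation to first-order expansions and back *)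

Section SolutionDavie.
Context {R : realType}.
Variables (w : R -> R) (gamma s T c C A : R) (W : int -> {posnum R}).
Variable X : R -> R -> l2 W -> l2 W -> l2 W.
Hypothesis SW : sobolev_weight s c C W.
Hypothesis XP : young_driver T A gamma X.
Hypothesis XE : forall t r f g, 0 <= r <= t -> t <= T ->
  l2v (X t r f g) = driver w t r f g.
Implicit Types (x : R -> l2 W) (u v : R -> coeffs R).

Lemma solution_mean0_davie (u0 : coeffs R) v : is_solution_mean0 w gamma s T u0 v ->
  exists x z, [/\ 1 < z, davie T X z x, l2v (x 0) = u0
    & forall t, 0 <= t <= T -> v t = airy (w t) (l2v (x t))].
Proof.
have T0 := driver_T_ge0 XP; have c0 := sobolev_c_gt0 SW.
move=> [_ [alpha /andP[al1 al2] [vH [H vh]]] [I vI]].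
have /choice[x xE] t : exists f : l2 W, 0 <= t <= T -> l2v f = interaction w v t.
  have [tT|_] := boolP (0 <= t <= T); last by exists 0.
  by have [g gE] := Hs_l2 SW (vH t tT); exists g.
have ux t : 0 <= t <= T -> interaction w v t = l2v (x t) by move=> /xE.
have zT : 0 <= (0 : R) <= T by rewrite lexx.
(* The empty partition of [[0, 0]] has sum [0], which forces the integral at time [0] to vanish. *)
have I0 : I 0 = 0.
  have [[IH Ilim] _] := vI 0 zT; have [g gE] := Hs_l2 SW IH.
  suff g0 : g = 0 by rewrite -gE g0.
  apply/eqP; rewrite -normr_le0; apply/ler_addgt0Pr => eps eps0; rewrite add0r.
  have ec : 0 < eps * c by rewrite mulr_gt0.
  have [d d0 dP] := Ilim _ ec.
  have p0 : partition_of 0 0 (fun=> 0 : R) by split.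
  have := dP 0%N _ p0 (fun j => ltac:(by [])).
  rewrite /young_sum big_ord0 sub0r -gE -[- l2v g]/(l2v (- g)) => /ltW H1; rewrite -normrN -[leRHS](mulfK (lt0r_neq0 c0)).
  by apply: (l2_le_Hnorm SW (ltW ec)).
have x0E : l2v (x 0) = u0 by rewrite -ux//; have [_ ->] := vI 0 zT; rewrite I0 addr0.
have IE t : 0 <= t <= T -> I t = l2v (x t - x 0).
  move=> tT; have [_ E] := vI t tT.
  by rewrite -[RHS]/(l2v (x t) - l2v (x 0)) x0E -ux// E addrC addKr.
have gP := driver_gamma XP; have /andP[g2 g1] := gP.
have H0 : 0 <= Num.max 0 H by rewrite le_max lexx.
have Hc : 0 <= Num.max 0 H / c by rewrite divr_ge0// ltW.
exists x, (alpha + gamma); split => //; first by move: al1; lra.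
- apply: (young_integral_davie SW XP XE ux Hc) => //; first 2 last.
  + move=> t r /andP[r0 rt] tT.
    have tI : 0 <= t <= T by rewrite (le_trans r0).
    have rI : 0 <= r <= T by rewrite r0 (le_trans rt).
    rewrite mulrAC; apply: (l2_le_Hnorm SW); first by rewrite mulr_ge0 ?powR_ge0.
    rewrite -[l2v _]/(l2v (x t) - l2v (x r)) -!ux//.
    apply: le_trans (vh r t rI tI) _; rewrite lee_fin ger0_norm ?subr_ge0//.
    by apply: ler_wpM2r; [exact: powR_ge0|rewrite le_max lexx orbT].
  + by move=> t tT; rewrite -IE//; case: (vI t tT).
  + by move: al1; lra.
  + by move: al1; lra.
move=> t tT; rewrite -ux// /interaction.
by have := airyK (- w t) (v t); rewrite opprK => ->.
Qed.

Lemma driver0 t r (f g : coeffs R) : driver w t r f g 0 = 0.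
Proof. by rewrite /driver mulr0z mulr0 mul0r. Qed.

(** The Riemann sums of the driver have no zero mode, because of the factor [n], and they converge
    to [x t - x 0]. *)
Lemma davie_mean0 x z t : 1 < z -> davie T X z x -> 0 <= t <= T -> x t 0 = x 0 0.
Proof.
move=> z1 xP tT; have /andP[t0 _] := tT.
suff H : normc ((x t - x 0) 0) <= 0.
  apply/eqP; rewrite -subr_eq0; apply/eqP.
  apply: ComplexField.Normc.eq0_normc; apply/eqP; rewrite eq_le normc_ge0 andbT.
  exact: H.
apply/ler_addgt0Pr => eps eps0; rewrite add0r.
have eW : 0 < eps * (W 0)%:num by rewrite mulr_gt0.
have ux t' : 0 <= t' <= T -> l2v (x t') = l2v (x t') by [].
have [eta eta0 etaP] := young_integral_near SW XE ux tT (davie_young_integral SW XP XE ux z1 xP tT) eW.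
have [n [h [/andP[h0 hle] nh]]] := grid_exists0 t0 eta0.
have := etaP n (fun i => i%:R * h) (mul0r h) nh.
set S := \sum_(i < n) _ => H.
have {}H : `|S - (x t - x 0)| <= eps * (W 0)%:num.
  by apply: H => i _; rewrite -mulrBl -natrB// subSnn mul1r h0.
have S0 : S 0 = 0.
  rewrite /S l2v_sum; elim/big_ind: _ => [//|f g f0 g0|i _].
    by rewrite -[(f + g) 0]/(f 0 + g 0) f0 g0 addr0.
  rewrite XE ?driver0//.
    by rewrite mulr_ge0 ?(ltW h0)//= ler_pM2r// ler_nat.
  case/andP: tT => _; apply: le_trans; rewrite -nh ler_pM2r// ler_nat.
  exact: ltn_ord.
have := le_trans (l2_coef_le _ 0) H.
rewrite mulrC ler_pM2r// => H2; apply: le_trans H2.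
rewrite -[l2v (S - _) 0]/(S 0 - (x t - x 0) 0) S0 sub0r.
by case: ((x t - x 0) 0) => a b /=; rewrite !sqrrN.
Qed.

Lemma davie_solution_mean0 x (B : R) : davie T X (2 * gamma) x ->
  (forall t, 0 <= t <= T -> `|x t| <= B) -> x 0 0 = 0 ->
  is_solution_mean0 w gamma s T (l2v (x 0)) (fun t => airy (w t) (l2v (x t))).
Proof.
move=> xP xB x00; have T0 := driver_T_ge0 XP; have /andP[g2 g1] := driver_gamma XP.
have C0 := sobolev_C_gt0 SW.
have z1 : 1 < 2 * gamma by lra.
have iE t : interaction w (fun t => airy (w t) (l2v (x t))) t = l2v (x t).
  by rewrite /interaction airyK.
have [H H0 xH] := davie_holder XP (ltac:(lra) : gamma <= 2 * gamma) xP xB.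
split.
- by move=> t tT; rewrite /airy (davie_mean0 z1 xP tT) x00 mulr0.
(* The exponent [1 / 2] lies strictly between [1 - gamma] and [gamma] for every admissible
   [gamma]. *)
- exists (1 / 2); first by apply/andP; split; lra.
  split => [t _|]; first by rewrite iE; exact: (l2_Hs SW).
  exists (C * (H * T `^ (gamma - 1 / 2))) => r t.
  wlog rt : r t / r <= t.
    move=> wl rT tT; have [rt|tr] := leP r t; first exact: wl.
    rewrite distrC; apply: le_trans (wl t r (ltW tr) tT rT).
    rewrite le_eqVlt; apply/orP; left; apply/eqP; apply: eq_Hnorm => n.
    rewrite !iE -[(l2v (x t) - _) n]/(l2v (x t) n - l2v (x r) n).
    rewrite -[(l2v (x r) - _) n]/(l2v (x r) n - l2v (x t) n).
    by case: (x t n) (x r n) => a b [a' b'] /=; congr Num.sqrt; ring.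
  move=> /andP[r0 rT] /andP[t0 tT]; rewrite !iE -[l2v _ - _]/(l2v (x t - x r)).
  apply: le_trans (Hnorm_l2_le SW _) _; rewrite lee_fin -mulrA.
  apply: ler_wpM2l; first exact: ltW.
  have := xH t r; rewrite r0 rt tT => /(_ isT isT) H1; apply: (le_trans H1).
  rewrite -mulrA; apply: ler_wpM2l => //.
  have tr0 : 0 <= t - r by rewrite subr_ge0.
  rewrite ger0_norm//; apply: (@le_trans _ _ ((t - r) `^ (gamma - 1 / 2) * (t - r) `^ (1 / 2))).
    by rewrite -powRD subrK// gt_eqF//; lra.
  apply: ler_wpM2r; first exact: powR_ge0.
  by apply: ge0_ler_powR; rewrite ?nnegrE//; lra.
- exists (fun t => l2v (x t - x 0)) => t tT; split.
    by apply: (davie_young_integral SW XP XE _ z1 xP tT) => t' _; exact: iE.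
  by rewrite iE -[l2v (x t - _)]/(l2v (x t) - l2v (x 0)) addrC subrK.
Qed.

(** The propagator and the inverse of the Galilean translation by [2 * a * t], in one rotation:
    [u t] is this rotation of [x t] plus the mean [a]. *)
Definition kdv_phase (a t : R) (n : int) : R := 2 * a * t * n%:~R + w t * n%:~R ^+ 3.

Lemma kdv_phase_odd a t : oddphase (kdv_phase a t).
Proof. by move=> n; rewrite /kdv_phase mulrNz; ring. Qed.

Lemma flowE a t (f : l2 W) :
  l2v (rot (kdv_phase a t) f + l2const a) =
  fun n => expi (kdv_phase a t n) * f n + const_coeffs a n.
Proof.
rewrite -[LHS]/(l2v (rot (kdv_phase a t) f) + l2v (l2const a)).
by rewrite rotE ?(l2constP a).1//; exact: kdv_phase_odd.
Qed.

Lemma expi_const_coeffs (b a : R) n : expi (n%:~R * b) * const_coeffs a n = const_coeffs a n.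
Proof.
rewrite /const_coeffs; case: eqVneq => [->|_]; last by rewrite mulr0.
by rewrite mul0r expi0 mul1r.
Qed.

Lemma solution_davie (u0 : coeffs R) u : is_solution w gamma s T u0 u ->
  exists x z, [/\ 1 < z, davie T X z x, l2v (x 0) = u0 - const_coeffs (mean u0)
    & forall t, 0 <= t <= T ->
        u t = l2v (rot (kdv_phase (mean u0) t) (x t) + l2const (mean u0))].
Proof.
move=> /solution_mean0_davie[x [z [z1 xP x0 xE]]]; exists x, z; split => // t tT.
rewrite flowE; apply/funext => n; set a := mean u0.
have := congr1 (fun f => f n) (xE t tT).
rewrite /galilean -/a /airy -[(_ - _) n]/(translate (2 * a * t) (u t) n - const_coeffs a n).
rewrite /translate => /eqP; rewrite subr_eq => /eqP E.
have -> : u t n = expi (n%:~R * (2 * a * t)) * (expi (- (n%:~R * (2 * a * t))) * u t n).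
  by rewrite mulrA -expiD subrr expi0 mul1r.
rewrite E mulrDr expi_const_coeffs mulrA -expiD; congr (expi _ * _ + _).
by rewrite /kdv_phase mulrC.
Qed.

Lemma davie_solution (u0 : coeffs R) x (B : R) : davie T X (2 * gamma) x ->
  (forall t, 0 <= t <= T -> `|x t| <= B) -> real_valued u0 ->
  l2v (x 0) = u0 - const_coeffs (mean u0) ->
  is_solution w gamma s T u0
    (fun t => l2v (rot (kdv_phase (mean u0) t) (x t) + l2const (mean u0))).
Proof.
move=> xP xB u0r x0E; rewrite /is_solution.
set a := mean u0; rewrite (_ : galilean _ _ = fun t => airy (w t) (l2v (x t))); last first.
  apply/funext => t; rewrite /galilean; apply/funext => n.
  rewrite -[LHS]/(translate (2 * a * t) _ n - const_coeffs a n) /translate flowE.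
  rewrite mulrDr -mulrN expi_const_coeffs addrK mulrA -expiD /airy; congr (expi _ * _).
  by rewrite /kdv_phase; ring.
rewrite -x0E; apply: davie_solution_mean0 xP xB _.
rewrite x0E -[LHS]/(u0 0 - const_coeffs a 0) /const_coeffs eqxx.
have := u0r 0; rewrite oppr0 /a /mean; case: (u0 0) => p q [] /eqP.
by rewrite -addr_eq0 -mulr2n mulrn_eq0 /= => /eqP ->; rewrite subrr.
Qed.

End SolutionDavie.

(** * Global well-posedness *)

(** What is chosen according to the size of the data: the weight with its norm, the constants, and
    the size [M] up to which data are controlled. *)
Record kdv_frame (R : realType) (w : R -> R) (gamma s T c C A kappa M tau : R)
    (W : int -> {posnum R}) (X : R -> R -> l2 W -> l2 W -> l2 W)
    (ip : l2 W -> l2 W -> R) : Prop := KdvFrame {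
  frame_weight : sobolev_weight s c C W;
  frame_driver : young_driver T A gamma X;
  frame_energy : driver_energy T kappa gamma X ip;
  frame_eq : forall t r f g, 0 <= r <= t -> t <= T -> l2v (X t r f g) = driver w t r f g;
  frame_params : young_params T A kappa gamma M tau }.

Lemma kdv_frame_exists (R : realType) (w : R -> R) (rho gamma s T B : R) :
  {within `[0, +oo[, continuous w} -> irregular rho gamma w -> 1 / 2 < gamma < 1 ->
  subcritical rho gamma s -> 0 < T -> 0 <= B ->
  exists c C A kappa M tau (W : int -> {posnum R}) (X : R -> R -> l2 W -> l2 W -> l2 W) ip,
    kdv_frame w gamma s T c C A kappa M tau X ip /\ B / c <= M.
Proof.
move=> wc irr gP sc T0 B0; have /andP[g2 g1] := gP.
have g0 : 0 < gamma by lra.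
have [d [beta [KP b0 sb]]] := subcritical_kernel_params gP sc.
have [D D0 thD] := theta_summable (kp_d KP).
have [Cw Cw0 PhiP] := Phi_le g0 (irr T T0).
have A0 : 0 < driver_const rho s D Cw.
  by rewrite /driver_const ltr_wpDl// mulr_ge0 ?(ltW Cw0)//; exact: bilin_const_ge0.
have k0 : 0 <= energy_const rho s D * Cw.
  by rewrite mulr_ge0 ?(ltW Cw0)//; exact: energy_const_ge0.
have a0 : 0 <= Num.max 0 (- s) by rewrite le_max lexx.
have ab : Num.max 0 (- s) < gamma * beta by rewrite gt_max mulr_gt0.
have [N [M [tau [N1 NM YP]]]] := @young_params_exist R _ _ _ _ _ _ B T0 A0 k0 g2 a0 ab.
exists ((2 * N) `^ Num.max 0 (- s))^-1, ((2 * N) `^ Num.max 0 s).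
exists (driver_const rho s D Cw), (energy_const rho s D * Cw * N `^ (- beta)), M, tau.
exists (iwt N s), (l2driver w (N := N) (s := s)), l2ip; split; last first.
  by rewrite invrK mulrC.
split.
- exact: sobolev_iwt.
- exact: l2_young_driver wc KP N1 D0 thD gP (ltW T0) Cw0 PhiP.
- rewrite mulrAC; exact: l2_driver_energy wc KP N1 D0 thD Cw0 PhiP.
- by move=> t r f g; exact: (l2driverE wc KP N1 D0 thD Cw0 PhiP).
- exact: YP.
Qed.

Lemma normc_sub_mean (R : realType) (f : coeffs R) (n : int) :
  normc ((f - const_coeffs (mean f)) n) <= normc (f n).
Proof.
rewrite -[(f - _) n]/(f n - const_coeffs (mean f) n) /const_coeffs.
case: eqVneq => [->|_]; last by rewrite subr0.
rewrite /mean; case: (f 0) => a b /=; rewrite subrr expr0n add0r subr0.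
by rewrite ler_wsqrtr// lerDr sqr_ge0.
Qed.

Lemma real_sub_mean (R : realType) (f : coeffs R) : real_valued f ->
  real_valued (f - const_coeffs (mean f)).
Proof.
move=> fr n; rewrite -[(f - _) (- n)]/(f (- n) - const_coeffs (mean f) (- n)).
rewrite -[(f - _) n]/(f n - const_coeffs (mean f) n) fr /const_coeffs oppr_eq0.
by case: ifP => _; rewrite ?subr0// rmorphB /= ?conjc_real// oppr0.
Qed.

(** Total boundedness of the path on [[0, T]]. It makes [rot_near_seq], which handles finitely many
    vectors, uniform in time. *)
Lemma holder_net (R : realType) (V : normedZmodType R) (T H gamma eps : R) (x : R -> V) :
  0 < T -> 0 < gamma -> 0 <= H -> 0 < eps ->
  (forall t r, 0 <= r <= t -> t <= T -> `|x t - x r| <= H * (t - r) `^ gamma) ->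
  exists fs : seq V, forall t, 0 <= t <= T -> exists2 f, f \in fs & `|x t - f| <= eps.
Proof.
move=> T0 g0 H0 eps0 xH.
have e0 : 0 < eps / (H + 1) by rewrite divr_gt0// ltr_wpDl.
have [eta eta0 etaP] := powR_small g0 e0.
have [n [h [/andP[h0 hle] nh]]] := grid_exists T0 eta0.
exists [seq x (i%:R * h) | i <- iota 0 n.+1] => t /andP[t0 tT].
have th0 : 0 <= t / h by rewrite divr_ge0// ltW.
have /andP[] := truncn_itv th0; set i := Num.truncn _ => i1 i2.
have ih : i%:R * h <= t by rewrite -ler_pdivlMr.
have ih0 : 0 <= i%:R * h by rewrite mulr_ge0// ltW.
have hi : t - i%:R * h <= h.
  by move: i2; rewrite ltr_pdivrMr// -natr1 mulrDl mul1r => i2; rewrite lerBlDl ltW.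
exists (x (i%:R * h)).
  apply/mapP; exists i => //; rewrite mem_iota add0n leq0n /= ltnS.
  by rewrite -(ler_nat R) -(ler_pM2r h0) nh (le_trans ih).
have ihT : 0 <= i%:R * h <= t by rewrite ih0.
apply: le_trans (xH _ _ ihT tT) _.
apply: (@le_trans _ _ ((H + 1) * (eps / (H + 1)))); last first.
  by rewrite mulrC divfK// gt_eqF// ltr_wpDl.
apply: ler_pM => //; [exact: powR_ge0|by rewrite lerDl|].
by apply: etaP; rewrite subr_ge0 ih (le_trans hi).
Qed.

Section FrameSolutions.
Context {R : realType}.
Variables (w : R -> R) (gamma s T c C A kappa M tau : R) (W : int -> {posnum R}).
Variables (X : R -> R -> l2 W -> l2 W -> l2 W) (ip : l2 W -> l2 W -> R).
Hypothesis KF : kdv_frame w gamma s T c C A kappa M tau X ip.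

Let SW := frame_weight KF.
Let XP := frame_driver KF.
Let EP := frame_energy KF.
Let XE := frame_eq KF.
Let YP := frame_params KF.

Lemma frame_bound (x : R -> l2 W) (z : R) : 1 < z -> davie T X z x -> `|x 0| <= M ->
  forall t, 0 <= t <= T -> `|x t| <= 2 * M.
Proof. exact: davie_apriori XP EP YP. Qed.

Lemma frame_stability : exists2 L : R, 0 <= L & forall (x y : R -> l2 W) (z z' : R),
  1 < z -> 1 < z' -> davie T X z x -> davie T X z' y -> `|x 0| <= M -> `|y 0| <= M ->
  forall t, 0 <= t <= T -> `|x t - y t| <= L * `|x 0 - y 0|.
Proof.
have [T0 M0 tau0 _ tauC _] := YP.
pose Q := (Num.truncn (2 * T / tau)).+1.
have QT : 2 * T <= Q%:R * tau.
  rewrite -ler_pdivrMr//; apply/ltW; rewrite /Q.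
  by case/andP: (truncn_itv (ltW (divr_gt0 (mulr_gt0 (ltr0n _ 2) T0) tau0))).
have M20 : 0 < 2 * M by rewrite mulr_gt0.
have st : 16 * sew_const (2 * gamma) * A * (2 * M) * tau `^ gamma <= 1.
  have -> : 16 * sew_const (2 * gamma) * A * (2 * M) * tau `^ gamma =
    32 * (sew_const (2 * gamma) * A * M * tau `^ gamma) by ring.
  by rewrite mulrC -ler_pdivlMr.
exists (2 ^+ Q); first exact: exprn_ge0.
move=> x y z z' z1 z1' xP yP xM yM t tT.
exact: (davie_stability XP T0 M20 tau0 st QT z1 z1' xP yP
  (frame_bound z1 xP xM) (frame_bound z1' yP yM) tT).
Qed.

Lemma frame_initial (u0 : coeffs R) (B : R) : real_valued u0 -> 0 <= B ->
  (Hnorm s u0 <= B%:E)%E ->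
  exists2 f : l2 W, l2v f = u0 - const_coeffs (mean u0) & `|f| <= B / c.
Proof.
move=> ur B0 uB; apply: (Hs_l2_le SW (real_sub_mean ur) B0).
by apply: le_trans uB; apply: le_Hnorm => n; exact: normc_sub_mean.
Qed.

Lemma frame_solution_exists (u0 : coeffs R) (f : l2 W) : real_valued u0 ->
  l2v f = u0 - const_coeffs (mean u0) -> `|f| <= M ->
  exists u, is_solution w gamma s T u0 u.
Proof.
move=> ur fE fM; have [x xP x0] := davie_exists (@l2_complete R W) XP EP YP fM.
have /andP[g2 _] := driver_gamma XP.
have z1 : 1 < 2 * gamma by lra.
have x0M : `|x 0| <= M by rewrite x0.
exists (fun t => l2v (rot (kdv_phase w (mean u0) t) (x t) + l2const (mean u0))).
apply: (davie_solution SW XP XE xP (frame_bound z1 xP x0M) ur).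
by rewrite x0.
Qed.

Lemma frame_solution_unique (u0 : coeffs R) (f : l2 W) u v :
  l2v f = u0 - const_coeffs (mean u0) -> `|f| <= M ->
  is_solution w gamma s T u0 u -> is_solution w gamma s T u0 v ->
  forall t, 0 <= t <= T -> u t = v t.
Proof.
move=> fE fM /(solution_davie SW XP XE)[x [z [z1 xP x0 uE]]].
move=> /(solution_davie SW XP XE)[y [z' [z1' yP y0 vE]]] t tT.
have xf : x 0 = f by apply: val_inj; rewrite /= x0.
have yf : y 0 = f by apply: val_inj; rewrite /= y0.
have [L _ LP] := frame_stability.
have := LP x y z z' z1 z1' xP yP; rewrite xf yf subrr normr0 mulr0.
move=> /(_ fM fM t tT); rewrite normr_le0 subr_eq0 => /eqP xy.
by rewrite uE// vE// xy.
Qed.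

Lemma davie_frame_holder (x : R -> l2 W) (z : R) : 1 < z -> davie T X z x -> `|x 0| <= M ->
  exists2 H : R, 0 <= H & forall t r, 0 <= r <= t -> t <= T ->
    `|x t - x r| <= H * (t - r) `^ gamma.
Proof.
move=> z1 xP xM; apply: (davie_holder XP _ xP (frame_bound z1 xP xM)).
by have /andP[_ g1] := driver_gamma XP; lra.
Qed.

End FrameSolutions.

Section FrameContinuity.
Context {R : realType}.
Variables (w : R -> R) (gamma s T c C A kappa M tau : R) (W : int -> {posnum R}).
Variables (X : R -> R -> l2 W -> l2 W -> l2 W) (ip : l2 W -> l2 W -> R).
Hypothesis wc : {within `[0, +oo[, continuous w}.
Hypothesis KF : kdv_frame w gamma s T c C A kappa M tau X ip.

Let SW := frame_weight KF.
Let XP := frame_driver KF.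
Let XE := frame_eq KF.

Lemma within_continuous_dist (t eps : R) : 0 <= t -> 0 < eps ->
  exists2 d : R, 0 < d & forall t', 0 <= t' -> `|t' - t| < d -> `|w t' - w t| <= eps.
Proof.
move=> t0 eps0; have tI : `[0, +oo[%classic t by rewrite /= in_itv/= andbT.
have /subspace_continuousP/(_ t tI)/cvgrPdist_le/(_ _ eps0) := wc.
rewrite near_withinE => /nbhs_normP[d d0 H]; exists d => // t' t'0 td.
rewrite distrC; apply: H; last by rewrite /= in_itv/= andbT.
by rewrite /= distrC.
Qed.

Lemma phase_near_time (a t eta : R) (K : nat) : 0 <= t -> 0 < eta ->
  exists2 d : R, 0 < d & forall t', 0 <= t' -> `|t' - t| < d ->
    forall n : int, (`|n| <= K)%N -> `|kdv_phase w a t' n - kdv_phase w a t n| <= eta.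
Proof.
move=> t0 eta0.
have e1 : 0 < eta / 2 / (K%:R ^+ 3 + 1) by rewrite !divr_gt0.
have e2 : 0 < eta / 2 / (`|2 * a| * K%:R + 1) by rewrite !divr_gt0.
have [d d0 dP] := within_continuous_dist t0 e1.
exists (Num.min d (eta / 2 / (`|2 * a| * K%:R + 1))); first by rewrite lt_min d0.
move=> t' t'0; rewrite lt_min => /andP[/(dP _ t'0) w1 /ltW t1] n nK.
have nR : `|n%:~R : R| <= K%:R by rewrite -intr_norm -natr_absz ler_nat.
have -> : kdv_phase w a t' n - kdv_phase w a t n =
    2 * a * (t' - t) * n%:~R + (w t' - w t) * n%:~R ^+ 3 by rewrite /kdv_phase; ring.
apply: le_trans (ler_normD _ _) _; rewrite (splitr eta) (normrM (w t' - w t)) normrX.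
rewrite (normrM (2 * a * (t' - t))) (normrM (2 * a)); apply: lerD.
  move: t1; rewrite ler_pdivlMr// => t1; apply: le_trans t1.
  rewrite mulrAC mulrC; apply: ler_wpM2l => //.
  apply: (@le_trans _ _ (`|2 * a| * K%:R)); last by rewrite lerDl.
  by apply: ler_wpM2l.
move: w1; rewrite ler_pdivlMr// => w1; apply: le_trans w1; apply: ler_wpM2l => //.
apply: (@le_trans _ _ (K%:R ^+ 3)); last by rewrite lerDl.
by rewrite lerXn2r// nnegrE.
Qed.

Lemma holder_dist (H : R) (x : R -> l2 W) (t eps : R) : 0 <= H -> 0 < eps ->
  (forall t r, 0 <= r <= t -> t <= T -> `|x t - x r| <= H * (t - r) `^ gamma) ->
  0 <= t <= T -> exists2 d : R, 0 < d & forall t', 0 <= t' <= T -> `|t' - t| < d ->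
    `|x t' - x t| <= eps.
Proof.
move=> H0 eps0 xH /andP[t0 tT]; have g0 : 0 < gamma by have /andP[? _] := driver_gamma XP; lra.
have e0 : 0 < eps / (H + 1) by rewrite divr_gt0// ltr_wpDl.
have [d d0 dP] := powR_small g0 e0; exists d => // t' /andP[t'0 t'T] td.
have E : H * `|t' - t| `^ gamma <= eps.
  apply: (@le_trans _ _ ((H + 1) * (eps / (H + 1)))); last first.
    by rewrite mulrC divfK// gt_eqF// ltr_wpDl.
  apply: ler_pM; [exact: H0|exact: powR_ge0|by rewrite lerDl|].
  by apply: dP; rewrite normr_ge0 ltW.
apply: le_trans E; have [tt'|t't] := leP t t'.
  by rewrite [`|t' - t|]ger0_norm ?subr_ge0// xH// t0.
by rewrite distrC [`|t' - t|]distrC [`|t - t'|]ger0_norm ?subr_ge0 ?(ltW t't)// xH ?t'0 ?(ltW t't).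
Qed.

Lemma frame_continuous (u0 : coeffs R) (f : l2 W) u :
  l2v f = u0 - const_coeffs (mean u0) -> `|f| <= M ->
  is_solution w gamma s T u0 u -> continuous_Hs T s u.
Proof.
move=> fE fM /(solution_davie SW XP XE)[x [z [z1 xP x0 uE]]].
have C0 := sobolev_C_gt0 SW.
have xM : `|x 0| <= M by have -> : x 0 = f by apply: val_inj; rewrite /= x0.
have [H H0 xH] := davie_frame_holder KF z1 xP xM.
split=> [t tT|t tT eps eps0]; first by rewrite uE//; exact: (l2_Hs SW).
have /andP[t0 _] := tT.
have e0 : 0 < eps / C / 4 by rewrite !divr_gt0.
have [d1 d10 P1] := holder_dist H0 e0 xH tT.
have [K [eta [eta0 P2]]] := rot_near (x t) e0.
have [d2 d20 P3] := phase_near_time (mean u0) K t0 eta0.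
exists (Num.min d1 d2) => [|t' t'T]; first by rewrite lt_min d10.
rewrite lt_min => /andP[td1 td2]; rewrite !uE//.
set a := mean u0; set F' := rot _ (x t') + _; set F := rot _ _ + _.
rewrite -[l2v F' - l2v F]/(l2v (F' - F)).
apply: le_lt_trans (Hnorm_l2_le SW _) _; rewrite lte_fin.
have th r := kdv_phase_odd w a r.
have -> : F' - F = rot (kdv_phase w a t') (x t' - x t)
    + (rot (kdv_phase w a t') (x t) - rot (kdv_phase w a t) (x t)).
  by rewrite rotB// /F' /F; zmod.
have /andP[t'0 _] := t'T.
have Q1 := le_trans (norm_rot_le (x t' - x t) (th t')) (P1 t' t'T td1).
have Q2 := P2 _ _ (th t') (th t) (P3 t' t'0 td2).
have Q3 := le_trans (ler_normD _ _) (lerD Q1 Q2).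
apply: (le_lt_trans (ler_wpM2l (ltW C0) Q3)).
have -> : C * (eps / C / 4 + eps / C / 4) = eps / 2 by field; rewrite gt_eqF.
by rewrite ltr_pdivrMr// ltr_pMr// ltr1n.
Qed.

Lemma mean_diff_le (u0 v0 : coeffs R) (g : l2 W) : l2v g = v0 - u0 ->
  (W 0)%:num * `|mean v0 - mean u0| <= `|g|.
Proof.
move=> gE; apply: le_trans (l2_coef_le g 0); apply: ler_wpM2l => //.
rewrite gE -[(v0 - u0) 0]/(v0 0 - u0 0) /mean -raddfB.
exact: (normc_ReIm_le _).1.
Qed.

(** Removing the means costs at most a factor [2], since the norm of [g] also controls the
    difference of the means. *)
Lemma frame_initial_diff (u0 v0 : coeffs R) (f f' g : l2 W) :
  l2v f = u0 - const_coeffs (mean u0) -> l2v f' = v0 - const_coeffs (mean v0) ->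
  l2v g = v0 - u0 -> `|f' - f| <= 2 * `|g|.
Proof.
move=> fE f'E gE; have [cE cB] := l2constP (W := W) (mean v0 - mean u0).
have -> : f' - f = g - l2const (mean v0 - mean u0).
  apply: val_inj; rewrite -[LHS]/(l2v f' - l2v f) -[RHS]/(l2v g - l2v (l2const _)).
  rewrite fE f'E gE cE; apply/funext => n.
  rewrite -[LHS]/(v0 n - const_coeffs _ n - (u0 n - const_coeffs _ n)).
  rewrite -[RHS]/(v0 n - u0 n - const_coeffs _ n) /const_coeffs.
  by case: ifP => _; rewrite ?rmorphB /=; ring.
apply: le_trans (ler_normB _ _) _; have := le_trans cB (mean_diff_le gE); lra.
Qed.

(** Data with different means are rotated by phases whose difference is unbounded in the frequency,
    so the Lipschitz bound on [x] does not carry over directly to [u]. The two phases are compared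
    on a finite net of the path [x] only; the remaining terms are rotations of small vectors and the
    difference of the means. *)
Lemma frame_map_continuous (u0 : coeffs R) (f : l2 W) u (m eps : R) : real_valued u0 ->
  l2v f = u0 - const_coeffs (mean u0) -> 0 < m -> `|f| + m <= M ->
  is_solution w gamma s T u0 u -> 0 < eps ->
  exists2 delta : R, 0 < delta & forall (v0 : coeffs R) v,
    Hs s v0 -> is_solution w gamma s T v0 v -> (Hnorm s (v0 - u0) < delta%:E)%E ->
    forall t, 0 <= t <= T -> (Hnorm s (v t - u t) < eps%:E)%E.
Proof.
move=> ur fE m0 fM /(solution_davie SW XP XE)[x [z [z1 xP x0 uE]]] eps0.
have C0 := sobolev_C_gt0 SW; have c0 := sobolev_c_gt0 SW.
have T0 := params_T_gt0 (frame_params KF).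
have g0 : 0 < gamma by have /andP[? _] := driver_gamma XP; lra.
have xf : x 0 = f by apply: val_inj; rewrite /= x0.
have xM : `|x 0| <= M by rewrite xf; apply: le_trans fM; rewrite lerDl ltW.
have [H H0 xH] := davie_frame_holder KF z1 xP xM.
have [L L0 LP] := frame_stability KF.
have e0 : 0 < eps / C / 8 by rewrite !divr_gt0.
have [fs fsP] := holder_net T0 g0 H0 e0 xH.
have [K [eta [eta0 near]]] := rot_near_seq fs e0.
have L1 : 0 < 2 * L + 1 by rewrite ltr_wpDl// mulr_ge0.
have W00 : 0 < (W 0)%:num by [].
have TK : 0 < 2 * T * K%:R + 1 by rewrite ltr_wpDl// mulr_ge0// mulr_ge0// ltW.
(* In this order: the new datum stays below [M], the Lipschitz and mean terms are small, the phases
   are close on the box of size [K] for all times up to [T]. *)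
pose del := Num.min (m / 2) (Num.min (eps / C / 8 / (2 * L + 1))
  (eta / (2 * T * K%:R + 1) * (W 0)%:num)).
have del0 : 0 < del by rewrite !lt_min !divr_gt0//= mulr_gt0// divr_gt0.
exists (del * c) => [|v0 v [vr vfin]]; first exact: mulr_gt0.
move=> /(solution_davie SW XP XE)[y [z' [z1' yP y0 vE]]] /ltW vu t tT.
have dr : real_valued (v0 - u0).
  by move=> n; rewrite -[LHS]/(v0 (- n) - u0 (- n)) vr ur -rmorphB.
have [g gE] := Hs_l2_le SW dr (ltW (mulr_gt0 del0 c0)) vu.
rewrite mulfK ?gt_eqF// !le_min => /and3P[gm gL geta].
have y0E : l2v (y 0) = v0 - const_coeffs (mean v0) by [].
have yx := frame_initial_diff fE y0E gE.
have yM : `|y 0| <= M.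
  rewrite -[y 0](subrK f) addrC; apply: le_trans (ler_normD _ _) _.
  by apply: le_trans fM; rewrite lerD2l; move: yx gm; lra.
have mean_g := mean_diff_le gE.
rewrite uE// vE//; set a := mean u0 in mean_g *; set b := mean v0 in mean_g *.
set F' := rot _ (y t) + _; set F := rot _ _ + _; rewrite -[l2v F' - l2v F]/(l2v (F' - F)).
apply: le_lt_trans (Hnorm_l2_le SW _) _; rewrite lte_fin.
have tha := kdv_phase_odd w a t; have thb := kdv_phase_odd w b t.
have [h hfs xh] := fsP t tT.
have cE : l2const b - l2const a = l2const (b - a) :> l2 W.
  apply: val_inj; rewrite -[LHS]/(l2v (l2const b) - l2v (l2const a)) /= !(l2constP _).1.
  apply/funext => n; rewrite -[LHS]/(const_coeffs b n - const_coeffs a n) /const_coeffs.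
  by case: ifP => _; rewrite ?rmorphB ?subr0.
have -> : F' - F = rot (kdv_phase w b t) (y t - x t) + (rot (kdv_phase w b t) (x t - h)
    - rot (kdv_phase w a t) (x t - h)
    + (rot (kdv_phase w b t) h - rot (kdv_phase w a t) h) + l2const (b - a)).
  by rewrite !rotB// -cE /F' /F; zmod.
have Q1 : `|rot (kdv_phase w b t) (y t - x t)| <= L * (2 * `|g|).
  apply: le_trans (norm_rot_le _ thb) _; rewrite distrC.
  apply: le_trans (LP _ _ _ _ z1 z1' xP yP xM yM t tT) _.
  by rewrite distrC xf; apply: ler_wpM2l.
have Q2 := le_trans (norm_rot_le (x t - h) thb) xh.
have Q3 := le_trans (norm_rot_le (x t - h) tha) xh.
have Q4 : `|rot (kdv_phase w b t) h - rot (kdv_phase w a t) h| <= eps / C / 8.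
  apply: near => // n nK.
  have nR : `|n%:~R : R| <= K%:R by rewrite -intr_norm -natr_absz ler_nat.
  have -> : kdv_phase w b t n - kdv_phase w a t n = (b - a) * (2 * t * n%:~R).
    by rewrite /kdv_phase; ring.
  have /andP[t0 tT'] := tT.
  have ba : `|b - a| <= eta / (2 * T * K%:R + 1).
    by rewrite -(ler_pM2r W00) mulrC; apply: le_trans mean_g geta.
  move: ba; rewrite ler_pdivlMr// => ba; apply: le_trans ba; rewrite normrM.
  apply: ler_wpM2l => //; rewrite !normrM (ger0_norm t0) (ger0_norm (ler0n R 2)).
  apply: (@le_trans _ _ (2 * T * K%:R)); last by rewrite lerDl.
  by apply: ler_pM => //; [rewrite mulr_ge0|apply: ler_wpM2l].
have Q5 := le_trans (l2constP (W := W) (b - a)).2 mean_g.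
have gL' : `|g| * (2 * L + 1) <= eps / C / 8 by rewrite -ler_pdivlMr.
have tot : `|rot (kdv_phase w b t) (y t - x t) + (rot (kdv_phase w b t) (x t - h)
    - rot (kdv_phase w a t) (x t - h)
    + (rot (kdv_phase w b t) h - rot (kdv_phase w a t) h) + l2const (b - a))|
    <= eps / C / 8 * 4.
  apply: le_trans (ler_normD _ _) _.
  apply: le_trans (lerD Q1 (le_trans (ler_normD _ _) (lerD (le_trans (ler_normD _ _)
    (lerD (le_trans (ler_normB _ _) (lerD Q2 Q3)) Q4)) Q5))) _.
  have arith (e p : R) : L * (2 * p) + (e + e + e + p) = p * (2 * L + 1) + (e + e + e) by ring.
  rewrite arith [leRHS](_ : _ = eps / C / 8 + (eps / C / 8 + eps / C / 8 + eps / C / 8)).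
    by rewrite lerD2r.
  by set e := eps / C / 8; ring.
apply: (le_lt_trans (ler_wpM2l (ltW C0) tot)).
have -> : C * (eps / C / 8 * 4) = eps / 2 by field; rewrite gt_eqF.
by rewrite ltr_pdivrMr// ltr_pMr// ltr1n.
Qed.

End FrameContinuity.

Lemma subcritical_well_posed (R : realType) (w : R -> R) (rho gamma s : R) :
  {within `[0, +oo[, continuous w} -> irregular rho gamma w -> 1 / 2 < gamma < 1 ->
  subcritical rho gamma s -> globally_well_posed w gamma s.
Proof.
move=> wc irr gP sc T T0; split.
- move=> u0 uH; have [B B0 uB] := Hs_bound uH; have [ur _] := uH.
  have [c [C [A [kappa [M [tau [W [X [ip [KF BM]]]]]]]]]] :=
    kdv_frame_exists wc irr gP sc T0 B0.
  have [f fE /le_trans/(_ BM) fM] := frame_initial KF ur B0 uB.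
  have [u uS] := frame_solution_exists KF ur fE fM.
  exists u => // v vS t tT; exact: (frame_solution_unique KF fE fM vS uS tT).
- move=> u0 u uH uS; have [B B0 uB] := Hs_bound uH; have [ur _] := uH.
  have [c [C [A [kappa [M [tau [W [X [ip [KF BM]]]]]]]]]] :=
    kdv_frame_exists wc irr gP sc T0 B0.
  have [f fE /le_trans/(_ BM) fM] := frame_initial KF ur B0 uB.
  exact: (frame_continuous wc KF fE fM uS).
- move=> u0 u uH uS eps eps0; have [B B0 uB] := Hs_bound uH; have [ur _] := uH.
  (* A frame for size [B + 1] leaves the room [1 / c] for neighbouring data. *)
  have B10 : 0 <= B + 1 by rewrite addr_ge0.
  have [c [C [A [kappa [M [tau [W [X [ip [KF BM]]]]]]]]]] :=
    kdv_frame_exists wc irr gP sc T0 B10.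
  have c0 := sobolev_c_gt0 (frame_weight KF).
  have [f fE fB] := frame_initial KF ur B0 uB.
  have m0 : 0 < 1 / c by rewrite divr_gt0.
  have fM : `|f| + 1 / c <= M by apply: le_trans BM; rewrite mulrDl lerD2r.
  exact: (frame_map_continuous KF ur fE m0 fM uS eps0).
Qed.

Unset Implicit Arguments.

Theorem theorem1p5 (R : realType) (rho gamma s : R) (w : R -> R)
  (hrho : 1 / 2 < rho) (hgamma : 1 / 2 < gamma < 1)
  (hcont : {within `[0, +oo[, continuous w}) (hw0 : w 0 = 0)
  (hirr : irregular rho gamma w)
  (hs :
    (* (i) *)
    [/\ 1 / 2 < rho, rho <= 3 * gamma / (6 * gamma - 2)
      & s > (3 / 2 - 3 * rho) * gamma] \/
    (* (ii) *)
    [/\ 3 * gamma / (6 * gamma - 2) < rho, rho <= 3 / 2 & s >= - rho] \/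
    (* (iii) *)
    (1 / 2 < gamma < (Num.sqrt 5 - 1) / 2 /\
      ([/\ 3 / 2 <= rho,
           rho < 3 * (1 - gamma) ^+ 2 / (2 * (- gamma ^+ 2 - gamma + 1))
         & s >= - rho] \/
       (rho >= 3 * (1 - gamma) ^+ 2 / (2 * (- gamma ^+ 2 - gamma + 1)) /\
        s > - ((4 * rho * (2 * gamma - 1) + 3 * (1 - gamma) ^+ 2)
               / (2 * (- gamma ^+ 2 + 3 * gamma - 1)))))) \/
    (* (iv) *)
    [/\ (Num.sqrt 5 - 1) / 2 <= gamma < 1, rho >= 3 / 2 & s >= - rho]) :
  globally_well_posed w gamma s.
Proof.
exact: (subcritical_well_posed hcont hirr hgamma
  (admissible_subcritical hrho hgamma hs)).
Qed.
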